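(* $\mathbb{D}^{1,2}\cap W^*(\{S_t,t\ge0\})$ does not contain non-trivial projections; that is, if $p=p^*=p^2\in W^*(\{S_t,t\ge0\})$ is a projection, then $p\in\mathbb{D}^{1,2}$ if and only if $p\in\{0,1\}$.
   Context: Setting. Inner products are linear in the first variable. On the full Fock space $\mathbb{C}\Omega\oplus\bigoplus_{n\ge1}L^2(\mathbb{R}_+)^{\otimes n}$ (complex $L^2$, $\|\Omega\|=1$), let $l(h)$ be the left creation operator, $l(h)\Omega=h$, $l(h)(g_1\otimes\cdots\otimes g_n)=h\otimes g_1\otimes\cdots\otimes g_n$, and for real-valued $h\in L^2_{\mathbb{R}}(\mathbb{R}_+)$ let $S(h)=l(h)+l(h)^*$. $S_t=S(\mathbf{1}_{[0,t]})$ is the free Brownian motion, and $\mathcal{SC}=W^*(\{S_t,t\ge0\})$ is the von Neumann algebra generated by it, equivalently by $\{S(h):h\in L^2_{\mathbb{R}}(\mathbb{R}_+)\}$; $\tau(X)=\langle X\Omega,\Omega\rangle$ is its faithful normal tracial state; $L^2(\mathcal{SC})$ has inner product $\langle X,Y\rangle=\tau(Y^*X)$. $\mathcal{SC}_{alg}$ is the unital $*$-algebra generated by the $S(h)$, $h\in L^2_{\mathbb{R}}(\mathbb{R}_+)$. Malliavin derivative. $\mathcal{B}_2=L^2(\mathbb{R}_+;L^2(\mathcal{SC}\otimes\mathcal{SC}^{op},\tau\otimes\tau^{op}))$. $\nabla:\mathcal{SC}_{alg}\to\mathcal{B}_2$, $A\mapsto(\nabla_tA)_{t\ge0}$, is the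 linear map with $\nabla_tS(h)=h(t)\,1\otimes1$ and $\nabla_t(AB)=A\cdot\nabla_tB+\nabla_tA\cdot B$, where $A\cdot(x\otimes y)\cdot B=Ax\otimes yB$. It is closable from $L^2(\mathcal{SC})$ to $\mathcal{B}_2$; its closure is still denoted $\nabla$, with domain $\mathbb{D}^{1,2}$, the completion of $\mathcal{SC}_{alg}$ for $\|F\|_{1,2}^2=\|F\|_2^2+\|\nabla F\|_{\mathcal{B}_2}^2$. *)

(* Defs.v *)
From HB Require Import structures.
From mathcomp Require Import all_boot all_order all_algebra.
From mathcomp Require Import all_classical all_reals all_analysis.
From mathcomp Require Import measurable_realfun complex ring lra.
Set Implicit Arguments.
Unset Strict Implicit.
Unset Printing Implicit Defensive.
Import Order.TTheory GRing.Theory Num.Theory.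
Import numFieldNormedType.Exports.
Local Open Scope classical_set_scope.
Local Open Scope ring_scope.

Section L2.
Variable R : realType.

Definition half_line : set R := `[0, +oo[.

(* Square-integrable functions R_+ -> C, not quotiented by a.e. equality; values
   at negative arguments are irrelevant. *)
Record l2 := L2 {
  l2_fun :> R -> R[i];
  l2_mRe : measurable_fun half_line (fun t => complex.Re (l2_fun t));
  l2_mIm : measurable_fun half_line (fun t => complex.Im (l2_fun t));
  l2_fin : (\int[lebesgue_measure]_(t in half_line)
     (complex.Re (l2_fun t) ^+ 2 + complex.Im (l2_fun t) ^+ 2)%:E < +oo)%E }.

Definition l2_dot (f g : l2) : R[i] := Complex
  (\int[lebesgue_measure]_(t in half_line) complex.Re (f t * Num.conj (g t)))
  (\int[lebesgue_measure]_(t in half_line) complex.Im (f t * Num.conj (g t))).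

(* <f1 (x) .. (x) fm, g1 (x) .. (x) gn>, which is 0 when m and n differ; the
   empty sequence stands for the vacuum. *)
Fixpoint tens_dot (s s' : seq l2) : R[i] :=
  match s, s' with
  | [::], [::] => 1
  | f :: s, g :: s' => l2_dot f g * tens_dot s s'
  | _, _ => 0
  end.

Lemma half_line_measurable : measurable half_line.
Proof. exact: measurable_itv. Qed.

Section indicator.
Variable t : R.
Let f (x : R) : R[i] := Complex (\1_`[0, t] x) 0.

Lemma l2_indic_mRe : measurable_fun half_line (fun x => complex.Re (f x)).
Proof. exact: measurable_indic. Qed.

Lemma l2_indic_mIm : measurable_fun half_line (fun x => complex.Im (f x)).
Proof. exact: measurable_cst. Qed.

Lemma l2_indic_fin : (\int[lebesgue_measure]_(x in half_line)
  (complex.Re (f x) ^+ 2 + complex.Im (f x) ^+ 2)%:E < +oo)%E.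
Proof.
under eq_integral => x _.
  rewrite [X in X%:E](_ : _ = \1_`[0, t] x); last first.
    by rewrite /= expr0n addr0 indicE; case: (_ \in _); rewrite ?expr1n ?expr0n.
  over.
rewrite integral_indic//; last exact: half_line_measurable.
apply: (@le_lt_trans _ _ (lebesgue_measure `[0, t])).
  apply: le_measure; rewrite ?inE//.
  by apply: measurableI => //; exact: half_line_measurable.
by rewrite lebesgue_measure_itv/=; case: ifPn => // _; rewrite ltry.
Qed.

Definition l2_indic : l2 := L2 l2_indic_mRe l2_indic_mIm l2_indic_fin.
End indicator.

End L2.

Definition is_adjoint (R : realType) (H : lmodType R[i])
  (dot : H -> H -> R[i]) (A B : H -> H) :=
  forall x y, dot (A x) y = dot x (B y).

Definition bounded_op (R : realType) (H : normedModType R[i]) : set (H -> H) :=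
  [set A | linear A /\ continuous A].

(* The full Fock space over L^2(R_+), as a Hilbert space with a total family of
   elementary tensors having the prescribed inner products: this determines the
   Hilbert sum of the Hilbert tensor powers, together with the creation
   operators, up to a unique unitary. A model is built below in
   [FockModel.full_fock_inhabited]. *)
Record full_fock (R : realType) := FullFock {
  fock :> completeNormedModType R[i];
  fdot : {dot fock for (@Num.conj R[i])};
  fdotE : forall x, fdot x x = `|x| ^+ 2;
  tens : seq (l2 R) -> fock;
  fdot_tens : forall s s', fdot (tens s) (tens s') = tens_dot s s';
  tens_total : forall (x : fock) (e : R[i]), 0 < e ->
    exists n (c : 'I_n -> R[i]) (s : 'I_n -> seq (l2 R)),
      `|x - \sum_(i < n) c i *: tens (s i)| < e;
  create : l2 R -> fock -> fock;
  create_bounded : forall h, bounded_op (create h);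
  create_tens : forall h s, create h (tens s) = tens (h :: s);
  create_adj : forall h, exists B, is_adjoint fdot (create h) B
}.

Section FreeMalliavin.
Variables (R : realType) (F : full_fock R).
Implicit Types (A B X Y p : F -> F) (h : l2 R).
Local Notation op := (F -> F).

Definition vacuum : F := tens F [::].

(* Every operator occurring below has an adjoint, which is then unique; the
   default value 0 is never reached. *)
Definition adj A : op := xget 0 [set B | is_adjoint (@fdot _ F) A B].

Definition semicircular h : op := create h + adj (create h).

Definition commutant (M : set op) : set op :=
  [set B | bounded_op B /\ forall A, M A -> A \o B = B \o A].

(* As the S_t are self-adjoint, the von Neumann algebra that they generate is
   their bicommutant. *)
Definition SC : set op :=
  commutant (commutant
    [set A | exists2 t : R, 0 <= t & A = semicircular (l2_indic t)]).

Definition tau A : R[i] := fdot F (A vacuum) vacuum.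

Definition tau_dot X Y : R[i] := tau (adj Y \o X).

(* The inner product of L^2(SC^op, tau^op): the product of SC^op is reversed. *)
Definition tau_op_dot X Y : R[i] := tau (X \o adj Y).

(* A sequence [:: (x1, y1); ...; (xn, yn)] stands for the sum of the elementary
   tensors xk (x) yk in the algebraic tensor product of SC and SC^op. *)
Definition tensor := seq (op * op).

Definition tensor_scale (c : R[i]) (u : tensor) : tensor :=
  [seq (c *: xy.1, xy.2) | xy <- u].

Definition tensor_sub (u v : tensor) : tensor := u ++ tensor_scale (- 1) v.

Definition tensor_lact A (u : tensor) : tensor := [seq (A \o xy.1, xy.2) | xy <- u].

Definition tensor_ract (u : tensor) B : tensor := [seq (xy.1, xy.2 \o B) | xy <- u].

Definition tensor_dot (u v : tensor) : R[i] :=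
  \sum_(x <- u) \sum_(y <- v) tau_dot x.1 y.1 * tau_op_dot x.2 y.2.

(* The squared norm of L^2(R_+; L^2(SC (x) SC^op, tau (x) tau^op)). *)
Definition B2_normsq (u : R -> tensor) : \bar R :=
  (\int[lebesgue_measure]_(t in @half_line R)
     (complex.Re (tensor_dot (u t) (u t)))%:E)%E.

(* The graph of the derivative on the unital algebra generated by the S(h), h
   real-valued, which is a *-algebra since these S(h) are self-adjoint. The
   first rule is forced by the Leibniz rule. *)
Inductive malliavin : op -> (R -> tensor) -> Prop :=
| malliavin1 : malliavin idfun (fun=> [::])
| malliavinS h : (forall t, complex.Im (h t) = 0) ->
    malliavin (semicircular h) (fun t => [:: (h t *: (idfun : op), idfun)])
| malliavinD A B u v : malliavin A u -> malliavin B v ->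
    malliavin (A + B) (fun t => u t ++ v t)
| malliavinZ (c : R[i]) A u : malliavin A u ->
    malliavin (c *: A) (fun t => tensor_scale c (u t))
| malliavinM A B u v : malliavin A u -> malliavin B v ->
    malliavin (A \o B) (fun t => tensor_lact A (v t) ++ tensor_ract (u t) B).

Definition norm12sq A (u : R -> tensor) : \bar R :=
  ((complex.Re (tau_dot A A))%:E + B2_normsq u)%E.

(* [D12 X]: the class of X in L^2(SC) lies in the completion of the algebra for
   the graph norm, i.e. X is the limit in L^2(SC) of a sequence in the algebra
   which is Cauchy for the graph norm. *)
Definition D12 X := exists (A : nat -> op) (u : nat -> R -> tensor),
  [/\ forall n, malliavin (A n) (u n),
      forall e : R, 0 < e -> exists N, forall m n, (N <= m)%N -> (N <= n)%N ->
        (norm12sq (A m - A n)%R (fun t => tensor_sub (u m t) (u n t)) < e%:E)%E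
    & (fun n => complex.Re (tau_dot (A n - X) (A n - X))) @ \oo --> (0 : R)].

Definition is_projection p := is_adjoint (@fdot _ F) p p /\ p \o p = p.

End FreeMalliavin.

(* A model of [full_fock]: the completion of the linear span of the words in l2
   for the positive semidefinite kernel [tens_dot]. A vector is encoded by its
   inner products with the words. *)
Module FockModel.

Section Cint.
Variable R : realType.
Local Notation C := R[i].
Local Notation mu := (@lebesgue_measure R).
Local Notation D := (@half_line R).
Local Notation Re := (@complex.Re R).
Local Notation Im := (@complex.Im R).

Lemma ReM (x y : C) : Re (x * y) = Re x * Re y - Im x * Im y.
Proof. by case: x; case: y. Qed.
Lemma ImM (x y : C) : Im (x * y) = Re x * Im y + Im x * Re y.
Proof. by case: x; case: y. Qed.
Lemma ReD (x y : C) : Re (x + y) = Re x + Re y.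
Proof. by case: x; case: y. Qed.
Lemma ImD (x y : C) : Im (x + y) = Im x + Im y.
Proof. by case: x; case: y. Qed.
Lemma ReJ (x : C) : Re (Num.conj x) = Re x.
Proof. by case: x. Qed.
Lemma ImJ (x : C) : Im (Num.conj x) = - Im x.
Proof. by case: x. Qed.
Lemma ReIm_eq (x y : C) : Re x = Re y -> Im x = Im y -> x = y.
Proof. by case: x y => a b [c d] /= -> ->. Qed.

Definition cint (f : R -> C) : C := Complex
  (\int[mu]_(t in D) Re (f t)) (\int[mu]_(t in D) Im (f t)).

Definition cintegrable (f : R -> C) :=
  mu.-integrable D (fun t => (Re (f t))%:E) /\
  mu.-integrable D (fun t => (Im (f t))%:E).

Lemma mD : measurable (D : set (measurableTypeR R)). Proof. exact: half_line_measurable. Qed.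

Lemma eq_cint f g : f =1 g -> cint f = cint g.
Proof. by move=> /funext ->. Qed.

Lemma cint0 : cint (fun=> 0) = 0.
Proof. by rewrite /cint /Rintegral integral0. Qed.

Lemma cintegrable0 : cintegrable (fun=> 0).
Proof. by split; exact: integrable0. Qed.

Lemma cintegrableD f g : cintegrable f -> cintegrable g ->
  cintegrable (fun t => f t + g t).
Proof.
move=> [f1 f2] [g1 g2]; split.
  under eq_fun do rewrite ReD EFinD. exact: (integrableD mD f1 g1).
under eq_fun do rewrite ImD EFinD; exact: (integrableD mD f2 g2).
Qed.

Lemma cintD f g : cintegrable f -> cintegrable g ->
  cint (fun t => f t + g t) = cint f + cint g.
Proof.
move=> [f1 f2] [g1 g2]; apply: ReIm_eq; rewrite ?ReD ?ImD /cint /=.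
  under eq_Rintegral do rewrite ReD; exact: RintegralD mD f1 g1.
under eq_Rintegral do rewrite ImD; exact: RintegralD mD f2 g2.
Qed.

Lemma integrableZZ (a b : R) (f g : R -> R) :
  mu.-integrable D (fun t => (f t)%:E) -> mu.-integrable D (fun t => (g t)%:E) ->
  mu.-integrable D (fun t => (a * f t + b * g t)%:E).
Proof.
move=> fi gi; under eq_fun do rewrite EFinD !EFinM.
by apply: (integrableD mD); exact: (integrableZl mD).
Qed.

Lemma RintZZ (a b : R) (f g : R -> R) :
  mu.-integrable D (fun t => (f t)%:E) -> mu.-integrable D (fun t => (g t)%:E) ->
  \int[mu]_(t in D) (a * f t + b * g t) =
  a * (\int[mu]_(t in D) f t) + b * \int[mu]_(t in D) g t.
Proof.
move=> fi gi; rewrite (RintegralD mD); [|exact: (integrableZl mD _ fi)|exact: (integrableZl mD _ gi)].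
by rewrite (RintegralZl _ mD fi) (RintegralZl _ mD gi).
Qed.

Lemma cintegrableZ (c : C) f : cintegrable f -> cintegrable (fun t => c * f t).
Proof.
move=> [f1 f2]; split.
  under eq_fun do rewrite ReM -mulNr; exact: integrableZZ.
under eq_fun do rewrite ImM; exact: integrableZZ.
Qed.

Lemma cintZ (c : C) f : cintegrable f -> cint (fun t => c * f t) = c * cint f.
Proof.
move=> [f1 f2]; apply: ReIm_eq; rewrite ?ReM ?ImM /cint /=.
  under eq_Rintegral do rewrite ReM -mulNr; rewrite RintZZ// mulNr//.
by under eq_Rintegral do rewrite ImM; rewrite RintZZ.
Qed.

Lemma cintJ f : cintegrable f -> cint (fun t => Num.conj (f t)) = Num.conj (cint f).
Proof.
move=> [f1 f2]; apply: ReIm_eq; rewrite ?ReJ ?ImJ /cint /=.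
  by under eq_Rintegral do rewrite ReJ.
under eq_Rintegral do rewrite ImJ -mulN1r.
by rewrite (RintegralZl _ mD f2) mulN1r.
Qed.

Lemma cintegrable_sum (I : Type) (s : seq I) (f : I -> R -> C) :
  (forall i, cintegrable (f i)) -> cintegrable (fun t => \sum_(i <- s) f i t).
Proof.
move=> fi; elim: s => [|i s IH].
  by under eq_fun do rewrite big_nil; exact: cintegrable0.
by under eq_fun do rewrite big_cons; exact: cintegrableD.
Qed.

Lemma cint_sum (I : Type) (s : seq I) (f : I -> R -> C) :
  (forall i, cintegrable (f i)) ->
  cint (fun t => \sum_(i <- s) f i t) = \sum_(i <- s) cint (f i).
Proof.
move=> fi; elim: s => [|i s IH].
  by rewrite big_nil (eq_cint (g := fun=> 0)) ?cint0// => t; rewrite big_nil.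
rewrite big_cons -IH -cintD//; last exact: cintegrable_sum.
by apply: eq_cint => t; rewrite big_cons.
Qed.

Lemma cint_ge0 f : (forall t, 0 <= f t) -> 0 <= cint f.
Proof.
move=> f0.
have h t : Im (f t) = 0 /\ 0 <= Re (f t).
  by move: (f0 t); case: (f t) => a b; rewrite lecE /= => /andP[/eqP-> ->].
rewrite lecE /cint /=; apply/andP; split.
  rewrite (_ : (fun t => Im (f t)) = cst 0); last by apply/funext => t; rewrite (h t).1.
  by rewrite (Rintegral_cst _ mD) mul0r.
by apply: Rintegral_ge0 => t _; exact: (h t).2.
Qed.

Lemma sq_bound1 (a b c d : R) :
  `|a * c - b * - d| <= a ^+ 2 + b ^+ 2 + (c ^+ 2 + d ^+ 2).
Proof.
have := And4 (sqr_ge0 (a + c)) (sqr_ge0 (a - c)) (sqr_ge0 (b + d)) (sqr_ge0 (b - d)).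
have := And4 (sqr_ge0 a) (sqr_ge0 b) (sqr_ge0 c) (sqr_ge0 d).
move=> [? ? ? ?] [? ? ? ?]; rewrite ler_norml; apply/andP; split; lra.
Qed.

Lemma sq_bound2 (a b c d : R) :
  `|a * - d + b * c| <= a ^+ 2 + b ^+ 2 + (c ^+ 2 + d ^+ 2).
Proof.
have := And4 (sqr_ge0 (a + d)) (sqr_ge0 (a - d)) (sqr_ge0 (b + c)) (sqr_ge0 (b - c)).
have := And4 (sqr_ge0 a) (sqr_ge0 b) (sqr_ge0 c) (sqr_ge0 d).
move=> [? ? ? ?] [? ? ? ?]; rewrite ler_norml; apply/andP; split; lra.
Qed.

Lemma l2_cintegrable (f g : l2 R) : cintegrable (fun t => f t * Num.conj (g t)).
Proof.
pose s (f : l2 R) t := Re (f t) ^+ 2 + Im (f t) ^+ 2.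
have si (h : l2 R) : mu.-integrable D (fun t => (s h t)%:E).
  apply/integrableP; split.
    apply/measurable_EFinP; apply: measurable_funD;
      apply: measurable_funX; [exact: l2_mRe|exact: l2_mIm].
  under eq_integral do rewrite gee0_abs ?lee_fin ?addr_ge0 ?sqr_ge0//.
  exact: l2_fin.
have ssi : mu.-integrable D (fun t => (s f t + s g t)%:E).
  by under eq_fun do rewrite EFinD; exact: (integrableD mD (si f) (si g)).
have [mf1 mf2 mg1 mg2] := And4 (@l2_mRe _ f) (@l2_mIm _ f) (@l2_mRe _ g) (@l2_mIm _ g).
split; apply: le_integrable ssi; rewrite /s; try exact: mD.
- apply/measurable_EFinP; under eq_fun do rewrite ReM ReJ ImJ.
  apply: measurable_funB; apply: measurable_funM => //.
  exact: measurableT_comp.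
- move=> t _; rewrite lee_fin (ger0_norm (addr_ge0 _ _)) ?addr_ge0 ?sqr_ge0//.
  by rewrite ReM ReJ ImJ sq_bound1.
- apply/measurable_EFinP; under eq_fun do rewrite ImM ReJ ImJ.
  apply: measurable_funD; apply: measurable_funM => //.
  exact: measurableT_comp.
- move=> t _; rewrite lee_fin (ger0_norm (addr_ge0 _ _)) ?addr_ge0 ?sqr_ge0//.
  by rewrite ImM ReJ ImJ sq_bound2.
Qed.

Lemma l2_dotE (f g : l2 R) : l2_dot f g = cint (fun t => f t * Num.conj (g t)).
Proof. by []. Qed.

Lemma l2_dotC (f g : l2 R) : l2_dot f g = Num.conj (l2_dot g f).
Proof.
rewrite !l2_dotE -cintJ; last exact: l2_cintegrable.
apply: eq_cint => t; apply: ReIm_eq; rewrite ?ReJ ?ImJ ?ReM ?ImM ?ReJ ?ImJ; ring.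
Qed.

End Cint.

Section clim.
Variable C : numClosedFieldType.
Implicit Types (f g : nat -> C).

Definition clim f (l : C) :=
  forall e, 0 < e -> exists N, forall n, (N <= n)%N -> `|f n - l| < e.

Lemma clim_uniq f l l' : clim f l -> clim f l' -> l = l'.
Proof.
move=> fl fl'; apply/eqP; rewrite -subr_eq0 -normr_eq0.
apply: contraT => d0.
have dp : 0 < `|l - l'| / 2 by rewrite divr_gt0// lt_def d0 normr_ge0.
have [N1 h1] := fl _ dp; have [N2 h2] := fl' _ dp.
have := ltrD (h1 (maxn N1 N2) (leq_maxl _ _)) (h2 (maxn N1 N2) (leq_maxr _ _)).
rewrite -splitr distrC => /(le_lt_trans (ler_normD _ _)).
by rewrite addrA subrK ltxx.
Qed.

Lemma clim_const l : clim (fun=> l) l.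
Proof. by move=> e e0; exists 0%N => n _; rewrite subrr normr0. Qed.

Lemma climD f g l l' : clim f l -> clim g l' -> clim (fun n => f n + g n) (l + l').
Proof.
move=> fl gl e e0; have e2 : 0 < e / 2 by rewrite divr_gt0.
have [N1 h1] := fl _ e2; have [N2 h2] := gl _ e2.
exists (maxn N1 N2) => n; rewrite geq_max => /andP[n1 n2].
rewrite opprD addrACA (le_lt_trans (ler_normD _ _))// [ltRHS]splitr.
by rewrite ltrD ?h1 ?h2.
Qed.

Lemma clim0_le f g : (forall n, `|f n| <= g n) -> clim g 0 -> clim f 0.
Proof.
move=> fg g0 e /g0[N h]; exists N => n /h; rewrite !subr0; apply: le_lt_trans.
by rewrite (ger0_norm (le_trans _ (fg n))).
Qed.

Lemma climZ c f l : clim f l -> clim (fun n => c * f n) (c * l).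
Proof.
move=> fl e e0; have e2 : 0 < e / (`|c| + 1).
  by rewrite divr_gt0// ltr_wpDl.
have [N h] := fl _ e2; exists N => n /h; rewrite ltr_pdivlMr ?ltr_wpDl// mulrC.
move=> H; rewrite -mulrBr normrM (le_lt_trans _ H)// ler_wpM2r// lerDl//.
Qed.

Lemma climJ f l : clim f l -> clim (fun n => Num.conj (f n)) (Num.conj l).
Proof.
by move=> fl e /fl[N h]; exists N => n /h; rewrite -rmorphB norm_conjC.
Qed.

Lemma clim_norm f l : clim f l -> clim (fun n => `|f n|) `|l|.
Proof.
move=> fl e /fl[N h]; exists N => n /h; apply: le_lt_trans.
exact: ler_dist_dist.
Qed.

Lemma eq_clim f g l : (forall n, f n = g n) -> clim f l -> clim g l.
Proof. by move=> fg fl e /fl[N h]; exists N => n /h; rewrite fg. Qed.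

Lemma clim_shift f l k : clim f l -> clim (fun n => f (n + k)%N) l.
Proof.
by move=> fl e /fl[N h]; exists N => n Nn; apply: h; rewrite (leq_trans Nn)// leq_addr.
Qed.

Lemma clim_ge0 f l : (forall n, 0 <= f n) -> clim f l -> 0 <= l.
Proof.
move=> f0 fl; have := clim_norm fl.
move/(eq_clim (g := f) (fun n => ger0_norm (f0 n))) => /(clim_uniq fl) ->.
exact: normr_ge0.
Qed.

Lemma clim_le f l m : (forall n, f n <= m) -> clim f l -> l <= m.
Proof.
move=> fm fl; rewrite -subr_ge0; apply: (@clim_ge0 (fun n => m - f n)).
  by move=> n; rewrite subr_ge0.
apply: climD; first exact: clim_const.
by rewrite -mulN1r; apply: (eq_clim _ (climZ (-1) fl)) => n; rewrite mulN1r.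
Qed.

Lemma clim_sqr0 f : clim (fun n => f n ^+ 2) 0 -> clim f 0.
Proof.
move=> f2 e e0; have [N h] := f2 _ (exprn_gt0 2 e0).
exists N => n /h; rewrite !subr0 normrX.
by rewrite ltr_pXn2r// nnegrE// ltW.
Qed.

Lemma cs_abs (a b z : C) : 0 <= a -> 0 <= b ->
  (forall x y, 0 <= x * Num.conj x * a + x * Num.conj y * z
                  + y * Num.conj x * Num.conj z + y * Num.conj y * b) ->
  `|z| ^+ 2 <= a * b.
Proof.
move=> a0 b0 h; have [b1|] := eqVneq b 0; last first.
  move=> bn0; have bp : 0 < b by rewrite lt_def bn0.
  have := h b (- z); rewrite (CrealP (ger0_real b0)) rmorphN/= normCK.
  rewrite (_ : _ + _ = b * (a * b - z * Num.conj z)); last by ring.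
  by rewrite pmulr_rge0// subr_ge0.
rewrite b1 mulr0; apply: contraT.
rewrite -real_ltNge ?ger0_real ?exprn_ge0// => zp.
pose n : C := (a + 1) / (`|z| ^+ 2 * 2).
have nr : Num.conj n = n.
  apply/CrealP/ger0_real; rewrite divr_ge0 ?addr_ge0 ?mulr_ge0 ?exprn_ge0//.
have := h 1 (- (n * z)); rewrite b1 rmorphN rmorphM/= nr rmorph1 mulr0 addr0.
rewrite (_ : _ + _ = a - n * (z * Num.conj z * 2)); last by ring.
rewrite -normCK divfK; last by rewrite mulf_neq0 ?pnatr_eq0 ?gt_eqF.
by rewrite opprD addrA subrr add0r oppr_ge0 ler10.
Qed.

Lemma tri_abs (z n m : C) : 0 <= n -> 0 <= m -> `|z| <= n * m ->
  n ^+ 2 + z + (Num.conj z + m ^+ 2) <= (n + m) ^+ 2.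
Proof.
move=> n0 m0 h; rewrite sqrrD addrA lerD2r -!addrA lerD2l.
have le1 : z + Num.conj z <= `|z + Num.conj z|.
  by apply: real_ler_norm; apply/CrealP; rewrite rmorphD/= conjCK addrC.
rewrite (le_trans le1)// (le_trans (ler_normD _ _))// mulr2n norm_conjC.
exact: lerD.
Qed.

Lemma sqrtC_tri (s n m z : C) : 0 <= s -> 0 <= n -> 0 <= m -> `|z| <= n * m ->
  s ^+ 2 = n ^+ 2 + z + (Num.conj z + m ^+ 2) -> s <= n + m.
Proof.
move=> s0 n0 m0 h e; rewrite -(@ler_pXn2r _ 2) ?nnegrE ?addr_ge0// e.
exact: tri_abs.
Qed.

Lemma cs_sqrt (a b z n m : C) : 0 <= n -> 0 <= m -> n ^+ 2 = a -> m ^+ 2 = b ->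
  (forall x y, 0 <= x * (Num.conj x * a) + x * (Num.conj y * z)
                  + (y * (Num.conj x * Num.conj z) + y * (Num.conj y * b))) ->
  `|z| <= n * m.
Proof.
move=> n0 m0 ea eb h.
rewrite -(@ler_pXn2r _ 2) ?nnegrE ?mulr_ge0// exprMn ea eb.
apply: cs_abs; rewrite -?ea -?eb ?exprn_ge0// => x y.
by have := h x y; rewrite ea eb !mulrA addrA.
Qed.

Lemma sqrtC_scale (c a : C) : 0 <= a -> sqrtC (c * (Num.conj c * a)) = `|c| * sqrtC a.
Proof. by move=> a0; rewrite mulrA -normCK rootCMl ?exprn_ge0// -/(sqrtC _) sqrCK. Qed.

End clim.

Section ccvg.
Variable R : realType.
Local Notation C := R[i].

Lemma complex_le_normD (a b : R) : `|Complex a b| <= (`|a| + `|b|)%:C%C.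
Proof.
rewrite normc_def lecR -[leRHS]ger0_norm ?addr_ge0// -sqrtr_sqr ler_wsqrtr//=.
by rewrite sqrrD !real_normK ?num_real// addrAC lerDl mulrn_wge0// mulr_ge0.
Qed.

Lemma Im_le_norm (z : C) : (`|complex.Im z|)%:C%C <= `|z|.
Proof.
case: z => a b; rewrite normc_def lecR /= -sqrtr_sqr ler_wsqrtr// lerDr sqr_ge0//.
Qed.

Lemma real_seq_complete (u : nat -> R) :
  (forall e, 0 < e -> exists N, forall n, (N <= n)%N -> `|u N - u n| < e) ->
  exists l, forall e, 0 < e -> exists N, forall n, (N <= n)%N -> `|u n - l| < e.
Proof.
move=> h; have : cvg (u @ \oo).
  apply: cauchy_cvg; apply: cauchy_exP => e /h[N hN]; exists (u N).
  by exists N => // n /= /hN.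
move=> ul; exists (lim (u @ \oo)) => e e0.
have /cvgrPdist_lt /(_ e e0)[N _ hN] := ul.
by exists N => n Nn; rewrite distrC; apply: hN.
Qed.

Lemma clim_complete (f : nat -> C) :
  (forall e, 0 < e -> exists N, forall m n, (N <= m)%N -> (N <= n)%N ->
    `|f m - f n| < e) -> exists l, clim f l.
Proof.
move=> h.
have [a ha] : exists l, forall e, 0 < e -> exists N, forall n, (N <= n)%N ->
    `|complex.Re (f n) - l| < e.
  apply: real_seq_complete => e e0.
  have [N hN] := h e%:C%C ltac:(by rewrite ltcR).
  exists N => n Nn; rewrite -ltcR; apply: le_lt_trans (hN N n _ Nn) => //.
  apply: le_trans (normc_ge_Re _); by rewrite raddfB.
have [b hb] : exists l, forall e, 0 < e -> exists N, forall n, (N <= n)%N ->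
    `|complex.Im (f n) - l| < e.
  apply: real_seq_complete => e e0.
  have [N hN] := h e%:C%C ltac:(by rewrite ltcR).
  exists N => n Nn; rewrite -ltcR; apply: le_lt_trans (hN N n _ Nn) => //.
  apply: le_trans (Im_le_norm _); by rewrite raddfB.
exists (Complex a b) => -[e e'].
rewrite ltcE /= => /andP[/eqP-> e0].
have e2 : 0 < e / 2 by rewrite divr_gt0.
have [N1 h1] := ha _ e2; have [N2 h2] := hb _ e2.
exists (maxn N1 N2) => n; rewrite geq_max => /andP[n1 n2].
have := complex_le_normD (complex.Re (f n) - a) (complex.Im (f n) - b).
rewrite (_ : Complex _ _ = f n - Complex a b); last by case: (f n).
by move=> /le_lt_trans; apply; rewrite ltcR [ltRHS]splitr ltrD ?h1 ?h2.
Qed.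
End ccvg.

Section pre.
Variables (C : numClosedFieldType) (W : Type).

Definition gram (K : W -> W -> C) (a b : seq (C * W)) : C :=
  \sum_(x <- a) \sum_(y <- b) x.1 * Num.conj y.1 * K x.2 y.2.

Record psd_kernel := PsdKernel { ker :> W -> W -> C;
  ker_herm : forall s t, ker s t = Num.conj (ker t s);
  ker_psd : forall a, 0 <= gram ker a a }.

Variable K : psd_kernel.
Implicit Types (a b d : seq (C * W)).
Local Notation B := (gram K).

Definition psc (c : C) a : seq (C * W) := [seq (c * x.1, x.2) | x <- a].
Definition psub a b := a ++ psc (-1) b.

Lemma gramDl a b d : B (a ++ b) d = B a d + B b d.
Proof. by rewrite /gram big_cat. Qed.

Lemma gramDr d a b : B d (a ++ b) = B d a + B d b.
Proof. by rewrite /gram -big_split; apply: eq_bigr => x _; rewrite big_cat. Qed.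

Lemma gramZl c a b : B (psc c a) b = c * B a b.
Proof.
rewrite /gram big_map mulr_sumr; apply: eq_bigr => x _.
by rewrite mulr_sumr; apply: eq_bigr => y _; rewrite !mulrA.
Qed.

Lemma gramZr c a b : B a (psc c b) = Num.conj c * B a b.
Proof.
rewrite /gram mulr_sumr; apply: eq_bigr => x _.
rewrite big_map mulr_sumr; apply: eq_bigr => y _ /=.
by rewrite rmorphM !mulrA [Num.conj c * _]mulrC.
Qed.

Lemma gramC a b : B a b = Num.conj (B b a).
Proof.
rewrite /gram rmorph_sum exchange_big; apply: eq_bigr => x _.
rewrite rmorph_sum; apply: eq_bigr => y _.
by rewrite !rmorphM/= conjCK -ker_herm [Num.conj _ * _]mulrC.
Qed.

Lemma gramBl a b d : B (psub a b) d = B a d - B b d.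
Proof. by rewrite gramDl gramZl mulN1r. Qed.

Lemma gramBr d a b : B d (psub a b) = B d a - B d b.
Proof. by rewrite gramDr gramZr rmorphN rmorph1 mulN1r. Qed.

Definition nrm a := sqrtC (B a a).

Lemma nrm_ge0 a : 0 <= nrm a. Proof. by rewrite sqrtC_ge0 ker_psd. Qed.
Lemma nrm_sqr a : nrm a ^+ 2 = B a a. Proof. by rewrite sqrtCK. Qed.

Lemma pre_cs a b : `|B a b| <= nrm a * nrm b.
Proof.
apply: (cs_sqrt (nrm_ge0 a) (nrm_ge0 b) (nrm_sqr a) (nrm_sqr b)) => x y.
have := ker_psd K (psc x a ++ psc y b).
by rewrite gramDl !gramDr !gramZl !gramZr -(gramC b a).
Qed.

Lemma nrmD a b : nrm (a ++ b) <= nrm a + nrm b.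
Proof.
apply: (sqrtC_tri (nrm_ge0 _) (nrm_ge0 a) (nrm_ge0 b) (pre_cs a b)).
by rewrite !nrm_sqr gramDl !gramDr -gramC.
Qed.

Lemma nrmZ c a : nrm (psc c a) = `|c| * nrm a.
Proof.
by rewrite /nrm gramZl gramZr sqrtC_scale ?ker_psd.
Qed.

Lemma nrm_subC a b : nrm (psub a b) = nrm (psub b a).
Proof.
congr sqrtC; rewrite !gramBl !gramBr; ring.
Qed.

Lemma nrm_tri a b d : nrm (psub a d) <= nrm (psub a b) + nrm (psub b d).
Proof.
apply: le_trans (nrmD _ _); rewrite le_eqVlt; apply/orP; left; apply/eqP.
congr sqrtC; rewrite !(gramBl, gramBr, gramDl, gramDr); ring.
Qed.

Definition pcauchy (u : nat -> seq (C * W)) := forall e, 0 < e ->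
  exists N, forall m n, (N <= m)%N -> (N <= n)%N -> nrm (psub (u m) (u n)) < e.

Lemma pcauchy_const a : pcauchy (fun=> a).
Proof.
move=> e e0; exists 0%N => m n _ _.
by rewrite /nrm gramBl !subrr sqrtC0.
Qed.

Lemma pcauchyD u v : pcauchy u -> pcauchy v -> pcauchy (fun n => u n ++ v n).
Proof.
move=> cu cv e e0; have e2 : 0 < e / 2 by rewrite divr_gt0.
have [N1 h1] := cu _ e2; have [N2 h2] := cv _ e2.
exists (maxn N1 N2) => m n; rewrite !geq_max => /andP[m1 m2] /andP[n1 n2].
rewrite [ltRHS]splitr.
apply: le_lt_trans (ltrD (h1 m n m1 n1) (h2 m n m2 n2)).
apply: le_trans (nrmD _ _); rewrite le_eqVlt; apply/orP; left; apply/eqP.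
congr sqrtC; rewrite !(gramBl, gramBr, gramDl, gramDr); ring.
Qed.

Lemma pcauchy_bounded T u (M : C) : 0 <= M ->
  (forall a, nrm (T a) <= M * nrm a) ->
  (forall a b, psub (T a) (T b) = T (psub a b)) -> pcauchy u ->
  pcauchy (fun n => T (u n)).
Proof.
move=> M0 hM TB cu e e0; have e2 : 0 < e / (M + 1).
  by rewrite divr_gt0// ltr_wpDl.
have [N h] := cu _ e2; exists N => m n Nm Nn.
rewrite TB (le_lt_trans (hM _))//.
have := h m n Nm Nn; rewrite ltr_pdivlMr ?ltr_wpDl// mulrC.
by apply: le_lt_trans; rewrite ler_wpM2r ?nrm_ge0// lerDl.
Qed.

Lemma pscB c a b : psub (psc c a) (psc c b) = psc c (psub a b).
Proof.
rewrite /psub /psc map_cat -!map_comp; congr (_ ++ _); apply: eq_map => x /=.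
by rewrite mulrCA.
Qed.

Lemma pcauchyZ c u : pcauchy u -> pcauchy (fun n => psc c (u n)).
Proof.
apply: (@pcauchy_bounded (psc c) _ `|c|) => // a; first by rewrite nrmZ.
exact: pscB.
Qed.

Lemma pcauchy_bnd u : pcauchy u -> exists2 M, 0 < M & exists N, forall n,
   (N <= n)%N -> nrm (u n) <= M.
Proof.
move=> /(_ 1 ltr01)[N h]; exists (nrm (u N) + 1); first by rewrite ltr_wpDl ?nrm_ge0.
exists N => n Nn; have : nrm (u n) <= nrm (u N ++ psub (u n) (u N)).
  rewrite le_eqVlt; apply/orP; left; apply/eqP.
  congr sqrtC; rewrite !(gramBl, gramBr, gramDl, gramDr); ring.
move=> /le_trans; apply; rewrite (le_trans (nrmD _ _))// lerD2l.
exact: ltW (h _ _ Nn (leqnn N)).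
Qed.

Lemma clim_gram0 u v : clim (fun n => nrm (u n)) 0 -> pcauchy v ->
  clim (fun n => B (u n) (v n)) 0.
Proof.
move=> u0 /pcauchy_bnd[M M0 [N2 hM]] e e0.
have [N1 h1] := u0 _ (divr_gt0 e0 M0).
exists (maxn N1 N2) => n; rewrite geq_max => /andP[n1 n2].
rewrite subr0 (le_lt_trans (pre_cs _ _))//.
have := h1 _ n1; rewrite subr0 (ger0_norm (nrm_ge0 _)) ltr_pdivlMr//.
by apply: le_lt_trans; rewrite ler_wpM2l ?nrm_ge0// hM.
Qed.

Lemma clim_gram0r u v : clim (fun n => nrm (v n)) 0 -> pcauchy u ->
  clim (fun n => B (u n) (v n)) 0.
Proof.
move=> v0 cu; have := climJ (clim_gram0 v0 cu); rewrite rmorph0.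
by apply: eq_clim => n; rewrite -gramC.
Qed.

Hypothesis Cc : forall f : nat -> C,
  (forall e, 0 < e -> exists N, forall m n, (N <= m)%N -> (N <= n)%N ->
    `|f m - f n| < e) -> exists l, clim f l.

Lemma gram_cvg u v : pcauchy u -> pcauchy v ->
  exists l, clim (fun n => B (u n) (v n)) l.
Proof.
move=> cu cv; apply: Cc => e e0.
have [M1 M10 [N1 h1]] := pcauchy_bnd cu.
have [M2 M20 [N2 h2]] := pcauchy_bnd cv.
have [N3 h3] := cu _ (divr_gt0 (divr_gt0 e0 (ltr0n C 2)) M20).
have [N4 h4] := cv _ (divr_gt0 (divr_gt0 e0 (ltr0n C 2)) M10).
exists (maxn (maxn N1 N2) (maxn N3 N4)) => m n.
rewrite !geq_max => /andP[/andP[m1 m2] /andP[m3 m4]] /andP[/andP[n1 n2] /andP[n3 n4]].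
rewrite (_ : _ - _ = B (psub (u m) (u n)) (v m) + B (u n) (psub (v m) (v n))); last first.
  by rewrite gramBl gramBr addrA subrK.
rewrite (le_lt_trans (ler_normD _ _))// [ltRHS]splitr ltrD//.
  rewrite (le_lt_trans (pre_cs _ _))//.
  have := h3 _ _ m3 n3; rewrite ltr_pdivlMr//; apply: le_lt_trans.
  by rewrite ler_wpM2l ?nrm_ge0// h2.
rewrite (le_lt_trans (pre_cs _ _))// mulrC.
have := h4 _ _ m4 n4; rewrite ltr_pdivlMr//; apply: le_lt_trans.
by rewrite ler_wpM2l ?nrm_ge0// h1.
Qed.

Definition dlt w : seq (C * W) := [:: (1, w)].

Definition rep (u : nat -> seq (C * W)) (phi : W -> C) :=
  pcauchy u /\ forall w, clim (fun n => B (u n) (dlt w)) (phi w).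

Lemma rep_ex u : pcauchy u -> exists phi, rep u phi.
Proof.
move=> cu; have h w := gram_cvg cu (@pcauchy_const (dlt w)).
by exists (fun w => sval (cid (h w))); split=> // w; exact: svalP (cid (h w)).
Qed.

Lemma repD u v phi psi : rep u phi -> rep v psi -> rep (fun n => u n ++ v n) (phi + psi).
Proof.
move=> [cu up] [cv vp]; split; first exact: pcauchyD.
by move=> w; apply: eq_clim (climD (up w) (vp w)) => n; rewrite gramDl.
Qed.

Lemma repZ c u phi : rep u phi -> rep (fun n => psc c (u n)) (c *: phi).
Proof.
move=> [cu up]; split; first exact: pcauchyZ.
by move=> w; apply: eq_clim (climZ c (up w)) => n; rewrite gramZl.
Qed.

Lemma repB u v phi psi : rep u phi -> rep v psi -> rep (fun n => psub (u n) (v n)) (phi - psi).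
Proof. by move=> ru rv; rewrite -scaleN1r; apply: repD => //; exact: repZ. Qed.

Lemma rep_uniq u phi psi : rep u phi -> rep u psi -> phi = psi.
Proof.
by move=> [_ h] [_ k]; apply/funext => w; exact: clim_uniq (h w) (k w).
Qed.

Lemma rep0_gram u a : rep u 0 -> clim (fun n => B (u n) a) 0.
Proof.
move=> [_ h]; elim: a => [|[c w] a IH].
  apply: eq_clim (clim_const 0) => n.
  by rewrite /gram big1// => x _; rewrite big_nil.
have := climD (climZ (Num.conj c) (h w)) IH; rewrite mulr0 addr0.
apply: eq_clim => n; rewrite -gramZr -gramDr /psc /= mulr1//.
Qed.

Lemma rep0_nrm u : rep u 0 -> clim (fun n => nrm (u n)) 0.
Proof.
move=> ru; apply: clim_sqr0; have [cu _] := ru => e e0.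
have e2 : 0 < e / 2 by rewrite divr_gt0.
have [M M0 [N1 h1]] := pcauchy_bnd cu.
have [N2 h2] := cu _ (divr_gt0 e2 M0).
have [N3 h3] := rep0_gram (u N2) ru e2.
exists (maxn N1 (maxn N2 N3)) => n.
rewrite !geq_max => /and3P[n1 n2 n3]; rewrite subr0 nrm_sqr.
rewrite (_ : B _ _ = B (u n) (u N2) + B (u n) (psub (u n) (u N2))); last first.
  by rewrite gramBr subrKC.
rewrite (le_lt_trans (ler_normD _ _))// [ltRHS]splitr ltrD//.
  by have := h3 _ n3; rewrite subr0.
rewrite (le_lt_trans (pre_cs _ _))// mulrC.
have := h2 _ _ n2 (leqnn _); rewrite ltr_pdivlMr//; apply: le_lt_trans.
by rewrite ler_wpM2l ?nrm_ge0// h1.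
Qed.

Lemma rep_gram_uniq u u' v v' phi psi l :
  rep u phi -> rep u' phi -> rep v psi -> rep v' psi ->
  clim (fun n => B (u n) (v n)) l -> clim (fun n => B (u' n) (v' n)) l.
Proof.
move=> ru ru' rv rv' h.
have /rep0_nrm d1 : rep (fun n => psub (u' n) (u n)) 0 by rewrite -(subrr phi); exact: repB.
have /rep0_nrm d2 : rep (fun n => psub (v' n) (v n)) 0 by rewrite -(subrr psi); exact: repB.
have := climD (climD h (clim_gram0 d1 rv'.1)) (clim_gram0r d2 ru.1).
rewrite !addr0; apply: eq_clim => n; rewrite gramBl gramBr; ring.
Qed.

End pre.

Section hcomp.
Variables (R : realType) (W : Type) (K : psd_kernel R[i] W).
Local Notation C := R[i].

Definition hpred : {pred W -> C} := [pred phi | `[< exists u, rep K u phi >]].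

Lemma hpred_submod : submod_closed hpred.
Proof.
split.
  apply/asboolP; exists (fun=> [::]); split; first exact: pcauchy_const.
  by move=> w; rewrite /gram; under [X in clim X]eq_fun do rewrite big_nil; exact: clim_const.
move=> c phi psi /asboolP[u ru] /asboolP[v rv]; apply/asboolP.
by exists (fun n => psc c (u n) ++ v n); apply: repD => //; exact: repZ.
Qed.

HB.instance Definition _ := GRing.isSubmodClosed.Build _ _ hpred hpred_submod.

Record hcomp := HComp { hval :> W -> C; hvalP : hval \in hpred }.

HB.instance Definition _ := [isSub of hcomp for hval].
HB.instance Definition _ := [Choice of hcomp by <:].
HB.instance Definition _ := [SubChoice_isSubLmodule of hcomp by <:].

Lemma hrep (x : hcomp) : exists u, rep K u x.
Proof. by have /asboolP := hvalP x. Qed.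

Definition hseq (x : hcomp) := sval (cid (hrep x)).
Lemma hseqP x : rep K (hseq x) x. Proof. exact: svalP (cid (hrep x)). Qed.

Lemma hlim_ex u : pcauchy K u -> exists x : hcomp, rep K u x.
Proof.
move=> /(rep_ex (@clim_complete R))[phi rphi].
have hphi : phi \in hpred by apply/asboolP; exists u.
by exists (HComp hphi).
Qed.

Lemma hdot_ex (x y : hcomp) : exists l, clim (fun n => gram K (hseq x n) (hseq y n)) l.
Proof. exact: gram_cvg (@clim_complete R) _ _ (hseqP x).1 (hseqP y).1. Qed.

Lemma hdot_sig : {d : hcomp -> hcomp -> C | forall u v (x y : hcomp),
  rep K u x -> rep K v y -> clim (fun n => gram K (u n) (v n)) (d x y)}.
Proof.
exists (fun x y => sval (cid (hdot_ex x y))) => u v x y ru rv.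
apply: rep_gram_uniq (hseqP x) ru (hseqP y) rv _.
exact: svalP (cid (hdot_ex x y)).
Qed.

Definition hdot := sval hdot_sig.

Lemma hdotP u v (x y : hcomp) : rep K u x -> rep K v y ->
  clim (fun n => gram K (u n) (v n)) (hdot x y).
Proof. exact: (proj2_sig hdot_sig u v x y). Qed.

Lemma hdot_linl y : GRing.linear_for *%R (fun x => hdot x y).
Proof.
move=> c x x'; have r := repD (repZ c (hseqP x)) (hseqP x').
have h := hdotP (x := c *: x + x') r (hseqP y); apply: clim_uniq h _.
have := climD (climZ c (hdotP (hseqP x) (hseqP y))) (hdotP (hseqP x') (hseqP y)).
by apply: eq_clim => n; rewrite gramDl gramZl.
Qed.

Lemma hdotC x y : hdot x y = Num.conj (hdot y x).
Proof.
apply: clim_uniq (hdotP (hseqP x) (hseqP y)) _.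
by apply: eq_clim (climJ (hdotP (hseqP y) (hseqP x))) => n; rewrite -gramC.
Qed.

Lemma hdot_linr x : GRing.linear_for (@Num.conj C \; *%R) (hdot x).
Proof.
move=> c y y' /=; rewrite hdotC hdot_linl [hdot x y]hdotC [hdot x y']hdotC.
by rewrite rmorphD rmorphM.
Qed.

HB.instance Definition _ := bilinear_isBilinear.Build C hcomp hcomp C
  *%R (@Num.conj C \; *%R) hdot (conj hdot_linl hdot_linr).

Lemma hdot_herm (x y : hcomp) : hdot x y = (-1) ^+ false * Num.conj (hdot y x).
Proof. by rewrite expr0 mul1r -hdotC. Qed.

HB.instance Definition _ := isHermitianSesquilinear.Build C hcomp false
  (@Num.conj C) hdot hdot_herm.

Lemma hdot_ge0 (x : hcomp) : 0 <= hdot x x.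
Proof.
by apply: clim_ge0 (hdotP (hseqP x) (hseqP x)) => n; exact: ker_psd.
Qed.

Lemma hdot_eq0 (x : hcomp) : hdot x x = 0 -> x = 0.
Proof.
move=> x0; apply/val_inj/funext => w /=.
have [cu h] := hseqP x; apply: clim_uniq (h w) _.
apply: clim_gram0; last exact: pcauchy_const.
apply: clim_sqr0; rewrite -x0.
by apply: eq_clim (hdotP (hseqP x) (hseqP x)) => n; rewrite nrm_sqr.
Qed.

Lemma hdot_gt0 (x : hcomp) : x != 0 -> 0 < hdot x x.
Proof.
by move=> x0; rewrite lt_def hdot_ge0 andbT; apply: contra x0 => /eqP/hdot_eq0 ->.
Qed.

HB.instance Definition _ := isDotProduct.Build C hcomp hdot hdot_gt0.

Definition hnorm (x : hcomp) : C := sqrtC (hdot x x).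

Lemma hnorm_sqr x : hnorm x ^+ 2 = hdot x x. Proof. exact: sqrtCK. Qed.
Lemma hnorm_ge0 x : 0 <= hnorm x. Proof. by rewrite sqrtC_ge0 hdot_ge0. Qed.

Lemma hdotD (x y : hcomp) : hdot (x + y) (x + y) =
  hdot x x + hdot x y + (hdot y x + hdot y y).
Proof. by rewrite linearDl !linearDr. Qed.

Lemma hdotZl c (x y : hcomp) : hdot (c *: x) y = c * hdot x y.
Proof. exact: linearZl_LR. Qed.

Lemma hdotZr c (x y : hcomp) : hdot x (c *: y) = Num.conj c * hdot x y.
Proof. exact: linearZr_LR. Qed.

Lemma hcs (x y : hcomp) : `|hdot x y| <= hnorm x * hnorm y.
Proof.
apply: (cs_sqrt (hnorm_ge0 x) (hnorm_ge0 y) (hnorm_sqr x) (hnorm_sqr y)) => a b.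
have := hdot_ge0 (a *: x + b *: y).
by rewrite hdotD !hdotZl !hdotZr -(hdotC y x).
Qed.

Lemma hnormD (x y : hcomp) : hnorm (x + y) <= hnorm x + hnorm y.
Proof.
apply: (sqrtC_tri (hnorm_ge0 _) (hnorm_ge0 x) (hnorm_ge0 y) (hcs x y)).
by rewrite !hnorm_sqr hdotD -hdotC.
Qed.

Lemma hnormZ (c : C) (x : hcomp) : hnorm (c *: x) = `|c| * hnorm x.
Proof. by rewrite /hnorm hdotZl hdotZr sqrtC_scale ?hdot_ge0. Qed.

Lemma hnorm0_eq0 (x : hcomp) : hnorm x = 0 -> x = 0.
Proof. by move=> /eqP; rewrite sqrtC_eq0 => /eqP/hdot_eq0. Qed.

HB.instance Definition _ := Lmodule_isNormed.Build C hcomp hnormD hnormZ hnorm0_eq0.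

Lemma hnormE (x : hcomp) : `|x| = hnorm x. Proof. by []. Qed.

Lemma hembed_ex (a : seq (C * W)) : exists x : hcomp, rep K (fun=> a) x.
Proof. exact: hlim_ex (pcauchy_const K a). Qed.

Definition hembed a : hcomp := sval (cid (hembed_ex a)).
Lemma hembedP a : rep K (fun=> a) (hembed a). Proof. exact: svalP (cid (hembed_ex a)). Qed.

Lemma hdot_embed a b : hdot (hembed a) (hembed b) = gram K a b.
Proof. exact: clim_uniq (hdotP (hembedP a) (hembedP b)) (clim_const _). Qed.

Lemma hval_eq u (x y : hcomp) : rep K u x -> rep K u y -> x = y.
Proof. by move=> rx ry; apply/val_inj; exact: rep_uniq rx ry. Qed.

Lemma hembedB a b : hembed a - hembed b = hembed (psub a b).
Proof.
apply: hval_eq (hembedP _); have := repB (hembedP a) (hembedP b); exact.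
Qed.

Lemma hnorm_embed a : `|hembed a| = nrm K a.
Proof. by rewrite hnormE /hnorm hdot_embed. Qed.

Lemma hembed_approx u (x : hcomp) : rep K u x -> forall e, 0 < e -> exists N, forall n,
  (N <= n)%N -> `|x - hembed (u n)| <= e.
Proof.
move=> ru e e0; have [N h] := ru.1 _ e0; exists N => n Nn.
have r : rep K (fun k => psub (u (k + N)%N) (u n)) (x - hembed (u n)).
  have ru' : rep K (fun k => u (k + N)%N) x.
    split; last by move=> w; have := clim_shift N (ru.2 w).
    move=> d /ru.1[N' h']; exists N' => m k Nm Nk.
    by apply: h'; rewrite (leq_trans _ (leq_addr _ _)).
  exact: (repB ru' (hembedP (u n))).
rewrite hnormE -(@ler_pXn2r _ 2) ?nnegrE ?hnorm_ge0 ?(ltW e0)// hnorm_sqr.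
apply: clim_le (hdotP r r) => k; rewrite -nrm_sqr.
rewrite ler_pXn2r ?nnegrE ?nrm_ge0 ?(ltW e0)// ltW// h//.
by rewrite leq_addl.
Qed.

Definition small n : C := (n.+1%:R^-1 : R)%:C%C.

Lemma small_gt0 n : 0 < small n.
Proof. by rewrite ltcR invr_gt0. Qed.

Lemma small_le m n : (m <= n)%N -> small n <= small m.
Proof. by move=> mn; rewrite lecR lef_pV2 ?posrE// ler_nat. Qed.

Lemma small_lt (e : C) : 0 < e -> exists n, small n < e.
Proof.
case: e => e e'; rewrite ltcE /= => /andP[/eqP-> e0].
exists (Num.truncn e^-1); rewrite ltcR invf_plt ?posrE//.
exact: truncnS_gt.
Qed.

Lemma hcomp_complete (F : set_system hcomp) :
  ProperFilter F -> cauchy F -> cvg F.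
Proof.
move=> PF /cauchyP/(_ _ _) cF.
have [x hx] := choice (fun n => cF _ (small_gt0 n)).
have hd m n : `|x m - x n| < small m + small n.
  have [y [/= ym yn]] := filter_ex (filterI (hx m) (hx n)).
  move: ym yn; rewrite -!ball_normE /ball_ /= => ym yn.
  rewrite (_ : x m - x n = (x m - y) + (y - x n)); last by rewrite addrA subrK.
  apply: le_lt_trans (ler_normD _ _) _; apply: ltrD; first exact: ym.
  by rewrite distrC; exact: yn.
have ha' n : exists b, `|x n - hembed b| <= small n.
  have [N h] := hembed_approx (hseqP (x n)) (small_gt0 n).
  by exists (hseq (x n) N); exact: h.
have [a ha] := choice ha'.
have ca : pcauchy K a.
  move=> e ep; have [N hN] := small_lt (divr_gt0 ep (ltr0n C 4)).
  exists N => m n Nm Nn; rewrite -hnorm_embed -hembedB.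
  rewrite (_ : _ - _ = (hembed (a m) - x m) + (x m - x n) + (x n - hembed (a n))); last first.
    by rewrite !addrA !subrK.
  rewrite (le_lt_trans (ler_normD _ _))//.
  rewrite (le_lt_trans (lerD (ler_normD _ _) (lexx _)))//.
  have -> : e = e / 4 + (e / 4 + e / 4) + e / 4 by field.
  have lm := le_lt_trans (small_le Nm) hN; have ln := le_lt_trans (small_le Nn) hN.
  rewrite ltrD//; last exact: le_lt_trans (ha n) ln.
  rewrite ltrD//; last exact: lt_trans (hd m n) (ltrD lm ln).
  by rewrite distrC; exact: le_lt_trans (ha m) lm.
have [y ry] := hlim_ex ca.
apply/cvg_ex; exists y; apply/cvgrPdist_lt => e ep.
have e4 := divr_gt0 ep (ltr0n C 4).
have [N1 h1] := small_lt e4; have [N2 h2] := hembed_approx ry e4.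
pose n := maxn N1 N2.
apply: filterS (hx n) => z; rewrite -ball_normE /ball_ /= => xz.
rewrite (_ : y - z = (y - hembed (a n)) + (hembed (a n) - x n) + (x n - z)); last first.
  by rewrite !addrA !subrK.
have ln := le_lt_trans (small_le (leq_maxl N1 N2)) h1.
rewrite (le_lt_trans (ler_normD _ _))//.
rewrite (le_lt_trans (lerD (ler_normD _ _) (lexx _)))//.
have -> : e = e / 4 + e / 4 + (e / 4 + e / 4) by field.
rewrite ltr_leD//; last first.
  rewrite (le_trans (ltW (lt_trans xz ln)))// lerDl ltW//.
rewrite ler_ltD//; first exact: h2 (leq_maxr _ _).
by rewrite distrC; exact: le_lt_trans (ha n) ln.
Qed.

HB.instance Definition _ := Uniform_isComplete.Build hcomp hcomp_complete.
End hcomp.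

Section hext.
Variables (R : realType) (W : Type) (K : psd_kernel R[i] W).
Local Notation C := R[i].
Local Notation pre := (seq (C * W)).
Local Notation H := (hcomp K).

Record preop := Preop { pop :> pre -> pre; pop_bnd : C;
  pop_bnd0 : 0 <= pop_bnd;
  popB : forall a b, psub (pop a) (pop b) = pop (psub a b);
  pop_le : forall a, nrm K (pop a) <= pop_bnd * nrm K a }.

Lemma hext_ex (T : preop) (x : H) : exists y : H, rep K (fun n => T (hseq x n)) y.
Proof.
by apply: hlim_ex; apply: pcauchy_bounded (pop_bnd0 T) (pop_le T) (@popB T) (hseqP x).1.
Qed.

Definition hext (T : preop) (x : H) : H := sval (cid (hext_ex T x)).
Lemma hextP (T : preop) (x : H) : rep K (fun n => T (hseq x n)) (hext T x).
Proof. exact: svalP (cid (hext_ex T x)). Qed.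

Lemma hdot_inj (x y : H) : (forall z, hdot x z = hdot y z) -> x = y.
Proof.
move=> h; apply/eqP; rewrite -subr_eq0; apply/eqP/hdot_eq0.
by rewrite -[x - y]addrC -scaleN1r hdot_linl h mulN1r addNr.
Qed.

Lemma hembed_sum (a : pre) : \sum_(x <- a) x.1 *: hembed K [:: (1, x.2)] = hembed K a.
Proof.
elim: a => [|[c w] a IH].
  rewrite big_nil -(subrr (hembed K [::])) hembedB.
  by apply: hval_eq (hembedP _ _); exact: hembedP.
rewrite big_cons IH; apply: hval_eq (hembedP K _).
have := repD (repZ c (hembedP K [:: (1, w)])) (hembedP K a).
by rewrite /psc /= mulr1.
Qed.

Variables (T T' : preop).
Hypothesis TT : forall a b, gram K (T a) b = gram K a (T' b).

Lemma hext_adj (x y : H) : hdot (hext T x) y = hdot x (hext T' y).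
Proof.
apply: clim_uniq (hdotP (hextP T x) (hseqP y)) _.
by apply: eq_clim (hdotP (hseqP x) (hextP T' y)) => n; rewrite TT.
Qed.

Lemma hext_linear : linear (hext T).
Proof.
move=> c x y; apply: hdot_inj => z.
by rewrite hext_adj !hdot_linl -!hext_adj.
Qed.

Lemma hext_bounded (x : H) : `|hext T x| <= pop_bnd T * `|x|.
Proof.
rewrite -(@ler_pXn2r _ 2) ?nnegrE ?mulr_ge0 ?pop_bnd0 ?normr_ge0//.
rewrite exprMn !hnormE !hnorm_sqr -subr_ge0.
have h1 := climZ (pop_bnd T ^+ 2) (hdotP (hseqP x) (hseqP x)).
have h2 := climZ (-1) (hdotP (hextP T x) (hextP T x)).
have := climD h1 h2; rewrite mulN1r; apply: clim_ge0 => n.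
rewrite mulN1r subr_ge0 -!nrm_sqr -exprMn.
rewrite ler_pXn2r ?nnegrE ?nrm_ge0 ?mulr_ge0 ?pop_bnd0 ?nrm_ge0//.
exact: pop_le.
Qed.

Lemma hext_bounded_op : bounded_op (hext T).
Proof.
split; first exact: hext_linear.
move=> x; apply/(@cvgrPdist_lt _ _ _ (nbhs x)) => e e0.
have d0 : 0 < e / (pop_bnd T + 1) by rewrite divr_gt0// ltr_wpDl// pop_bnd0.
have hB z : hext T x - hext T z = hext T (x - z).
  by rewrite addrC -scaleN1r -hext_linear scaleN1r addrC.
apply/nbhs_ballP; exists (e / (pop_bnd T + 1)) => //= z.
rewrite -ball_normE /ball_ /= ltr_pdivlMr ?ltr_wpDl ?pop_bnd0// mulrC => xz.
rewrite hB (le_lt_trans (hext_bounded _))//; apply: le_lt_trans xz.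
by rewrite ler_wpM2r// lerDl.
Qed.

Lemma hext_embed a : hext T (hembed K a) = hembed K (T a).
Proof.
apply: hdot_inj => z; apply: etrans (hext_adj _ _) _.
apply: clim_uniq (hdotP (hembedP K a) (hextP T' z)) _.
by apply: eq_clim (hdotP (hembedP K (T a)) (hseqP z)) => n; rewrite TT.
Qed.

End hext.

Section fock.
Variable R : realType.
Local Notation C := R[i].
Local Notation W := (seq (l2 R)).
Local Notation pre := (seq (C * W)).

Lemma tens_dotC (s t : W) : tens_dot s t = Num.conj (tens_dot t s).
Proof.
elim: s t => [|f s IH] [|g t] /=; rewrite ?rmorph1 ?rmorph0//.
by rewrite rmorphM /= -IH -l2_dotC.
Qed.

Definition hdf (w : W) (t : R) : C := if w is f :: _ then f t else 0.
Definition isnil (w : W) : C := if w is [::] then 1 else 0.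

Lemma hdf_integrable v w : cintegrable (fun t => hdf v t * Num.conj (hdf w t)).
Proof.
case: v w => [|f v] [|g w] /=; last exact: l2_cintegrable.
all: by rewrite (_ : (fun=> _) = fun=> 0) ?cintegrable0; [exact: cintegrable0|apply/funext => t; rewrite ?mul0r ?rmorph0 ?mulr0].
Qed.

Lemma tens_dot_step v w : tens_dot v w = isnil v * isnil w +
  cint (fun t => hdf v t * Num.conj (hdf w t)) * tens_dot (behead v) (behead w).
Proof.
have z f : (forall t, f t = 0) -> cint f = 0 :> C.
  by move=> f0; rewrite (eq_cint (g := fun=> 0)) ?cint0.
case: v w => [|f v] [|g w] /=; rewrite ?mul0r ?mul1r ?mulr0 ?add0r//.
all: by rewrite z ?mul0r ?addr0// => t; rewrite ?mul0r ?rmorph0 ?mulr0.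
Qed.

Definition slice (a : pre) t : pre := [seq (x.1 * hdf x.2 t, behead x.2) | x <- a].

Lemma gram_step a : gram (@tens_dot R) a a =
  `|\sum_(x <- a) x.1 * isnil x.2| ^+ 2 +
  cint (fun t => gram (@tens_dot R) (slice a t) (slice a t)).
Proof.
rewrite normCK rmorph_sum mulr_suml /gram.
pose g (x y : C * W) t := x.1 * hdf x.2 t * Num.conj (y.1 * hdf y.2 t) *
   tens_dot (behead x.2) (behead y.2).
have gE x y t : g x y t = (x.1 * Num.conj y.1 * tens_dot (behead x.2) (behead y.2)) *
   (hdf x.2 t * Num.conj (hdf y.2 t)).
  by rewrite /g rmorphM /=; ring.
have gi x y : cintegrable (g x y).
  by rewrite (funext (gE x y)); exact/cintegrableZ/hdf_integrable.
rewrite (eq_cint (g := fun t => \sum_(x <- a) \sum_(y <- a) g x y t)); last first.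
  by move=> t; rewrite /slice big_map; apply: eq_bigr => x _; rewrite big_map.
rewrite cint_sum; last by move=> x; apply: cintegrable_sum.
rewrite -big_split; apply: eq_bigr => x _ /=.
rewrite cint_sum// mulr_sumr -big_split; apply: eq_bigr => y _ /=.
rewrite (eq_cint (gE x y)) cintZ; last exact: hdf_integrable.
rewrite tens_dot_step rmorphM /=.
have -> : Num.conj (isnil y.2) = isnil y.2 by case: (y.2) => [|? ?] /=; rewrite ?rmorph1 ?rmorph0.
ring.
Qed.

Lemma tens_dot_psd (a : pre) : 0 <= gram (@tens_dot R) a a.
Proof.
have [m hm] : exists m, forall x, List.In x a -> (size x.2 <= m)%N.
  elim: a => [|x a [m hm]]; first by exists 0%N.
  exists (maxn (size x.2) m) => y /= [<-|/hm h]; first exact: leq_maxl.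
  exact: leq_trans h (leq_maxr _ _).
elim: m a hm => [|m IH] a hm; rewrite gram_step addr_ge0 ?exprn_ge0//.
  apply: cint_ge0 => t.
  suff -> : slice a t = [seq (0, behead x.2) | x <- a].
    rewrite /gram big1// => x _; rewrite big_map big1// => y _.
    by rewrite rmorph0 mulr0 mul0r.
  elim: a hm => //= x a IHa hm; rewrite IHa; last by move=> y ya; apply: hm; right.
  congr (_ :: _); have := hm x (or_introl erefl).
  by case: (x.2) => //= _; rewrite mulr0.
apply: cint_ge0 => t; apply: IH => y /List.in_map_iff[x [<- /hm /=]].
by rewrite size_behead; case: (size _).
Qed.

Definition fockK : psd_kernel C W := PsdKernel tens_dotC tens_dot_psd.
Local Notation B := (gram fockK).

Lemma map_psub (k : W -> C) (tau : W -> W) (a b : pre) :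
  psub [seq (x.1 * k x.2, tau x.2) | x <- a] [seq (x.1 * k x.2, tau x.2) | x <- b] =
  [seq (x.1 * k x.2, tau x.2) | x <- psub a b].
Proof.
rewrite /psub /psc map_cat -!map_comp; congr (_ ++ _); apply: eq_map => x /=.
by rewrite mulrA.
Qed.

Variable h : l2 R.

Definition cre (a : pre) : pre := [seq (x.1 * 1, h :: x.2) | x <- a].
Definition annk (w : W) : C := if w is f :: _ then l2_dot f h else 0.
Definition ann (a : pre) : pre := [seq (x.1 * annk x.2, behead x.2) | x <- a].

Lemma gram_cre_ann a b : B (cre a) b = B a (ann b).
Proof.
rewrite /gram big_map; apply: eq_bigr => x _; rewrite big_map.
apply: eq_bigr => -[c [|f w]] _ /=; first by rewrite !mulr0 rmorph0 mulr0 mul0r.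
rewrite rmorphM /= -l2_dotC; ring.
Qed.

Lemma gram_cre a b : B (cre a) (cre b) = l2_dot h h * B a b.
Proof.
rewrite /gram big_map mulr_sumr; apply: eq_bigr => x _; rewrite big_map mulr_sumr.
by apply: eq_bigr => y _ /=; rewrite !mulr1; ring.
Qed.

Lemma l2_dot_ge0 : 0 <= l2_dot h h.
Proof. by rewrite l2_dotE; apply: cint_ge0 => t; rewrite mul_conjC_ge0. Qed.

Let M := sqrtC (l2_dot h h).
Let M0 : 0 <= M. Proof. by rewrite sqrtC_ge0 l2_dot_ge0. Qed.

Lemma nrm_cre a : nrm fockK (cre a) = M * nrm fockK a.
Proof. by rewrite /nrm gram_cre rootCMl ?l2_dot_ge0. Qed.

Lemma nrm_ann a : nrm fockK (ann a) <= M * nrm fockK a.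
Proof.
have [->|n0] := eqVneq (nrm fockK (ann a)) 0; first by rewrite mulr_ge0 ?nrm_ge0.
have np : 0 < nrm fockK (ann a) by rewrite lt_def n0 nrm_ge0.
rewrite -(ler_pM2l np) -expr2 nrm_sqr -gram_cre_ann.
have := pre_cs fockK (cre (ann a)) a.
rewrite nrm_cre ger0_norm; last by rewrite gram_cre_ann ker_psd.
by move=> /le_trans; apply; rewrite mulrCA mulrA.
Qed.

Definition cre_op : preop fockK.
Proof.
apply: (@Preop _ _ fockK cre M M0) => [a b|a]; last by rewrite nrm_cre.
exact: (map_psub (fun=> 1)).
Defined.

Definition ann_op : preop fockK.
Proof.
apply: (@Preop _ _ fockK ann M M0) => [a b|a]; last exact: nrm_ann.
exact: (map_psub annk).
Defined.

End fock.

Lemma full_fock_inhabited (R : realType) : inhabited (full_fock R).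
Proof.
pose H := hcomp (fockK R).
pose ten s : H := hembed (fockK R) [:: (1, s)].
apply: inhabits; apply: (@FullFock R H (@hdot _ _ (fockK R)) _ ten _ _
  (fun h => hext (cre_op h)) _ _ _).
- by move=> x; rewrite hnormE hnorm_sqr.
- move=> s s'; change (hdot (ten s) (ten s') = tens_dot s s'); 
  rewrite /ten hdot_embed /gram !big_seq1 /=.
  by rewrite rmorph1 !mul1r.
- move=> x e e0.
  have e2 : 0 < e / 2 by rewrite divr_gt0.
  have [N hN] := hembed_approx (hseqP x) e2.
  have := hN N (leqnn N); set a := hseq x N => ha.
  exists (size a), (fun i => (tnth (in_tuple a) i).1), (fun i => (tnth (in_tuple a) i).2).
  rewrite (_ : \sum_(i < _) _ = hembed _ a).
    by apply: le_lt_trans ha _; rewrite ltr_pdivrMr// ltr_pMr// ltr1n.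
  by rewrite -hembed_sum [RHS]big_tnth.
- by move=> h; exact: (@hext_bounded_op _ _ _ (cre_op h) (ann_op h) (gram_cre_ann h)).
- move=> h s; rewrite /ten (@hext_embed _ _ _ (cre_op h) (ann_op h) (gram_cre_ann h)).
  by rewrite /= /cre /= mulr1.
- move=> h; exists (hext (ann_op h)).
  exact: (@hext_adj _ _ _ (cre_op h) (ann_op h) (gram_cre_ann h)).
Qed.

End FockModel.

(* Main.v *)
(* Let r(xi) be the right creation operators, P the vacuum projection and Omega
   the vacuum. For A in the algebra generated by the S(h), the commutator
   [r(xi)^*, A] is the image of the derivative of A, paired with xi, under
   x (x) y |-> x P y. Hence, for a projection p in the domain of the derivative
   and a real orthonormal basis (xi_i), the sum of the squared Hilbert-Schmidt
   norms of the [r(xi_i)^*, p] is finite.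
   Let q be the projection such that q r(xi) = r(xi) p and q Omega = 0. Then
   D = p - q is Hilbert-Schmidt, so |D p|^2 - |D q|^2 = tr D^3 (Hilbert-Schmidt
   norms) is an integer, the index of the pair (p, q): D^2 commutes with p and q,
   the traces of D^(2n) p and of D^(2n) q differ by a quantity that does not
   depend on n >= 1, and each tends to the dimension of an eigenspace of D.
   On the other hand p commutes with r(xi) + r(xi)^* for real xi, and this makes
   |D p|^2 - |D q|^2 equal to |p Omega|^2. So |p Omega|^2 is 0 or 1, and Omega is
   separating. *)

From HB Require Import structures.
Require Import Defs.
From mathcomp Require Import all_boot all_order all_algebra.
From mathcomp Require Import all_classical all_reals all_analysis.
From mathcomp Require Import measurable_realfun complex ring lra.
Set Implicit Arguments.
Unset Strict Implicit.
Unset Printing Implicit Defensive.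
Import Order.TTheory GRing.Theory Num.Theory.
Import numFieldNormedType.Exports.
Local Open Scope classical_set_scope.
Local Open Scope ring_scope.

(** * Hilbert spaces *)

(** The operator [D] assembles all the commutators at once: [D r(xi_i) = [p, r(xi_i)]] and
    [D Omega = p Omega]. Since [p] commutes with [r(xi_i) + r(xi_i)^*], these commutators are the
    [[r(xi_i)^*, p]] that the derivative controls. The traces of [p] and [q] may be infinite and [D]
    is only Hilbert-Schmidt, so no trace is ever formed. Each trace identity becomes an equality of
    Hilbert-Schmidt norms, i.e. of sums of nonnegative extended reals, written additively and
    cancelled only once a term is known to be finite; invariance under adjoints replaces cyclicity.
    The [xi_i] have to be real, because otherwise the vacuum terms in the commutator of
    [r(xi) + r(xi)^*] with [S(h)] do not cancel in general. The other obstacle is that the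
    approximants of [p] converge only in [L^2], i.e. on the vacuum, without control of their
    operator norms. The derivative of [p] itself is never constructed: uniform bounds on finite sums
    for the approximants pass to the limit. *)

Lemma le0_eps (R : realType) (a : R) : (forall e : R, 0 < e -> a <= e) -> a <= 0.
Proof. by move=> h; apply/ler_addgt0Pr => e e0; rewrite add0r h. Qed.

Section SquaredModulus.
Variable R : realType.
Implicit Types z : R[i].
Local Notation Re := (@complex.Re R).
Local Notation Im := (@complex.Im R).

Definition sqmod z : R := Re z ^+ 2 + Im z ^+ 2.

Lemma sqmod_ge0 z : 0 <= sqmod z.
Proof. by rewrite addr_ge0 ?sqr_ge0. Qed.

Lemma mul_conj_sqmod z : z * Num.conj z = (sqmod z)%:C%C.
Proof.
apply: FockModel.ReIm_eq;
  rewrite ?FockModel.ReM ?FockModel.ImM ?FockModel.ReJ ?FockModel.ImJ /sqmod /=; ring.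
Qed.

Lemma sqmodM z z' : sqmod (z * z') = sqmod z * sqmod z'.
Proof. rewrite /sqmod FockModel.ReM FockModel.ImM; ring. Qed.

Lemma sqmod_real (a : R) : sqmod a%:C%C = a ^+ 2.
Proof. by rewrite /sqmod /= expr0n addr0. Qed.

Lemma conj_real (a : R) : Num.conj a%:C%C = a%:C%C :> R[i].
Proof. by apply: FockModel.ReIm_eq; rewrite ?FockModel.ReJ ?FockModel.ImJ/= ?oppr0. Qed.

Lemma sqmodJ z : sqmod (Num.conj z) = sqmod z.
Proof. by rewrite /sqmod FockModel.ReJ FockModel.ImJ sqrrN. Qed.

Lemma sqmod0 : sqmod 0 = 0.
Proof. by rewrite /sqmod /= expr0n addr0. Qed.

Lemma sqmod_eq0 z : sqmod z = 0 -> z = 0.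
Proof.
move=> /eqP; rewrite paddr_eq0 ?sqr_ge0// !sqrf_eq0 => /andP[/eqP a /eqP b].
exact: FockModel.ReIm_eq.
Qed.

Lemma sqmodN z : sqmod (- z) = sqmod z.
Proof. by rewrite /sqmod !raddfN /= !sqrrN. Qed.

Lemma sqmodD_le z z' : sqmod (z + z') <= 2 * sqmod z + 2 * sqmod z'.
Proof.
have := sqmod_ge0 (z - z'); rewrite /sqmod !(raddfB, raddfD) /=; nra.
Qed.

Lemma sqr_Re_le z : Re z ^+ 2 <= sqmod z.
Proof. by rewrite lerDl sqr_ge0. Qed.

Lemma sqr_Im_le z : Im z ^+ 2 <= sqmod z.
Proof. by rewrite lerDr sqr_ge0. Qed.

Lemma complexE z : z = (Re z)%:C%C + 'i%C * (Im z)%:C%C.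
Proof. by case: z => a b; apply: FockModel.ReIm_eq => /=; ring. Qed.

End SquaredModulus.

Section Hilbert.
Variables (R : realType) (H : completeNormedModType R[i]).
Variable dot : {dot H for (@Num.conj R[i])}.
Hypothesis dotE : forall x, dot x x = `|x| ^+ 2.
Local Notation C := R[i].
Local Notation Re := (@complex.Re R).
Local Notation Im := (@complex.Im R).
Implicit Types (x y z : H) (u : nat -> H) (A B : H -> H).

Lemma dotDl x y z : dot (x + y) z = dot x z + dot y z. Proof. exact: linearDl. Qed.
Lemma dotDr x y z : dot x (y + z) = dot x y + dot x z. Proof. exact: linearDr. Qed.
Lemma dotZl c x y : dot (c *: x) y = c * dot x y. Proof. exact: linearZl_LR. Qed.
Lemma dotZr c x y : dot x (c *: y) = Num.conj c * dot x y. Proof. exact: linearZr_LR. Qed.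
Lemma dotNl x y : dot (- x) y = - dot x y. Proof. by rewrite -scaleN1r dotZl mulN1r. Qed.
Lemma dotNr x y : dot x (- y) = - dot x y.
Proof. by rewrite -scaleN1r dotZr rmorphN rmorph1 mulN1r. Qed.
Lemma dotBl x y z : dot (x - y) z = dot x z - dot y z. Proof. by rewrite dotDl dotNl. Qed.
Lemma dotBr x y z : dot x (y - z) = dot x y - dot x z. Proof. by rewrite dotDr dotNr. Qed.
Lemma dot0l x : dot 0 x = 0. Proof. by rewrite -(scale0r 0) dotZl mul0r. Qed.
Lemma dot0r x : dot x 0 = 0. Proof. by rewrite -(scale0r 0) dotZr rmorph0 mul0r. Qed.
Lemma dotC x y : dot x y = Num.conj (dot y x).
Proof. by have := @hermC _ false _ _ dot x y; rewrite expr0 mul1r. Qed.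

Lemma dot_suml (I : Type) (r : seq I) (f : I -> H) y :
  dot (\sum_(i <- r) f i) y = \sum_(i <- r) dot (f i) y.
Proof. by elim: r => [|i r IH]; rewrite ?big_nil ?dot0l// !big_cons dotDl IH. Qed.

Lemma dot_sumr (I : Type) (r : seq I) (f : I -> H) x :
  dot x (\sum_(i <- r) f i) = \sum_(i <- r) dot x (f i).
Proof. by elim: r => [|i r IH]; rewrite ?big_nil ?dot0r// !big_cons dotDr IH. Qed.

(** The norm of [H] takes values in [R[i]]; estimates are made with this real number, which suits
    both [lra] and sums in [\bar R]. *)
Definition sqnorm x : R := Re (dot x x).
Local Notation nsq := sqnorm.

Lemma dot_nsq x : dot x x = (nsq x)%:C%C.
Proof.
have : Im (dot x x) = 0.
  have := congr1 Im (dotC x x); rewrite FockModel.ImJ; lra.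
by rewrite /sqnorm; case: (dot x x) => a b /= ->.
Qed.

Lemma norm_nsq x : `|x| ^+ 2 = (nsq x)%:C%C.
Proof. by rewrite -dotE dot_nsq. Qed.

Lemma nsq_ge0 x : 0 <= nsq x.
Proof. by rewrite -ler0c -norm_nsq exprn_ge0. Qed.

Lemma nsq_eq0 x : nsq x = 0 -> x = 0.
Proof.
move=> x0; apply/eqP; rewrite -normr_eq0 -sqrf_eq0; apply/eqP.
by rewrite norm_nsq x0.
Qed.

Lemma nsq0 : nsq 0 = 0. Proof. by rewrite /sqnorm dot0l. Qed.

Lemma nsqZ c x : nsq (c *: x) = sqmod c * nsq x.
Proof.
rewrite /sqnorm dotZl dotZr dot_nsq mulrA mul_conj_sqmod FockModel.ReM /=; ring.
Qed.

Lemma nsqZr (a : R) x : nsq (a%:C%C *: x) = a ^+ 2 * nsq x.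
Proof. by rewrite nsqZ sqmod_real. Qed.

Lemma nsqN x : nsq (- x) = nsq x.
Proof. by rewrite /sqnorm dotNl dotNr opprK. Qed.

Lemma nsqD x y : nsq (x + y) = nsq x + nsq y + 2 * Re (dot x y).
Proof.
rewrite /sqnorm dotDl !dotDr (dotC y x) !FockModel.ReD FockModel.ReJ; ring.
Qed.

Lemma nsqB x y : nsq (x - y) = nsq x + nsq y - 2 * Re (dot x y).
Proof. by rewrite nsqD nsqN dotNr raddfN/= mulrN. Qed.

Lemma nsq_subC x y : nsq (x - y) = nsq (y - x).
Proof. by rewrite -nsqN opprB. Qed.

Lemma nsqD_le x y : nsq (x + y) <= 2 * nsq x + 2 * nsq y.
Proof.
have := nsq_ge0 (x - y); rewrite nsqB nsqD; lra.
Qed.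

Lemma nsq_sub_le x y z : nsq (x - z) <= 2 * nsq (x - y) + 2 * nsq (y - z).
Proof. by rewrite -[x - z](subrKA y); exact: nsqD_le. Qed.

Lemma cauchy_schwarz x y : sqmod (dot x y) <= nsq x * nsq y.
Proof.
have [y0|yn0] := eqVneq (nsq y) 0.
  by rewrite (nsq_eq0 y0) dot0r sqmod0 nsq0 mulr0.
have yp : 0 < nsq y by rewrite lt_def yn0 nsq_ge0.
have := nsq_ge0 ((nsq y)%:C%C *: x - dot x y *: y).
rewrite nsqB nsqZr nsqZ dotZl dotZr [X in Re (_ * X)]mulrC mul_conj_sqmod -rmorphM /=.
rewrite (_ : _ - _ = nsq y * (nsq x * nsq y - sqmod (dot x y))); last by ring.
by rewrite pmulr_rge0// subr_ge0.
Qed.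

Lemma dot_sep x : (forall y, dot x y = 0) -> x = 0.
Proof. by move=> h; apply: nsq_eq0; rewrite /sqnorm h. Qed.

Lemma dot_inj x y : (forall z, dot x z = dot y z) -> x = y.
Proof. by move=> h; apply/subr0_eq/dot_sep => z; rewrite dotBl h subrr. Qed.

Definition hcvg u x := forall e : R, 0 < e ->
  exists N, forall n, (N <= n)%N -> nsq (u n - x) < e.

Lemma hcvg_cst x : hcvg (fun=> x) x.
Proof. by move=> e e0; exists 0%N => n _; rewrite subrr nsq0. Qed.

Lemma hcvgD u (v : nat -> H) x y : hcvg u x -> hcvg v y -> hcvg (fun n => u n + v n) (x + y).
Proof.
move=> ux vy e e0; have e4 : 0 < e / 4 by rewrite divr_gt0.
have [N1 h1] := ux _ e4; have [N2 h2] := vy _ e4.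
exists (maxn N1 N2) => n; rewrite geq_max => /andP[/h1 n1 /h2 n2].
rewrite opprD addrACA; have := nsqD_le (u n - x) (v n - y); lra.
Qed.

Lemma hcvg_bounded A (M : R) u x : (forall y z, A (y - z) = A y - A z) ->
  (forall y, nsq (A y) <= M * nsq y) -> hcvg u x -> hcvg (A \o u) (A x).
Proof.
move=> AB AM ux e e0; have M1 : 0 < `|M| + 1 by rewrite ltr_wpDl.
have [N h] := ux _ (divr_gt0 e0 M1).
exists N => n /h; rewrite ltr_pdivlMr// => lt; rewrite /= -AB.
apply: le_lt_trans (AM _) _; apply: le_lt_trans lt; rewrite mulrC.
apply: ler_wpM2l; first exact: nsq_ge0.
by rewrite (le_trans (ler_norm _))// lerDl.
Qed.

Lemma hcvgZ c u x : hcvg u x -> hcvg (fun n => c *: u n) (c *: x).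
Proof.
apply: (@hcvg_bounded (fun y => c *: y) (sqmod c)) => [y z|y].
  by rewrite scalerBr.
by rewrite nsqZ.
Qed.

Lemma hcvg_sqmod0 u x y : hcvg u x -> forall e : R, 0 < e ->
  exists N, forall n, (N <= n)%N -> sqmod (dot (u n) y - dot x y) < e.
Proof.
move=> ux e e0; have y1 : 0 < nsq y + 1 by rewrite ltr_wpDl ?nsq_ge0.
have [N h] := ux _ (divr_gt0 e0 y1); exists N => n /h; rewrite ltr_pdivlMr// => lt.
rewrite -dotBl; apply: le_lt_trans (cauchy_schwarz _ _) _.
by apply: le_lt_trans lt; rewrite ler_wpM2l ?nsq_ge0// lerDl.
Qed.

Lemma hcvg_dot u (v : nat -> H) x y : hcvg u x -> hcvg v y -> forall e : R, 0 < e ->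
  exists N, forall n, (N <= n)%N -> sqmod (dot (u n) (v n) - dot x y) < e.
Proof.
move=> ux vy e e0; have e4 := divr_gt0 e0 (ltr0n R 4).
have x1 : 0 < 2 * nsq x + 2 by rewrite ltr_wpDl ?mulr_ge0 ?nsq_ge0.
have [N1 h1] := hcvg_sqmod0 y ux e4.
have [N2 h2] := vy _ (divr_gt0 e4 x1); have [N3 h3] := ux _ ltr01.
exists (maxn N1 (maxn N2 N3)) => n; rewrite !geq_max => /and3P[/h1 lt1 /h2 lt2 /h3 lt3].
rewrite (_ : _ - _ = dot (u n) (v n - y) + (dot (u n) y - dot x y)); last first.
  by rewrite dotBr; ring.
have -> : e = 2 * (e / 4) + 2 * (e / 4) by field.
apply: le_lt_trans (sqmodD_le _ _) _; apply: ltrD; rewrite ltr_pM2l//.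
apply: le_lt_trans (cauchy_schwarz _ _) _; move: lt2; rewrite ltr_pdivlMr// mulrC.
apply: le_lt_trans; apply: ler_wpM2r; first exact: nsq_ge0.
rewrite -[u n](subrK x); have := nsqD_le (u n - x) x.
move: (nsq _) lt3 (nsq (_ + _)) => a lt3 b; lra.
Qed.

Lemma hcvg_dot_eq u (v : nat -> H) u' v' x y x' y' : hcvg u x -> hcvg v y ->
  hcvg u' x' -> hcvg v' y' -> (forall n, dot (u n) (v n) = dot (u' n) (v' n)) ->
  dot x y = dot x' y'.
Proof.
move=> ux vy ux' vy' h; apply/subr0_eq/sqmod_eq0/eqP; rewrite eq_le sqmod_ge0 andbT.
apply: le0_eps => e e0; have e4 := divr_gt0 e0 (ltr0n R 4).
have [N1 h1] := hcvg_dot ux vy e4; have [N2 h2] := hcvg_dot ux' vy' e4.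
pose n := maxn N1 N2; have lt1 := h1 n (leq_maxl _ _); have lt2 := h2 n (leq_maxr _ _).
rewrite (_ : _ - _ = - (dot (u n) (v n) - dot x y) + (dot (u' n) (v' n) - dot x' y')); last first.
  by rewrite h; ring.
apply: le_trans (sqmodD_le _ _) _; rewrite sqmodN.
have -> : e = 2 * (e / 4) + 2 * (e / 4) by field.
by apply: lerD; rewrite ler_pM2l//; exact: ltW.
Qed.

Lemma hcvg_dot0 u x y : hcvg u x -> (forall n, dot (u n) y = 0) -> dot x y = 0.
Proof.
move=> ux h; apply: sqmod_eq0; apply/eqP; rewrite eq_le sqmod_ge0 andbT.
apply: le0_eps => e e0.
have [N /(_ N (leqnn N))] := hcvg_sqmod0 y ux e0.
by rewrite h sub0r -mulN1r sqmodM /sqmod /= oppr0 expr0n addr0 sqrrN expr1n mul1r => /ltW.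
Qed.

Lemma hcvg_Im0 u x y : hcvg u x -> (forall n, Im (dot (u n) y) = 0) -> Im (dot x y) = 0.
Proof.
move=> ux h; apply/eqP; rewrite -sqrf_eq0 eq_le sqr_ge0 andbT.
apply: le0_eps => e e0.
have [N /(_ N (leqnn N)) /ltW] := hcvg_sqmod0 y ux e0.
by apply: le_trans; rewrite -[leLHS]sqrrN (le_trans _ (sqr_Im_le _))// raddfB/= h sub0r.
Qed.

Lemma hcvg_uniq u x y : hcvg u x -> hcvg u y -> x = y.
Proof.
move=> ux uy; apply/subr0_eq/nsq_eq0/eqP; rewrite eq_le nsq_ge0 andbT.
apply: le0_eps => e e0; have e4 : 0 < e / 4 by rewrite divr_gt0.
have [N1 h1] := ux _ e4; have [N2 h2] := uy _ e4.
have := h1 (maxn N1 N2) (leq_maxl _ _); have := h2 (maxn N1 N2) (leq_maxr _ _).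
have := nsq_sub_le x (u (maxn N1 N2)) y; rewrite (nsq_subC x (u _)); lra.
Qed.

Lemma norm_lt_nsq x (e : R) : 0 < e -> (`|x| < e%:C%C) = (nsq x < e ^+ 2).
Proof.
move=> e0; rewrite -(@ltr_pXn2r _ 2)// ?nnegrE ?normr_ge0 ?ler0c ?(ltW e0)//.
by rewrite norm_nsq -rmorphXn ltcR.
Qed.

Lemma hcomplete u : (forall e : R, 0 < e -> exists N, forall m n,
    (N <= m)%N -> (N <= n)%N -> nsq (u m - u n) < e) -> exists x, hcvg u x.
Proof.
move=> cu; have : cvg (u @ \oo).
  apply: cauchy_cvg; apply: cauchy_exP => -[e e'].
  rewrite ltcE /= => /andP[/eqP-> e0].
  have [N h] := cu _ (exprn_gt0 2 e0); exists (u N).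
  by exists N => // n /= Nn; rewrite -ball_normE /ball_ /= norm_lt_nsq// h.
move=> ul; exists (lim (u @ \oo)) => e e0.
have se0 : 0 < Num.sqrt e by rewrite sqrtr_gt0.
have /cvgrPdist_lt/(_ (Num.sqrt e)%:C%C ltac:(by rewrite ltcR))[N _ h] := ul; exists N => n /h /=.
by rewrite norm_lt_nsq// sqr_sqrtr ?(ltW e0)// nsq_subC.
Qed.

(** * Orthogonal projection onto closed subspaces *)

Section projection.
Variable V : set H.
Hypothesis V0 : V 0.
Hypothesis VD : forall x y, V x -> V y -> V (x + y).
Hypothesis VZ : forall (a : R) x, V x -> V (a%:C%C *: x).
Hypothesis Vcl : forall u x, (forall n, V (u n)) -> hcvg u x -> V x.

(** Asking for real scalars only, and orthogonality for [Re dot], covers the real span of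
    one-particle vectors as well as complex subspaces. A minimizing sequence is Cauchy by the
    parallelogram law. *)
Lemma hilbert_proj x : exists2 y, V y & forall v : H, V v -> Re (dot (x - y) v) = 0.
Proof.
pose S := [set nsq (x - v) | v in V]; pose d := inf S.
have hS : has_inf S.
  by split; [exists (nsq (x - 0)); exists 0|exists 0 => _ [v _ <-]; exact: nsq_ge0].
have dle (v : H) : V v -> d <= nsq (x - v).
  by move=> Vv; apply: ge_inf; [exact: hS.2|exists v].
have h n : exists v, V v /\ nsq (x - v) < d + n.+1%:R^-1.
  have [_ [v Vv <-] lt] := @inf_adherent _ S n.+1%:R^-1 ltac:(by rewrite invr_gt0) hS.
  by exists v.
have [u hu] := choice h.
have small (e : R) : 0 < e -> exists N, forall n, (N <= n)%N -> n.+1%:R^-1 < e.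
  move=> e0; exists (Num.truncn e^-1) => n Nn.
  rewrite invf_plt ?posrE//; apply: lt_le_trans (truncnS_gt _) _.
  by rewrite ler_nat.
have [y uy] : exists y, hcvg u y.
  apply: hcomplete => e e0; have [N hN] := small _ (divr_gt0 e0 (ltr0n _ 4)).
  exists N => m n Nm Nn.
  have mid : d <= nsq (x - (2^-1)%:C%C *: (u m + u n)).
    by apply/dle/VZ/VD; [exact: (hu m).1|exact: (hu n).1].
  have E : nsq (u m - u n) = 2 * nsq (x - u m) + 2 * nsq (x - u n) -
      4 * nsq (x - (2^-1)%:C%C *: (u m + u n)).
    rewrite !nsqB nsqZr nsqD dotZr dotDr.
    rewrite (_ : Num.conj _ = (2^-1)%:C%C); last first.
      exact: conj_real.
    by rewrite FockModel.ReM /= mul0r subr0 FockModel.ReD; field.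
  have [m2 n2 m3 n3] := And4 (hu m).2 (hu n).2 (hN _ Nm) (hN _ Nn).
  have m4 := lt_trans m2 (ler_ltD (lexx d) m3).
  have n4 := lt_trans n2 (ler_ltD (lexx d) n3).
  rewrite E; lra.
exists y; first by apply: Vcl uy => n; exact: (hu n).1.
move=> v Vv; apply/eqP; rewrite -sqrf_eq0 eq_le sqr_ge0 andbT.
have [v0|vn0] := eqVneq (nsq v) 0.
  by rewrite (nsq_eq0 v0) dot0r /= expr0n.
have vp : 0 < nsq v by rewrite lt_def vn0 nsq_ge0.
have key n : Re (dot (x - u n) v) ^+ 2 <= nsq v * n.+1%:R^-1.
  (* Moving [u n] by [r / nsq v] along [v] lowers the squared distance by [r ^+ 2 / nsq v], the
     largest possible amount; as [u n] is nearly optimal, this is at most [n.+1%:R^-1]. *)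
  set r := Re _; have : d <= nsq (x - (u n + (r / nsq v)%:C%C *: v)).
    by apply/dle/VD/VZ => //; exact: (hu n).1.
  rewrite opprD addrA nsqB nsqZr dotZr.
  rewrite (_ : Num.conj _ = (r / nsq v)%:C%C); last first.
    exact: conj_real.
  rewrite FockModel.ReM /= mul0r subr0 -/r.
  rewrite (_ : _ - _ = nsq (x - u n) - r ^+ 2 / nsq v); last by field.
  have lt := (hu n).2 => le.
  have -> : r ^+ 2 = nsq v * (r ^+ 2 / nsq v) by field.
  rewrite ler_pM2l//; move: lt le; set t := _ / _; set i := _^-1; set a := nsq _.
  clearbody t i a; lra.
apply: le0_eps => e e0.
have e4 := divr_gt0 e0 (ltr0n R 4).
have [N1 h1] := small _ (divr_gt0 e4 vp); have [N2 h2] := hcvg_sqmod0 v uy e4.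
pose n := maxn N1 N2.
have := h1 n (leq_maxl _ _); rewrite ltr_pdivlMr// mulrC => lt1.
have := h2 n (leq_maxr _ _) => lt2.
have lt3 := sqr_Re_le (dot (u n) v - dot y v).
have := key n; rewrite !dotBl !raddfB/= in lt3 *.
set a := Re (dot x v) in lt3 *; set b := Re (dot (u n) v) in lt3 *; set c := Re _ in lt3 *.
have := sqr_ge0 (a - b - (b - c)).
have -> : (a - c) ^+ 2 = 2 * (a - b) ^+ 2 + 2 * (b - c) ^+ 2 - (a - b - (b - c)) ^+ 2.
  by ring.

move=> q0 lt4; apply: le_trans (_ : 2 * (e / 4) + 2 * (e / 4) <= e); last by lra.
have lt5 := le_lt_trans lt4 lt1; have lt6 := le_lt_trans lt3 lt2.
rewrite lerBlDr ler_wpDr//; apply: lerD; rewrite ler_pM2l//; exact: ltW.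
Qed.

End projection.

(** Orthogonality for [Re dot] to both [v] and ['i *: v] is orthogonality for [dot]. *)
Lemma hilbert_projC (V : set H) : V 0 ->
  (forall x y, V x -> V y -> V (x + y)) ->
  (forall c x, V x -> V (c *: x)) ->
  (forall u x, (forall n, V (u n)) -> hcvg u x -> V x) ->
  forall x, exists2 y, V y & forall v : H, V v -> dot (x - y) v = 0.
Proof.
move=> V0 VD VZ Vcl x; have [y Vy h] := hilbert_proj V0 VD (fun a => VZ a%:C%C) Vcl x.
exists y => // v Vv; apply: FockModel.ReIm_eq; first exact: h.
have := h _ (VZ 'i%C _ Vv); rewrite dotZr FockModel.ReM /= => <-; ring.
Qed.

(** * Total families and isometries *)

Section families.
Variables (W : Type) (b : W -> H).

Definition total_family := forall x, (forall w, dot x (b w) = 0) -> x = 0.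

Definition lincomb (f : W -> H) (a : seq (C * W)) := \sum_(p <- a) p.1 *: f p.2.

Lemma lincombD f a a' : lincomb f (a ++ a') = lincomb f a + lincomb f a'.
Proof. by rewrite /lincomb big_cat. Qed.

Lemma lincombZ f c a : lincomb f [seq (c * p.1, p.2) | p <- a] = c *: lincomb f a.
Proof.
by rewrite /lincomb big_map scaler_sumr; apply: eq_bigr => p _; rewrite scalerA.
Qed.

(** The vectors that can be approximated form a closed subspace containing the family; the residue
    of the projection onto it is orthogonal to the family, hence 0. *)
Lemma total_approx : total_family -> forall x (e : R), 0 < e ->
  exists a, nsq (x - lincomb b a) < e.
Proof.
move=> tb; pose V x := forall e : R, 0 < e -> exists a, nsq (x - lincomb b a) < e.
suff hV x : V x by move=> x; exact: hV.
have V0 : V 0.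
  by move=> e e0; exists [::]; rewrite /lincomb big_nil subrr nsq0.
have VD y z : V y -> V z -> V (y + z).
  move=> Vy Vz e e0; have [a ha] := Vy _ (divr_gt0 e0 (ltr0n R 4)).
  have [a' ha'] := Vz _ (divr_gt0 e0 (ltr0n R 4)); exists (a ++ a').
  rewrite lincombD opprD addrACA.
  have := nsqD_le (y - lincomb b a) (z - lincomb b a'); lra.
have VZ c y : V y -> V (c *: y).
  move=> Vy e e0; have c1 : 0 < sqmod c + 1 by rewrite ltr_wpDl ?sqmod_ge0.
  have [a ha] := Vy _ (divr_gt0 e0 c1); exists [seq (c * p.1, p.2) | p <- a].
  rewrite lincombZ -scalerBr nsqZ; move: ha; rewrite ltr_pdivlMr// mulrC.
  by apply: le_lt_trans; rewrite ler_wpM2r ?nsq_ge0// lerDl.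
have Vcl u y : (forall n, V (u n)) -> hcvg u y -> V y.
  move=> Vu uy e e0; have e4 := divr_gt0 e0 (ltr0n R 4).
  have [N /(_ N (leqnn N))hN] := uy _ e4; have [a ha] := Vu N _ e4; exists a.
  have := nsq_sub_le y (u N) (lincomb b a); rewrite (nsq_subC y (u N)); lra.
have [y Vy hy] := hilbert_projC V0 VD VZ Vcl x.
suff -> : x = y by [].
apply/subr0_eq/tb => w; apply: hy => e e0; exists [:: (1, w)].
by rewrite /lincomb big_seq1 scale1r subrr nsq0.
Qed.

Lemma total_eq x y : total_family -> (forall w, dot x (b w) = dot y (b w)) -> x = y.
Proof. by move=> tb h; apply/subr0_eq/tb => w; rewrite dotBl h subrr. Qed.

End families.

Lemma dot_lincomb (W : Type) (f g : W -> H) a a' :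
  (forall s s', dot (f s) (f s') = dot (g s) (g s')) ->
  dot (lincomb f a) (lincomb f a') = dot (lincomb g a) (lincomb g a').
Proof.
move=> fg; rewrite /lincomb !dot_suml; apply: eq_bigr => p _.
rewrite !dot_sumr; apply: eq_bigr => q _.
by rewrite !dotZl !dotZr fg.
Qed.

Definition isometric A := forall x y, dot (A x) (A y) = dot x y.

Lemma isometric_nsq A x : isometric A -> nsq (A x) = nsq x.
Proof. by move=> iA; rewrite /sqnorm iA. Qed.

(** The squared norm of the linearity defect is a combination of inner products, so it has the same
    value as for the identity, namely 0. *)
Lemma isometric_linear A : isometric A -> linear A.
Proof.
move=> iA c x y; apply/subr0_eq/nsq_eq0.
rewrite /sqnorm !(dotBl, dotDl, dotZl, dotBr, dotDr, dotZr) !iA.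
rewrite !(dotDl, dotZl, dotDr, dotZr).
by rewrite [X in Re X](_ : _ = 0) //; ring.
Qed.

(** [T x] is the limit of the images of combinations chosen to approximate [x]; equality of the Gram
    matrices makes these images Cauchy. The choices made for different [x] are compatible because
    inner products pass to the limit. *)
Lemma isometry_extension (W : Type) (b f : W -> H) : total_family b ->
  (forall s s', dot (f s) (f s') = dot (b s) (b s')) ->
  exists2 T, isometric T & forall s, T (b s) = f s.
Proof.
move=> tb fb.
have subE (g : W -> H) a a' : lincomb g a - lincomb g a' =
    lincomb g (a ++ [seq (- 1 * p.1, p.2) | p <- a']).
  by rewrite lincombD lincombZ scaleN1r.
have nf a a' : nsq (lincomb f a - lincomb f a') = nsq (lincomb b a - lincomb b a').
  by rewrite !subE /sqnorm (dot_lincomb _ _ fb).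
pose e_ n : R := n.+1%:R^-1.
have e_gt0 n : 0 < e_ n by rewrite invr_gt0.
have small (e : R) : 0 < e -> exists N, forall n, (N <= n)%N -> e_ n < e.
  move=> e0; exists (Num.truncn e^-1) => n Nn.
  rewrite invf_plt ?posrE//; apply: lt_le_trans (truncnS_gt _) _.
  by rewrite ler_nat.
have ex x : exists y, exists a : nat -> seq (C * W),
    hcvg (fun n => lincomb b (a n)) x /\ hcvg (fun n => lincomb f (a n)) y.
  have [a ha] := choice (fun n => total_approx tb x (e_gt0 n)).
  have bx : hcvg (fun n => lincomb b (a n)) x.
    move=> e /small[N h]; exists N => n /h; rewrite nsq_subC.
    exact: lt_trans (ha n).
  have [y fy] : exists y, hcvg (fun n => lincomb f (a n)) y.
    apply: hcomplete => e e0; have [N h] := bx _ (divr_gt0 e0 (ltr0n R 4)).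
    exists N => m n /h hm /h hn; rewrite nf.
    have := nsq_sub_le (lincomb b (a m)) x (lincomb b (a n)).
    rewrite (nsq_subC x (lincomb b (a n))); lra.
  by exists y, a.
have [T hT] := choice ex.
have iT : isometric T.
  move=> x y; have [a [bx fx]] := hT x; have [a' [by' fy]] := hT y.
  by apply: (hcvg_dot_eq fx fy bx by') => n; exact: dot_lincomb.
exists T => // s; have [a [bx fx]] := hT (b s).
apply: hcvg_uniq fx _ => e /bx[N h]; exists N => n /h.
have := nf (a n) [:: (1, s)]; rewrite /lincomb !big_seq1 !scale1r.
by rewrite -/(lincomb _ _) => ->.
Qed.

(** The range of [A] is closed, and [B x] is the preimage of the projection of [x] onto it. *)
Lemma isometric_adjoint A : isometric A -> exists B, is_adjoint dot A B.
Proof.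
move=> iA; have lA := isometric_linear iA.
have AZ c y : A (c *: y) = c *: A y.
  have := lA c y 0; rewrite addr0 => ->.
  suff -> : A 0 = 0 by rewrite addr0.
  by apply: nsq_eq0; rewrite (isometric_nsq 0 iA) nsq0.
have AD y z : A (y + z) = A y + A z by have := lA 1 y z; rewrite !scale1r.
have AB y z : A (y - z) = A y - A z by rewrite AD -scaleN1r AZ scaleN1r.
pose V x := exists y, x = A y.
have ex x : exists z, forall y, dot (A y) (x - A z) = 0.
  have V0 : V 0 by exists 0; apply/esym/nsq_eq0; rewrite (isometric_nsq 0 iA) nsq0.
  have VD y z : V y -> V z -> V (y + z).
    by move=> [y' ->] [z' ->]; exists (y' + z'); rewrite AD.
  have VZ c y : V y -> V (c *: y) by move=> [y' ->]; exists (c *: y'); rewrite AZ.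
  have Vcl u y : (forall n, V (u n)) -> hcvg u y -> V y.
    move=> /choice[v uv] uy; have [z vz] : exists z, hcvg v z.
      apply: hcomplete => e e0; have [N h] := uy _ (divr_gt0 e0 (ltr0n R 4)).
      exists N => m n /h hm /h hn.
      rewrite -(isometric_nsq _ iA) AB -!uv.
      have := nsq_sub_le (u m) y (u n); rewrite (nsq_subC y (u n)); lra.
    exists z; apply: hcvg_uniq uy _ => e /vz[N h]; exists N => n /h.
    by rewrite uv -AB (isometric_nsq _ iA).
  have [_ [z ->] h] := hilbert_projC V0 VD VZ Vcl x.
  by exists z => y; rewrite dotC h ?rmorph0//; exists y.
have [B hB] := choice ex.
exists B => y x; rewrite -[in LHS](subrK (A (B x)) x) dotDr hB add0r.
exact: iA.
Qed.

Lemma adjoint_linear A B : is_adjoint dot A B -> linear A.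
Proof.
move=> AB c x y; apply: dot_inj => z.
by rewrite AB !dotDl !dotZl -!AB.
Qed.

Lemma adjoint_morphD A B x y : is_adjoint dot A B -> A (x + y) = A x + A y.
Proof. by move=> AB; have := adjoint_linear AB 1 x y; rewrite !scale1r. Qed.

Lemma adjoint_morph0 A B : is_adjoint dot A B -> A 0 = 0.
Proof. by move=> AB; apply: (@addrI _ (A 0)); rewrite -(adjoint_morphD _ _ AB) !addr0. Qed.

Lemma adjoint_morphN A B x : is_adjoint dot A B -> A (- x) = - A x.
Proof.
move=> AB; apply: (@addrI _ (A x)).
by rewrite -(adjoint_morphD _ _ AB) !subrr (adjoint_morph0 AB).
Qed.

Lemma adjoint_morphB A B x y : is_adjoint dot A B -> A (x - y) = A x - A y.
Proof. by move=> AB; rewrite (adjoint_morphD _ _ AB) (adjoint_morphN _ AB). Qed.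

Lemma adjoint_morphZ A B c x : is_adjoint dot A B -> A (c *: x) = c *: A x.
Proof. by move=> AB; have := adjoint_linear AB c x 0; rewrite (adjoint_morph0 AB) !addr0. Qed.

(** Passing to the adjoints and back brings the comparison onto the total family. Operator
    identities on the Fock space are reduced in this way to elementary tensors or words. *)
Lemma adjointable_eq (W : Type) (b : W -> H) A B A' B' : total_family b ->
  is_adjoint dot A A' -> is_adjoint dot B B' ->
  (forall w, A (b w) = B (b w)) -> forall x, A x = B x.
Proof.
move=> tb hA hB AB x; apply: dot_inj => y.
rewrite hA hB; congr (dot x _); apply: (total_eq tb) => w.
by rewrite dotC -hA AB hB -dotC.
Qed.

Lemma adjoint_sym A B : is_adjoint dot A B -> is_adjoint dot B A.
Proof. by move=> AB x y; rewrite dotC -AB -dotC. Qed.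

Lemma adjoint_comp A B A' B' : is_adjoint dot A A' -> is_adjoint dot B B' ->
  is_adjoint dot (A \o B) (B' \o A').
Proof. by move=> hA hB x y; rewrite /= hA hB. Qed.

Lemma adjointD A B A' B' : is_adjoint dot A A' -> is_adjoint dot B B' ->
  is_adjoint dot (A + B) (A' + B').
Proof.
move=> hA hB x y; change (dot (A x + B x) y = dot x (A' y + B' y)).
by rewrite dotDl dotDr hA hB.
Qed.

Lemma adjointZ c A A' : is_adjoint dot A A' ->
  is_adjoint dot (c *: A) (Num.conj c *: A').
Proof.
move=> hA x y; change (dot (c *: A x) y = dot x (Num.conj c *: A' y)).
by rewrite dotZl dotZr conjCK hA.
Qed.

Lemma bounded_opP A (M : R) : linear A -> (forall x, nsq (A x) <= M * nsq x) ->
  bounded_op A.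
Proof.
move=> lA hM; split=> // x; apply/(@cvgrPdist_lt _ _ _ (nbhs x)) => -[e e'].
rewrite ltcE /= => /andP[/eqP-> e0].
have M1 : 0 < `|M| + 1 by rewrite ltr_wpDl.
have d0 : 0 < Num.sqrt (e ^+ 2 / (`|M| + 1)) by rewrite sqrtr_gt0 divr_gt0 ?exprn_gt0.
have AB z : A x - A z = A (x - z).
  by rewrite [LHS]addrC -scaleN1r -lA scaleN1r addrC.
apply/nbhs_ballP; exists (Num.sqrt (e ^+ 2 / (`|M| + 1)))%:C%C => /=.
  by rewrite ltcR.
move=> z; rewrite -ball_normE /ball_ /= !norm_lt_nsq// sqr_sqrtr; last first.
  by rewrite divr_ge0 ?exprn_ge0 ?ltW.
rewrite AB ltr_pdivlMr// => lt; apply: le_lt_trans (hM _) _.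
apply: le_lt_trans lt; rewrite mulrC; apply: ler_wpM2l; first exact: nsq_ge0.
by rewrite (le_trans (ler_norm _))// lerDl.
Qed.

End Hilbert.

(** * Hilbert-Schmidt operators and pairs of projections *)

Local Notation "'\tsum_' i F" := (\esum_(i in setT) F)%E
  (at level 41, i at level 0, F at level 41).

(** * Sums of nonnegative reals over an arbitrary index set *)

Section NonnegativeSums.
Variables (R : realType).
Implicit Types (W V : choiceType).

Lemma esum_le_seq W (f : W -> R) (M : \bar R) :
  (forall r, uniq r -> ((\sum_(i <- r) f i)%:E <= M)%E) -> (\tsum_i (f i)%:E <= M)%E.
Proof.
move=> h; apply: ge_ereal_sup => _ [X [finX _] <-].
by rewrite fsbig_finite//= sumEFin h// fset_uniq.
Qed.

Lemma seq_le_esum W (f : W -> R) r : uniq r ->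
  ((\sum_(i <- r) f i)%:E <= \tsum_i (f i)%:E)%E.
Proof.
move=> ur; apply: esum_ge; exists [set` r]; first by split => //; exact: finite_seq.
by rewrite -fsbig_seq// sumEFin.
Qed.

Lemma esum_exchange W V (a : W -> V -> R) : (forall i j, 0 <= a i j) ->
  (\tsum_i \tsum_j (a i j)%:E = \tsum_j \tsum_i (a i j)%:E)%E.
Proof.
move=> a0; rewrite !esum_esum; try by move=> *; rewrite lee_fin.
rewrite (@reindex_esum _ _ _ (setT `*`` (fun=> setT)) _ (fun k => (k.2, k.1)))//.
split; [by []|by move=> [i j] [i' j'] _ _ [-> ->]|].
by move=> [i j] _; exists (j, i).
Qed.

Lemma eq_tsum W (f g : W -> R) : f =1 g -> (\tsum_i (f i)%:E = \tsum_i (g i)%:E)%E.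
Proof. by move=> fg; apply: eq_esum => i _; rewrite fg. Qed.

Lemma le_tsum W (f g : W -> R) : (forall i, f i <= g i) ->
  (\tsum_i (f i)%:E <= \tsum_i (g i)%:E)%E.
Proof. by move=> fg; apply: le_esum => i _; rewrite lee_fin. Qed.

Lemma tsumD W (f g : W -> R) : (forall i, 0 <= f i) -> (forall i, 0 <= g i) ->
  (\tsum_i (f i + g i)%:E = \tsum_i (f i)%:E + \tsum_i (g i)%:E)%E.
Proof.
by move=> f0 g0; rewrite -esumD; [|move=> i _; rewrite lee_fin..].
Qed.

Lemma tsum_ge0 W (f : W -> R) : (forall i, 0 <= f i) -> (0 <= \tsum_i (f i)%:E)%E.
Proof. by move=> f0; apply: esum_ge0 => i _; rewrite lee_fin. Qed.

Lemma tsumZ W (c : R) (f : W -> R) : 0 <= c -> (forall i, 0 <= f i) ->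
  (\tsum_i (c * f i)%:E = c%:E * \tsum_i (f i)%:E)%E.
Proof.
have le (d : R) (g : W -> R) : 0 <= d -> (forall i, 0 <= g i) ->
    (\tsum_i (d * g i)%:E <= d%:E * \tsum_i (g i)%:E)%E.
  move=> d0 g0; apply: esum_le_seq => r ur.
  by rewrite -mulr_sumr EFinM lee_wpmul2l ?lee_fin// seq_le_esum.
move=> c0 f0; apply/eqP; rewrite eq_le le//=.
have [->|cn0] := eqVneq c 0.
  by rewrite mul0e tsum_ge0// => i; rewrite mul0r.
have cp : 0 < c by rewrite lt_def cn0.
rewrite muleC -lee_pdivlMr//.
have := @le c^-1 (fun i => c * f i).
rewrite invr_ge0 => /(_ c0 (fun i => mulr_ge0 c0 (f0 i))).
rewrite muleC; congr (_ <= _)%E; apply: eq_tsum => i.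
by rewrite mulrA mulVf// mul1r.
Qed.

Lemma le_sum_subset W (f : W -> R) (r s : seq W) : (forall i, 0 <= f i) ->
  uniq r -> uniq s -> {subset r <= s} -> \sum_(i <- r) f i <= \sum_(i <- s) f i.
Proof.
move=> f0 ur us rs.
have pr : perm_eq [seq i <- s | i \in r] r.
  apply: uniq_perm => //; first exact: filter_uniq.
  by move=> i; rewrite mem_filter; case: (boolP (i \in r)) => //= /rs.
rewrite [leRHS](bigID (mem r)) /= -[X in _ <= X + _]big_filter (perm_big _ pr).
by rewrite lerDl sumr_ge0.
Qed.

Lemma lt_tsum W (f : W -> R) (M : \bar R) : (M < \tsum_i (f i)%:E)%E ->
  exists2 r, uniq r & (M < (\sum_(i <- r) f i)%:E)%E.
Proof.
move=> ltM; apply: contrapT => h; move: ltM; apply/negP; rewrite -leNgt.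
apply: esum_le_seq => r ur; rewrite leNgt; apply/negP => lt.
by apply: h; exists r.
Qed.

(** Dominated convergence: a finite set carries all but [e / 2] of the initial sum, and the finitely
    many terms on it tend to 0. *)
Lemma tsum_decreasing_cvg0 W (a : nat -> W -> R) :
  (forall k i, 0 <= a k i) -> (forall k i, a k.+1 i <= a k i) ->
  (forall i (e : R), 0 < e -> exists K, forall k, (K <= k)%N -> a k i < e) ->
  (\tsum_i (a 0%N i)%:E < +oo)%E ->
  forall e : R, 0 < e -> exists K, forall k, (K <= k)%N -> (\tsum_i (a k i)%:E <= e%:E)%E.
Proof.
move=> a0 amono acvg fin e e0; have e2 : 0 < e / 2 by rewrite divr_gt0.
have ale k i : a k i <= a 0%N i.
  by elim: k => // k; exact: le_trans.
have finS : (\tsum_i (a 0%N i)%:E)%E \is a fin_num.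
  by rewrite ge0_fin_numE// tsum_ge0.
set S := fine (\tsum_i (a 0%N i)%:E)%E.
have [|r ur rS] := @lt_tsum _ (a 0%N) (S - e / 2)%:E.
  by rewrite -[ltRHS](fineK finS) lte_fin ltrBlDr ltrDl.
have [K hK] : exists K, forall k, (K <= k)%N -> \sum_(i <- r) a k i < e / 2.
  have [n en] : exists n : nat, e / 2 / n.+1%:R * (size r)%:R < e / 2.
    by exists (size r); rewrite mulrAC ltr_pdivrMr// ltr_pM2l// ltr_nat.
  have d0 : 0 < e / 2 / n.+1%:R by rewrite divr_gt0.
  suff [K hK] : exists K, forall k, (K <= k)%N ->
      \sum_(i <- r) a k i <= e / 2 / n.+1%:R * (size r)%:R.
    by exists K => k /hK /le_lt_trans; apply.
  move: (e / 2 / _) d0 => d d0; elim: r {ur rS en} => [|i r' [K hK]].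
    by exists 0%N => k _; rewrite big_nil mulr0.
  have [K' hK'] := acvg i _ d0; exists (maxn K K') => k; rewrite geq_max => /andP[/hK h /hK' h'].
  by rewrite big_cons /= -natr1 mulrDr mulr1 addrC; apply: lerD => //; exact: ltW.
exists K => k /hK lt; apply: esum_le_seq => r' ur'; rewrite lee_fin.
pose t := [seq i <- r' | i \notin r].
have urt : uniq (r ++ t).
  rewrite cat_uniq ur filter_uniq// andbT /=; apply/hasPn => i.
  by rewrite mem_filter => /andP[].
have le1 : \sum_(i <- r') a k i <= \sum_(i <- r ++ t) a k i.
  apply: le_sum_subset => // i ir'; rewrite mem_cat mem_filter ir' andbT.
  by case: (i \in r).
have le2 : \sum_(i <- t) a k i <= \sum_(i <- t) a 0%N i by exact: ler_sum.
have le3 : \sum_(i <- r ++ t) a 0%N i <= S.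
  by rewrite -lee_fin /S (fineK finS); exact: seq_le_esum.
rewrite big_cat /= in le1; rewrite big_cat /= in le3.
apply: (le_trans le1); rewrite [leRHS]splitr; apply: lerD; first exact: ltW.
apply: (le_trans le2); rewrite -(lerD2l (\sum_(i <- r) a 0%N i)).
by apply: (le_trans le3); rewrite -lerBlDr -lee_fin ltW.
Qed.

End NonnegativeSums.

(** * Orthonormal bases and Hilbert-Schmidt norms *)

Section Orthonormal.
Variables (R : realType) (H : completeNormedModType R[i]).
Variable dot : {dot H for (@Num.conj R[i])}.
Hypothesis dotE : forall x, dot x x = `|x| ^+ 2.
Local Notation C := R[i].
Local Notation nsq := (sqnorm dot).
Local Notation adjoint := (is_adjoint dot).
Implicit Types (x y z : H) (A B : H -> H).

Section family.
Variables (W : choiceType) (e : W -> H).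
Hypothesis e_on : forall w v, dot (e w) (e v) = (w == v)%:R.

Definition fproj (r : seq W) x := \sum_(w <- r) dot x (e w) *: e w.

Lemma dot_fproj r x w : uniq r -> dot (fproj r x) (e w) = dot x (e w) *+ (w \in r).
Proof.
move=> ur; rewrite /fproj dot_suml; case: (boolP (w \in r)) => wr.
  rewrite (bigD1_seq w)//= dotZl e_on eqxx mulr1 big1 ?addr0// => v vw.
  by rewrite dotZl e_on (negPf vw) mulr0.
rewrite big_seq big1 // => v vr; rewrite dotZl e_on.
by case: eqP => [E|_]; [rewrite -E vr in wr|rewrite mulr0].
Qed.

Lemma nsq_fproj r x : uniq r -> nsq (fproj r x) = \sum_(w <- r) sqmod (dot x (e w)).
Proof.
move=> ur; rewrite /sqnorm {2}/fproj dot_sumr raddf_sum /= !big_seq.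
apply: eq_bigr => w wr; rewrite dotZr dot_fproj// wr mulr1n.
by rewrite mulrC mul_conj_sqmod.
Qed.

Lemma fproj_perp r x : uniq r -> dot (x - fproj r x) (fproj r x) = 0.
Proof.
move=> ur; rewrite {2}/fproj dot_sumr big_seq big1// => w wr.
by rewrite dotZr dotBl dot_fproj// wr mulr1n subrr mulr0.
Qed.

Lemma nsq_sub_fproj r x : uniq r ->
  nsq (x - fproj r x) = nsq x - \sum_(w <- r) sqmod (dot x (e w)).
Proof.
move=> ur; rewrite -nsq_fproj//; apply/esym/eqP; rewrite subr_eq; apply/eqP.
by have := nsqD dot (x - fproj r x) (fproj r x); rewrite subrK fproj_perp// mulr0 addr0.
Qed.

Lemma bessel r x : uniq r -> \sum_(w <- r) sqmod (dot x (e w)) <= nsq x.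
Proof. by move=> ur; rewrite -subr_ge0 -nsq_sub_fproj// nsq_ge0. Qed.

Lemma fproj_lincomb r (a : seq (C * W)) : uniq r ->
  {subset [seq p.2 | p <- a] <= r} -> fproj r (lincomb e a) = lincomb e a.
Proof.
move=> ur ar.
have fprojD y z : fproj r (y + z) = fproj r y + fproj r z.
  by rewrite /fproj -big_split; apply: eq_bigr => w _ /=; rewrite dotDl scalerDl.
have fprojZ c y : fproj r (c *: y) = c *: fproj r y.
  by rewrite /fproj scaler_sumr; apply: eq_bigr => w _; rewrite dotZl scalerA.
elim: a ar => [|p a IH] ar.
  by rewrite /lincomb big_nil /fproj big1// => w _; rewrite dot0l scale0r.
rewrite /lincomb big_cons -/(lincomb e a) fprojD IH; last first.
  by move=> w wa; apply: ar; rewrite inE wa orbT.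
congr (_ + _); rewrite fprojZ; congr (_ *: _).
rewrite /fproj (bigD1_seq p.2)//=; last by apply: ar; rewrite inE eqxx.
rewrite e_on eqxx scale1r big1 ?addr0// => w wp.
by rewrite e_on eq_sym (negPf wp) scale0r.
Qed.

Hypothesis e_total : total_family dot e.

(** Once [s] contains the indices of a good approximant, [x - fproj s x] is the part of the
    approximation error orthogonal to the span of [s], hence no longer than that error. *)
Lemma fproj_approx x (d : R) : 0 < d -> exists2 r, uniq r &
  forall s, uniq s -> {subset r <= s} -> nsq (x - fproj s x) < d.
Proof.
move=> d0; have [a ha] := total_approx dotE e_total x d0.
exists (undup [seq p.2 | p <- a]); first exact: undup_uniq.
move=> s us rs; apply: le_lt_trans ha.
have as_ : {subset [seq p.2 | p <- a] <= s}.
  by move=> w wa; apply: rs; rewrite mem_undup.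
have -> : x - fproj s x = (x - lincomb e a) - fproj s (x - lincomb e a).
  rewrite (_ : fproj s (x - _) = fproj s x - fproj s (lincomb e a)); last first.
    by rewrite /fproj -sumrB; apply: eq_bigr => w _; rewrite dotBl scalerBl.
  by rewrite fproj_lincomb// opprB addrA subrK.
rewrite nsq_sub_fproj// lerBlDr lerDl.
by apply: sumr_ge0 => w _; exact: sqmod_ge0.
Qed.

Lemma parseval x : (\tsum_w (sqmod (dot x (e w)))%:E = (nsq x)%:E)%E.
Proof.
apply/eqP; rewrite eq_le; apply/andP; split.
  by apply: esum_le_seq => r ur; rewrite lee_fin bessel.
apply/lee_addgt0Pr => d d0; have [r ur h] := fproj_approx x d0.
apply: le_trans (leeD2r _ (seq_le_esum _ ur)).
rewrite -EFinD lee_fin -lerBlDl -nsq_sub_fproj//.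
exact/ltW/h.
Qed.

Definition hs_normsq A : \bar R := (\tsum_w (nsq (A (e w)))%:E)%E.
Local Notation hs := hs_normsq.

Lemma hs_ge0 A : (0 <= hs A)%E.
Proof. by apply: tsum_ge0 => w; exact: nsq_ge0. Qed.

(** By Parseval both sides are the sum of the squared moduli of the matrix entries. *)
Lemma hs_adjoint A B : adjoint A B -> hs A = hs B.
Proof.
move=> AB; rewrite /hs_normsq.
under eq_esum do rewrite -parseval.
rewrite esum_exchange; last by move=> *; exact: sqmod_ge0.
apply: eq_esum => v _; rewrite -parseval; apply: eq_esum => w _.
by rewrite AB dotC sqmodJ.
Qed.

Lemma le_hs A B : (forall x, nsq (A x) <= nsq (B x)) -> (hs A <= hs B)%E.
Proof. by move=> AB; apply: le_tsum. Qed.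

Lemma eq_hs A B : (forall x, nsq (A x) = nsq (B x)) -> hs A = hs B.
Proof. by move=> AB; apply: eq_tsum. Qed.

Lemma hs_add A B D : (forall x, nsq (A x) = nsq (B x) + nsq (D x)) ->
  hs A = (hs B + hs D)%E.
Proof. by move=> AB; rewrite /hs_normsq -tsumD; [exact: eq_tsum|move=> w; exact: nsq_ge0..]. Qed.

Lemma hs_sub_fin A B D : (forall x, A x = B x - D x) ->
  (hs B < +oo)%E -> (hs D < +oo)%E -> (hs A < +oo)%E.
Proof.
move=> AE Bf Df.
have le : (hs A <= 2%:E * hs B + 2%:E * hs D)%E.
  rewrite /hs_normsq -!tsumZ -?tsumD; try by move=> *; rewrite ?mulr_ge0 ?nsq_ge0 ?ler0n.
  by apply: le_tsum => w; rewrite AE (le_trans (nsqD_le dotE _ _))// nsqN.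
apply: le_lt_trans le _; apply: lte_add_pinfty; exact: lte_mul_pinfty.
Qed.

End family.
End Orthonormal.

Lemma fin_num_addeI (R : realType) (x a b : \bar R) : x \is a fin_num ->
  (x + a = x + b)%E -> a = b.
Proof.
move=> xf /(congr1 (fun y => y - x)%E).
by rewrite ![(x + _)%E]addeC !addeK.
Qed.

(** * Powers of positive contractions and the index of a pair of projections *)

Section Index.
Variables (R : realType) (H : completeNormedModType R[i]).
Variable dot : {dot H for (@Num.conj R[i])}.
Hypothesis dotE : forall x, dot x x = `|x| ^+ 2.
Local Notation C := R[i].
Local Notation Re := (@complex.Re R).
Local Notation nsq := (sqnorm dot).
Local Notation adjoint := (is_adjoint dot).
Implicit Types (x y z : H) (A B : H -> H).
Variables (W : choiceType) (e : W -> H).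
Hypothesis e_on : forall w v, dot (e w) (e v) = (w == v)%:R.
Hypothesis e_total : total_family dot e.
Local Notation hs := (hs_normsq dot e).

Section power.
Variable T : H -> H.
Hypothesis T_sa : adjoint T T.
Hypothesis T_contr : forall x, nsq (T x) <= Re (dot (T x) x).

Let TD x y : T (x + y) = T x + T y.
Proof. exact: (adjoint_morphD dotE _ _ T_sa). Qed.
Let T0 : T 0 = 0.
Proof. exact: (adjoint_morph0 dotE T_sa). Qed.
Let TZ c x : T (c *: x) = c *: T x.
Proof. exact: (adjoint_morphZ dotE _ _ T_sa). Qed.
Let iterD k x y : iter k T (x + y) = iter k T x + iter k T y.
Proof. by elim: k => //= k ->. Qed.

Let dot_iter j k x y : dot (iter j T x) (iter k T y) = dot (iter (j + k) T x) y.
Proof.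
elim: k j => [|k IH] j; first by rewrite addn0.
by rewrite /= -T_sa -[T _]/(iter j.+1 T x) IH addSnnS.
Qed.

Let Re_dot_le x : Re (dot (T x) x) <= nsq x.
Proof. have := nsq_ge0 dotE (T x - x); rewrite nsqB; have := T_contr x; lra. Qed.

Lemma contraction_nsq x : nsq (T x) <= nsq x.
Proof. exact: le_trans (T_contr x) (Re_dot_le x). Qed.

Let c x k := Re (dot (iter k T x) x).

Let c_double x j : c x (j + j) = nsq (iter j T x).
Proof. by rewrite /c -dot_iter. Qed.

Let c_decr x k : c x k.+1 <= c x k.
Proof.
rewrite -(odd_double_half k) -addnn; set j := k./2; case: odd; rewrite ?add0n ?add1n.
  rewrite (_ : (j + j).+2 = j.+1 + j.+1)%N; last by rewrite addSn addnS.
  rewrite c_double /c -[(j + j).+1]addSn -dot_iter.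
  exact: T_contr.
by rewrite c_double -addSn /c -dot_iter; exact: Re_dot_le.
Qed.

Let c_ge0 x k : 0 <= c x k.
Proof.
apply: le_trans (_ : c x (k + k) <= _); first by rewrite c_double nsq_ge0.
by elim: {1}k => // j; apply: le_trans; rewrite addSn; exact: c_decr.
Qed.

(** [T_contr] says that [0 <= T <= 1], so the moments [c x k] decrease. The squared distance of two
    iterates is [c x (m + m) + c x (n + n) - 2 * c x (m + n)], so the iterates are Cauchy. *)
Lemma power_limit x : exists2 z, T z = z & hcvg dot (fun k => iter k T x) z.
Proof.
have cmono N k : (N <= k)%N -> c x k <= c x N.
  move=> /subnK <-; elim: (k - N)%N => // j; apply: le_trans; exact: c_decr.
pose L := inf (range (c x)).
have hL : has_inf (range (c x)).
  by split; [exists (c x 0%N); exists 0%N|exists 0 => _ [k _ <-]; exact: c_ge0].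
have Lle k : L <= c x k by apply: ge_inf; [exact: hL.2|exists k].
have [z xz] : exists z, hcvg dot (fun k => iter k T x) z.
  apply: (hcomplete dotE) => d d0.
  have [_ [N _ <-] lt] := inf_adherent (divr_gt0 d0 (ltr0n R 2)) hL.
  exists N => m n Nm Nn; rewrite nsqB -!c_double dot_iter.
  rewrite -[Re _]/(c x (m + n)).
  have h1 := cmono _ _ (leq_trans Nm (leq_addr m m)).
  have h2 := cmono _ _ (leq_trans Nn (leq_addr n n)).
  have h3 := Lle (m + n)%N; rewrite -/L in lt; lra.
exists z => //; apply: (@hcvg_uniq _ _ _ dotE (fun k => iter k.+1 T x)).
  apply: (@hcvg_bounded _ _ _ dotE T 1 (fun k => iter k T x)) => // y.
    by move=> y'; exact: (adjoint_morphB dotE _ _ T_sa).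
  by rewrite mul1r; exact: contraction_nsq.
move=> d d0; have [N h] := xz _ d0; exists N => n Nn.
by apply: h; rewrite (leq_trans Nn).
Qed.

Definition fixed_family n (x : 'I_n -> H) :=
  (forall i, T (x i) = x i) /\ forall i j, dot (x i) (x j) = (i == j)%:R.

Lemma tsum_nsq_fproj n (x : 'I_n -> H) : (forall i j, dot (x i) (x j) = (i == j)%:R) ->
  (\tsum_w (nsq (fproj dot x (index_enum _) (e w)))%:E = n%:R%:E)%E.
Proof.
move=> x_on.
under eq_esum do rewrite (nsq_fproj x_on _ (index_enum_uniq _)) -sumEFin.
rewrite esum_sum; last by move=> *; rewrite lee_fin sqmod_ge0.
rewrite (eq_bigr (fun=> 1%:E)); last first.
  move=> i _; under eq_esum do rewrite dotC sqmodJ.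
  by rewrite (parseval dotE e_on e_total) /sqnorm x_on eqxx.
by rewrite sumEFin sumr_const card_ord.
Qed.

(** With [P] the projection onto the span of the family, [n] is the sum of the [nsq (P (e w))]. As
    [T] is self-adjoint and fixes the family, [P (e w) = P (T (e w))], which is no longer than
    [T (e w)]. *)
Lemma fixed_family_le n (x : 'I_n -> H) : fixed_family x -> (n%:R%:E <= hs T)%E.
Proof.
move=> [Tx x_on]; rewrite -(tsum_nsq_fproj x_on); apply: le_tsum => w.
rewrite (nsq_fproj x_on _ (index_enum_uniq _)).
apply: le_trans (bessel dotE x_on (T (e w)) (index_enum_uniq _)).
by apply: ler_sum => i _; rewrite T_sa Tx.
Qed.

(** [hs T] bounds the size of such families, so a largest one exists; a nonzero fixed vector
    orthogonal to it could be normalized and appended. *)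
Lemma fixed_family_max : (hs T < +oo)%E -> exists n (x : 'I_n -> H),
  fixed_family x /\ forall z, T z = z -> (forall i, dot z (x i) = 0) -> z = 0.
Proof.
move=> hT; pose fam n := `[< exists x : 'I_n -> H, fixed_family x >].
have fam0 : exists n, fam n.
  exists 0%N; apply/asboolP; exists (fun=> 0).
  by split=> [[]|[]].
have hTfin : hs T \is a fin_num by rewrite ge0_fin_numE// hs_ge0.
have fam_le n : fam n -> (n <= Num.truncn (fine (hs T)))%N.
  move=> /asboolP[x fx]; rewrite truncn_ge_nat ?fine_ge0 ?hs_ge0//.
  by rewrite -lee_fin fineK// (fixed_family_le fx).
have [n /asboolP[x fx] nmax] := ex_maxnP fam0 fam_le.
exists n, x; split=> // z Tz zx; apply: contrapT => zn0.
have zp : 0 < nsq z.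
  by rewrite lt_def nsq_ge0// andbT; apply/eqP => /(nsq_eq0 dotE).
suff /nmax : fam n.+1 by rewrite ltnn.
pose s := ((Num.sqrt (nsq z))^-1)%:C%C : C.
apply/asboolP; exists (fun i => if unlift ord_max i is Some j then x j else s *: z).
have [Tx x_on] := fx; split=> [i|i j].
  by case: unliftP => [j _|_]; rewrite ?TZ ?Tx ?Tz.
case: unliftP => [i' ->|->]; case: unliftP => [j' ->|->].
- by rewrite x_on (inj_eq lift_inj).
- by rewrite dotZr dotC zx rmorph0 mulr0 eq_sym (negPf (neq_lift _ _)).
- by rewrite dotZl zx mulr0 (negPf (neq_lift _ _)).
- rewrite dotZl dotZr conj_real dot_nsq// mulrA -!rmorphM /= eqxx.
  by rewrite -invfM -expr2 sqr_sqrtr ?nsq_ge0// mulVf// gt_eqF.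
Qed.

(* The limit is the dimension of the eigenspace of [T] for the eigenvalue 1. *)
Lemma hs_power_cvg : (hs T < +oo)%E -> exists n : nat, forall d : R, 0 < d ->
  exists K, forall k, (K <= k)%N -> (n%:R%:E <= hs (iter k T) <= (n%:R + d)%:E)%E.
Proof.
move=> hT; have [n [x [[Tx x_on] xmax]]] := fixed_family_max hT.
exists n; pose P := fproj dot x (index_enum _).
have TP y k : iter k T (P y) = P y.
  elim: k => //= k ->; rewrite /P /fproj.
  rewrite (big_morph T TD T0); apply: eq_bigr => i _.
  by rewrite TZ Tx.
have Pperp y i : dot (y - P y) (x i) = 0.
  by rewrite dotBl (dot_fproj x_on)// ?index_enum_uniq// mem_index_enum mulr1n subrr.
have split_ k y : nsq (iter k T y) = nsq (P y) + nsq (iter k T (y - P y)).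
  have -> : iter k T y = iter k T (y - P y) + P y.
    by rewrite -{2}(TP y k) -iterD subrK.
  suff d0 : dot (iter k T (y - P y)) (P y) = 0.
    by rewrite nsqD d0 mulr0 addr0 addrC.
    have := dot_iter 0 k (y - P y) (P y); rewrite add0n TP => <-.
  exact: (fproj_perp x_on _ (index_enum_uniq _)).
have small y d : 0 < d -> exists K, forall k, (K <= k)%N -> nsq (iter k T (y - P y)) < d.
  move=> d0; have [z Tz yz] := power_limit (y - P y).
  have z0 : z = 0.
    apply: xmax => // i; apply: (hcvg_dot0 dotE yz) => k.
    have -> : dot (iter k T (y - P y)) (x i) = dot (y - P y) (iter k T (x i)).
      by rewrite (dot_iter 0 k) add0n.
    by rewrite (_ : iter k T (x i) = x i)//; elim: k => //= k ->.
  have [N h] := yz _ d0; exists N => k /h; by rewrite z0 subr0.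
(* The powers start at 1, since power 0 is the identity and may have infinite Hilbert-Schmidt
   norm. *)
pose a k w := nsq (iter k.+1 T (e w - P (e w))).
have a0 k w : 0 <= a k w by exact: nsq_ge0.
have adecr k w : a k.+1 w <= a k w by exact: contraction_nsq.
have acvg w d : 0 < d -> exists K, forall k, (K <= k)%N -> a k w < d.
  by move=> /(small (e w))[K h]; exists K => k Kk; apply: h; exact: leqW.
have afin : (\tsum_w (a 0%N w)%:E < +oo)%E.
  apply: le_lt_trans hT; apply: le_tsum => w.
  by have := split_ 1%N (e w) => /= ->; rewrite lerDr nsq_ge0.
move=> d d0; have [K hK] := tsum_decreasing_cvg0 a0 adecr acvg afin d0.
exists K.+1 => -[//|k] /hK h.
have -> : hs (iter k.+1 T) = (n%:R%:E + \tsum_w (a k w)%:E)%E.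
  rewrite -(tsum_nsq_fproj x_on) -tsumD; try by move=> w; rewrite ?nsq_ge0.
  by apply: eq_tsum => w; rewrite split_.
by rewrite leeDl ?tsum_ge0//= EFinD leeD2l.
Qed.

End power.

Lemma nsq_proj_le p x : adjoint p p -> (forall x, p (p x) = p x) -> nsq (p x) <= nsq x.
Proof.
move=> p_sa p_idem; have := nsq_ge0 dotE (x - p x).
have pE : nsq (p x) = Re (dot x (p x)) by rewrite /sqnorm p_sa p_idem.
rewrite nsqB -pE; lra.
Qed.

Section projection_pair.
Variables p q : H -> H.
Hypothesis (p_sa : adjoint p p) (q_sa : adjoint q q).
Hypothesis (p_idem : forall x, p (p x) = p x) (q_idem : forall x, q (q x) = q x).

Let pD x y : p (x + y) = p x + p y.
Proof. exact: (adjoint_morphD dotE _ _ p_sa). Qed.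
Let pN x : p (- x) = - p x.
Proof. exact: (adjoint_morphN dotE _ p_sa). Qed.
Let qD x y : q (x + y) = q x + q y.
Proof. exact: (adjoint_morphD dotE _ _ q_sa). Qed.
Let qN x : q (- x) = - q x.
Proof. exact: (adjoint_morphN dotE _ q_sa). Qed.
Let pqE := (pD, qD, pN, qN, p_idem, q_idem).

Definition projdiff x := p x - q x.
(** The companion of [D]: it satisfies [D D + B B = 1] and exchanges the two projections,
    [B p = q B] and [B q = p B]. *)
Definition projcodiff x := x - p x - q x.
Local Notation D := projdiff.
Local Notation B := projcodiff.

Ltac lmod_ring := apply: (dot_inj dotE) => ?; rewrite !(dotDl, dotNl); ring.

Let D_sa : adjoint D D.
Proof. by move=> x y; rewrite /D dotBl dotBr p_sa q_sa. Qed.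
Let B_sa : adjoint B B.
Proof. by move=> x y; rewrite /B !dotBl !dotBr p_sa q_sa. Qed.
Let BB x : B (B x) = x - D (D x).
Proof. by rewrite /B /D !pqE; lmod_ring. Qed.
Let Bp x : B (p x) = q (B x).
Proof. by rewrite /B !pqE; lmod_ring. Qed.
Let Bq x : B (q x) = p (B x).
Proof. by rewrite /B !pqE; lmod_ring. Qed.
Let DDp x : D (D (p x)) = p (D (D x)).
Proof. by rewrite /D !pqE; lmod_ring. Qed.
Let DDq x : D (D (q x)) = q (D (D x)).
Proof. by rewrite /D !pqE; lmod_ring. Qed.

Let nsq_split x : nsq x = nsq (D x) + nsq (B x).
Proof.
by rewrite /sqnorm !(D_sa, B_sa) -raddfD -dotDr BB /= addrC subrK.
Qed.

Lemma nsq_projdiff_le x : nsq (D x) <= nsq x.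
Proof. by rewrite [leRHS]nsq_split lerDl nsq_ge0. Qed.

Lemma nsq_projcodiff_le x : nsq (B x) <= nsq x.
Proof. by rewrite [leRHS]nsq_split lerDr nsq_ge0. Qed.

Section step.
Variable E : H -> H.
Hypothesis E_sa : adjoint E E.
Hypothesis ED : forall x, E (D x) = D (E x).
Hypothesis (EEp : forall x, E (E (p x)) = p (E (E x)))
  (EEq : forall x, E (E (q x)) = q (E (E x))).
Hypothesis E_hs : (hs E < +oo)%E.

Let EDd x y : E (x + y) = E x + E y.
Proof. exact: (adjoint_morphD dotE _ _ E_sa). Qed.
Let EN x : E (- x) = - E x.
Proof. exact: (adjoint_morphN dotE _ E_sa). Qed.

Let EBB x : E (B (B x)) = B (B (E x)).
Proof. by rewrite !BB EDd EN !ED. Qed.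
Let EEB x : E (E (B x)) = B (E (E x)).
Proof. by rewrite /B !(EDd, EN) EEp EEq. Qed.

(** Since [s] commutes with [E E] and with [B B], one of its two occurrences is absorbed, which
    leaves the cross term of a polarization. *)
Let nsq_BE s x : adjoint s s -> (forall x, s (s x) = s x) ->
  (forall x, B (B (s x)) = s (B (B x))) -> (forall x, E (E (s x)) = s (E (E x))) ->
  nsq (B (E (s x))) = Re (dot (E (B (B x))) (E (s x))).
Proof.
move=> s_sa s_idem BBs EEs.
by rewrite /sqnorm B_sa -EBB BBs E_sa EEs -s_sa s_idem -E_sa dotC FockModel.ReJ.
Qed.

(* Formally, [tr (E E B B p) = tr (E E B B q)] by cycling one factor [B] through
   [B p = q B]. Polarization reduces this to the
   invariance of Hilbert-Schmidt norms under adjoints, which needs no trace. *)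
Lemma hs_projcodiff : hs (fun x => B (E (p x))) = hs (fun x => B (E (q x))).
Proof.
have BBp x : B (B (p x)) = p (B (B x)) by rewrite Bp Bq.
have BBq x : B (B (q x)) = q (B (B x)) by rewrite Bq Bp.
pose P := hs (fun x => B (E (p x))); pose Q := hs (fun x => B (E (q x))).
pose X s := fun x => E (B (B x)) + s *: E (p x).
pose Y s := fun x => E (B x) + s *: E (p (B x)).
pose X' s := fun x => B (B (E x)) + s *: p (E x).
pose Y' s := fun x => B (E x) + s *: B (p (E x)).
have XX' (s : C) : s = 1 \/ s = -1 -> hs (X s) = hs (X' s).
  move=> s1; apply: hs_adjoint => // x y.
  rewrite /X /X' dotDl dotDr dotZl dotZr !(E_sa, B_sa, p_sa).
  by case: s1 => ->; rewrite ?rmorphN ?rmorph1.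
have YY' (s : C) : s = 1 \/ s = -1 -> hs (Y s) = hs (Y' s).
  move=> s1; apply: hs_adjoint => // x y.
  rewrite /Y /Y' dotDl dotDr dotZl dotZr !(E_sa, B_sa, p_sa).
  by case: s1 => ->; rewrite ?rmorphN ?rmorph1.
have polar x y : nsq (x + 1 *: y) = nsq (x + (-1) *: y) + 4 * Re (dot x y).
  by rewrite scale1r scaleN1r nsqB nsqD; ring.
have BE_fin : (hs (B \o E) < +oo)%E.
  by apply: le_lt_trans E_hs; apply: le_hs => x; exact: nsq_projcodiff_le.
have XE : hs (X 1%R) = (hs (X (-1)%R) + 4%:E * P)%E.
  rewrite /P /hs_normsq -tsumZ -?tsumD; try by move=> *; rewrite ?mulr_ge0 ?nsq_ge0 ?ler0n.
  by apply: eq_tsum => w; rewrite /X polar -nsq_BE.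
have YE : hs (Y 1%R) = (hs (Y (-1)%R) + 4%:E * Q)%E.
  rewrite /Q /hs_normsq -tsumZ -?tsumD; try by move=> *; rewrite ?mulr_ge0 ?nsq_ge0 ?ler0n.
  apply: eq_tsum => w; rewrite /Y polar nsq_BE// -Bq.
  by rewrite [in LHS]E_sa EEB -B_sa -E_sa.
(* After passing to adjoints the two polarizations have the same cross term on each basis vector,
   because [B] moves across the inner product. *)
have XYE : (hs (X 1%R) + hs (Y (-1)%R) = hs (X (-1)%R) + hs (Y 1%R))%E.
  rewrite !XX' ?YY'; try tauto.
  rewrite /hs_normsq -!tsumD; try by move=> *; rewrite ?nsq_ge0.
  apply: eq_tsum => w; rewrite /X' /Y' !polar.
  by rewrite B_sa; ring.
have Xfin : hs (X (-1)%R) \is a fin_num.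
  rewrite ge0_fin_numE ?hs_ge0// XX'; last by right.
  apply: (@hs_sub_fin _ _ _ dotE _ _ _ (fun x => B (B (E x))) (fun x => p (E x))).
  - by move=> x; rewrite /X' scaleN1r.
  - by apply: le_lt_trans BE_fin; apply: le_hs => x; exact: nsq_projcodiff_le.
  - by apply: le_lt_trans E_hs; apply: le_hs => x; exact: nsq_proj_le.
have Yfin : hs (Y (-1)%R) \is a fin_num.
  rewrite ge0_fin_numE ?hs_ge0// YY'; last by right.
  apply: (@hs_sub_fin _ _ _ dotE _ _ _ (fun x => B (E x)) (fun x => B (p (E x)))).
  - by move=> x; rewrite /Y' scaleN1r.
  - exact: BE_fin.
  - apply: le_lt_trans E_hs; apply: le_hs => x.
    by apply: le_trans (nsq_projcodiff_le _) _; exact: nsq_proj_le.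
have four : (4%:E : \bar R) \is a fin_num by [].
have /(congr1 (fun a => (4^-1)%:E * a)%E) : (4%:E * P = 4%:E * Q)%E.
  apply/(fin_num_addeI Xfin)/(fin_num_addeI Yfin).
  by rewrite addeC -XE XYE YE addeCA.
by rewrite !muleA -EFinM mulVf// !mul1e.
Qed.

(** [D D + B B = 1] splits each norm into a [D] part and a [B] part, and the [B] parts for [p] and
    [q] agree. Replacing [E] by [D E] therefore preserves the difference between the norms for [p]
    and for [q]. *)
Lemma hs_step : (hs (fun x => E (p x)) + hs (fun x => D (E (q x))) =
  hs (fun x => E (q x)) + hs (fun x => D (E (p x))))%E.
Proof.
have split_ s : hs (fun x => E (s x)) =
    (hs (fun x => D (E (s x))) + hs (fun x => B (E (s x))))%E.
  by apply: hs_add => // x; exact: nsq_split.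
by rewrite !split_ hs_projcodiff [LHS]addeC [RHS]addeAC addeA.
Qed.

End step.

Hypothesis D_hs : (hs D < +oo)%E.

Let iter_comm k x : iter k D (D x) = D (iter k D x). Proof. by rewrite -iterSr. Qed.

Let iter_sa k : adjoint (iter k D) (iter k D).
Proof. by elim: k => [//|k IH] x y; rewrite iterSr IH D_sa -iterS. Qed.

Let iter_double k x : iter k D (iter k D x) = iter (k + k) D x.
Proof. by rewrite iterD. Qed.

Let iter_p k x : iter (k + k) D (p x) = p (iter (k + k) D x).
Proof. by elim: k x => // k IH x; rewrite addSn addnS /= IH DDp. Qed.

Let iter_q k x : iter (k + k) D (q x) = q (iter (k + k) D x).
Proof. by elim: k x => // k IH x; rewrite addSn addnS /= IH DDq. Qed.

Let iter_hs k : (hs (iter k.+1 D) < +oo)%E.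
Proof.
elim: k => // k; apply: le_lt_trans; apply: le_hs => x.
exact: nsq_projdiff_le.
Qed.

Let hs_comp_fin k s : adjoint s s -> (forall x, s (s x) = s x) ->
  (hs (fun x => iter k.+1 D (s x)) < +oo)%E.
Proof.
move=> s_sa s_idem; apply: le_lt_trans (iter_hs k).
rewrite (@hs_adjoint _ _ _ dotE _ _ e_on e_total _ (fun x => s (iter k.+1 D x))).
  by apply: le_hs => x; exact: nsq_proj_le.
by move=> x y; rewrite iter_sa s_sa.
Qed.

(** Telescopes [hs_step] over the powers [E] of [D], whose squares are even powers of [D] and so
    commute with [p] and [q]. *)
Lemma hs_iter_diff k : (hs (fun x => D (p x)) + hs (fun x => iter k.+1 D (q x)) =
  hs (fun x => D (q x)) + hs (fun x => iter k.+1 D (p x)))%E.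
Proof.
elim: k => [|k IH]; first by rewrite addeC.
have phi_fin : hs (fun x => iter k.+1 D (p x)) \is a fin_num.
  by rewrite ge0_fin_numE ?hs_ge0// hs_comp_fin.
have EEs s x : (forall k x, iter (k + k) D (s x) = s (iter (k + k) D x)) ->
    iter k.+1 D (iter k.+1 D (s x)) = s (iter k.+1 D (iter k.+1 D x)).
  by move=> h; rewrite !iter_double.
have := @hs_step _ (iter_sa k.+1) (iter_comm k.+1) (fun x => EEs p x iter_p)
  (fun x => EEs q x iter_q) (iter_hs k).
move=> /= step; apply: (fin_num_addeI phi_fin) => /=.
by rewrite addeCA step addeA IH /= -!addeA addeCA.
Qed.

(** For [s] equal to [p] or [q], [T = D D s] is a positive contraction whose positive powers are
    [D ^ (2 k) s], so the Hilbert-Schmidt norms of these tend to an integer; [hs_iter_diff] relates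
    the two limits to the norms of [D p] and [D q]. *)
Lemma index_integral : exists n m : nat,
  (hs (fun x => D (p x)) + m%:R%:E = hs (fun x => D (q x)) + n%:R%:E)%E.
Proof.
have key s : adjoint s s -> (forall x, s (s x) = s x) ->
    (forall k x, iter (k + k) D (s x) = s (iter (k + k) D x)) ->
    exists n : nat, forall d : R, 0 < d -> exists K, forall k, (K <= k)%N ->
      (n%:R%:E <= hs (fun x => iter (k + k) D (s x)) <= (n%:R + d)%:E)%E.
  move=> s_sa s_idem iter_s.
  have DDs x : D (D (s x)) = s (D (D x)) by exact: (iter_s 1%N).
  pose T x := D (D (s x)).
  have T_sa : adjoint T T by move=> x y; rewrite /T !D_sa s_sa -!DDs.
  have TE x : Re (dot (T x) x) = nsq (D (s x)).
    by rewrite /sqnorm -D_sa -s_sa -DDs s_idem.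
  have T_contr x : nsq (T x) <= Re (dot (T x) x) by rewrite TE nsq_projdiff_le.
  have T_hs : (hs T < +oo)%E.
    apply: le_lt_trans (hs_comp_fin 0%N s_sa s_idem); apply: le_hs => x.
    exact: nsq_projdiff_le.
  have [n h] := hs_power_cvg T_sa T_contr T_hs.
  exists n => d d0; have [K hK] := h d d0; exists K.+1 => -[//|k] Kk.
  have := hK k.+1 (leqW Kk); 
  rewrite (@eq_hs _ _ _ _ _ (iter k.+1 T) (fun x => iter (k.+1 + k.+1) D (s x)))//.
  move=> x; congr nsq; elim: k {Kk} => [|k IH]; first by [].
  by rewrite iterS IH /T -iter_s s_idem addSn [in RHS]addnS.
have [n hn] := key p p_sa p_idem iter_p; have [m hm] := key q q_sa q_idem iter_q.
exists n, m.
have Dfin s : adjoint s s -> (forall x, s (s x) = s x) -> hs (fun x => D (s x)) \is a fin_num.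
  by move=> s_sa s_idem; rewrite ge0_fin_numE ?hs_ge0// (hs_comp_fin 0%N s_sa s_idem).
have [af bf] := (Dfin p p_sa p_idem, Dfin q q_sa q_idem).
rewrite -(fineK af) -(fineK bf) -!EFinD; congr EFin.
set a := fine _; set b := fine _.
apply/eqP; rewrite -subr_eq0 -normr_le0; apply: le0_eps => d d0.
have [K1 h1] := hn d d0; have [K2 h2] := hm d d0.
(* [k] is kept positive so that [k + k] is a successor, the form of the exponent in
   [hs_iter_diff]. *)
pose k := maxn (maxn K1 K2) 1.
have := h1 k; have := h2 k; have := hs_iter_diff (k + k).-1.
rewrite prednK; last by rewrite addn_gt0 leq_max orbT.
rewrite -(fineK af) -(fineK bf) -/a -/b !leq_max !leqnn !orbT => E0.
move=> /(_ isT) /andP[m1 m2] /(_ isT) /andP[n1 n2]; move: E0 m1 m2 n1 n2.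
case: (hs _) => [u||]; case: (hs _) => [v||] //.
rewrite -!EFinD !lee_fin => -[E1] m1 m2 n1 n2.
by rewrite ler_norml; apply/andP; split; lra.
Qed.

End projection_pair.
End Index.

(** * A Bessel inequality weighted by a positive kernel *)

Section Schur.
Variables (R : realType) (H : completeNormedModType R[i]).
Variable dot : {dot H for (@Num.conj R[i])}.
Hypothesis dotE : forall x, dot x x = `|x| ^+ 2.
Local Notation C := R[i].
Local Notation Re := (@complex.Re R).
Local Notation nsq := (sqnorm dot).
Variables (W : choiceType) (e : W -> H).
Hypothesis e_on : forall w v, dot (e w) (e v) = (w == v)%:R.
Hypothesis e_total : total_family dot e.
Variable T : finType.
Implicit Types (G : T -> T -> C) (g : T -> H).

Definition psd G := forall z : T -> C,
  0 <= Re (\sum_j \sum_l z j * Num.conj (z l) * G j l).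

Lemma psd_gram g : psd (fun j l => dot (g j) (g l)).
Proof.
move=> z; apply: le_trans (nsq_ge0 dotE (\sum_j z j *: g j)) _.
rewrite le_eqVlt; apply/orP; left; apply/eqP; congr Re.
rewrite dot_suml; apply: eq_bigr => j _; rewrite dot_sumr; apply: eq_bigr => l _.
by rewrite dotZl dotZr mulrA.
Qed.

Lemma psd_trans G : psd G -> psd (fun j l => G l j).
Proof.
move=> hG z; have := hG (fun j => Num.conj (z j)).
rewrite exchange_big; congr (0 <= Re _); apply: eq_bigr => j _; apply: eq_bigr => l _.
by rewrite conjCK; congr (_ * _); rewrite mulrC.
Qed.

Lemma psd_scale G (b : T -> C) : psd G -> psd (fun j l => b j * Num.conj (b l) * G j l).
Proof.
move=> hG z; have := hG (fun j => z j * b j); congr (0 <= Re _).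
by apply: eq_bigr => j _; apply: eq_bigr => l _; rewrite rmorphM /=; ring.
Qed.

(* The remainder of Bessel's inequality is a quadratic form in the vectors
   [g j - fproj s (g j)], so it is enough that these tend to 0. *)
Lemma schur_bessel G g (r : seq W) : psd G -> uniq r ->
  \sum_(w <- r) Re (\sum_j \sum_l dot (g j) (e w) * Num.conj (dot (g l) (e w)) * G j l)
  <= Re (\sum_j \sum_l dot (g j) (g l) * G j l).
Proof.
move=> hG ur; rewrite -subr_ge0 -oppr_le0; apply: le0_eps => d d0.
(* The real part of [dot (D j) (D l) * G j l] is at least [- (nsq (D j) + sqmod (G j l) * nsq (D
   l))]. If every [nsq (D j)] is at most [d / (K + 1)], these bounds add up to at least [- d]. *)
pose K := \sum_j \sum_(l : T) (1 + sqmod (G j l)).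
have K0 : 0 <= K by apply: sumr_ge0 => j _; apply: sumr_ge0 => l _; rewrite addr_ge0 ?sqmod_ge0.
have K1 : 0 < K + 1 by rewrite ltr_wpDl.
have dK : 0 < d / (K + 1) by rewrite divr_gt0.
have ex j : exists t, uniq t /\ forall s, uniq s -> {subset t <= s} ->
    nsq (g j - fproj dot e s (g j)) < d / (K + 1).
  by have [t] := fproj_approx dotE e_on e_total (g j) dK; exists t.
have [t ht] := choice ex.
pose s := undup (r ++ flatten [seq t j | j <- enum T]).
have us : uniq s by exact: undup_uniq.
have rs : {subset r <= s} by move=> w wr; rewrite mem_undup mem_cat wr.
have ts j : {subset t j <= s}.
  move=> w wt; rewrite mem_undup mem_cat; apply/orP; right.
  by apply/flattenP; exists (t j) => //; apply/mapP; exists j; rewrite ?mem_enum.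
pose D j := g j - fproj dot e s (g j).
have hD j : nsq (D j) <= d / (K + 1) by apply/ltW/(ht j).2.
pose f w := Re (\sum_j \sum_l dot (g j) (e w) * Num.conj (dot (g l) (e w)) * G j l).
have f0 w : 0 <= f w by exact: hG.
have dotgg j l : dot (g j) (g l) =
    \sum_(w <- s) dot (g j) (e w) * Num.conj (dot (g l) (e w)) + dot (D j) (D l).
  have De w : w \in s -> dot (D j) (e w) = 0.
    by move=> ws; rewrite /D dotBl dot_fproj// ws mulr1n subrr.
  have -> : dot (D j) (D l) = dot (D j) (g l).
    rewrite {2}/D dotBr dot_sumr big_seq big1 ?subr0// => w ws.
    by rewrite dotZr De ?mulr0.
  rewrite dotBl dot_suml addrC -[LHS](subrK (\sum_(w <- s) dot (dot (g j) (e w) *: e w) (g l))).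
  by congr (_ + _); apply: eq_bigr => w _; rewrite dotZl -dotC.
have totE : Re (\sum_j \sum_l dot (g j) (g l) * G j l) =
    \sum_(w <- s) f w + Re (\sum_j \sum_l dot (D j) (D l) * G j l).
  rewrite /f -raddf_sum -FockModel.ReD; congr Re.
  rewrite [X in _ = X + _]exchange_big -big_split; apply: eq_bigr => j _ /=.
  rewrite [X in _ = X + _]exchange_big -big_split; apply: eq_bigr => l _ /=.
  by rewrite dotgg mulrDl mulr_suml.
have lowD : - d <= Re (\sum_j \sum_l dot (D j) (D l) * G j l).
  apply: le_trans (_ : - (K * (d / (K + 1))) <= _).
    rewrite lerN2 mulrA ler_pdivrMr// mulrC ler_pM2l// lerDl//.
  rewrite /K mulr_suml -sumrN raddf_sum; apply: ler_sum => j _ /=.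
  rewrite mulr_suml -sumrN raddf_sum; apply: ler_sum => l _ /=.
  have -> : dot (D j) (D l) * G j l = dot (D j) (Num.conj (G j l) *: D l).
    by rewrite dotZr conjCK mulrC.
  have := nsq_ge0 dotE (D j + Num.conj (G j l) *: D l).
  rewrite nsqD nsqZ sqmodJ; rewrite [(1 + _) * _]mulrDl mul1r.
  have := hD j; have := ler_wpM2l (sqmod_ge0 (G j l)) (hD l).
  have := nsq_ge0 dotE (D j); have := mulr_ge0 (sqmod_ge0 (G j l)) (nsq_ge0 dotE (D l)).
  move: (d / _) (nsq (D j)) (sqmod _ * nsq _) (Re _) => a1 a2 a3 a4.
  lra.
rewrite totE -/f; have := le_sum_subset f0 ur us rs; lra.
Qed.

End Schur.

(** * Right creation operators *)

Section L2Parts.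
Variable R : realType.
Local Notation C := R[i].
Local Notation Re := (@complex.Re R).
Local Notation Im := (@complex.Im R).
Implicit Types h k : l2 R.

Definition l2_real k := forall t, Im (k t) = 0.

Lemma l2_dot_Im0 h k : l2_real h -> l2_real k -> Im (l2_dot h k) = 0.
Proof.
move=> hr kr; rewrite /l2_dot /= (_ : (fun t => _) = cst 0); last first.
  apply/funext => t; rewrite FockModel.ImM FockModel.ReJ FockModel.ImJ hr kr.
  by rewrite oppr0 mulr0 mul0r addr0.
by rewrite Rintegral_cst ?mul0r//; exact: half_line_measurable.
Qed.

(** The decomposition into real and imaginary parts. As [l2] carries no vector space structure, it
    is expressed through inner products. *)
Lemma l2_split h : exists h1 h2, [/\ l2_real h1, l2_real h2 &
  forall g, l2_dot h g = l2_dot h1 g + 'i%C * l2_dot h2 g].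
Proof.
have part (f : R -> R) : measurable_fun (@half_line R) f ->
    (forall t, f t ^+ 2 <= Re (h t) ^+ 2 + Im (h t) ^+ 2) ->
    exists g : l2 R, forall t, g t = (f t)%:C%C.
  move=> mf fle.
  have fin : (\int[lebesgue_measure]_(t in @half_line R)
     (complex.Re (f t)%:C%C ^+ 2 + complex.Im (f t)%:C%C ^+ 2)%:E < +oo)%E.
    apply: le_lt_trans (l2_fin h); apply: ge0_le_integral => //=.
    - exact: half_line_measurable.
    - by move=> t _; rewrite lee_fin addr_ge0 ?sqr_ge0.
    - by apply/measurable_EFinP; apply: measurable_funD; apply: measurable_funX.
    - apply/measurable_EFinP; apply: measurable_funD; apply: measurable_funX;
        [exact: l2_mRe|exact: l2_mIm].
    - by move=> t _; rewrite lee_fin expr0n addr0.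
  have m0 : measurable_fun (@half_line R) (fun t => complex.Im (f t)%:C%C) by [].
  by exists (@L2 _ (fun t => (f t)%:C%C) mf m0 fin).
have [h1 h1E] := part _ (l2_mRe h) (fun t => ltac:(by rewrite lerDl sqr_ge0)).
have [h2 h2E] := part _ (l2_mIm h) (fun t => ltac:(by rewrite lerDr sqr_ge0)).
exists h1, h2; split=> [t|t|g]; rewrite ?h1E ?h2E//.
rewrite !FockModel.l2_dotE -FockModel.cintZ; last exact: FockModel.l2_cintegrable.
rewrite -FockModel.cintD; [|exact: FockModel.l2_cintegrable|].
  2: exact/FockModel.cintegrableZ/FockModel.l2_cintegrable.
apply: FockModel.eq_cint => t; rewrite h1E h2E mulrA -mulrDl; congr (_ * _).
exact: complexE.
Qed.

End L2Parts.

(** * Left and right creation operators on the Fock space *)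

Section Fock.
Variables (R : realType) (F : full_fock R).
Local Notation C := R[i].
Local Notation Im := (@complex.Im R).
Local Notation dot := (@fdot R F).
Local Notation dotE := (@fdotE R F).
Local Notation nsq := (sqnorm dot).
Local Notation adjoint := (is_adjoint dot).
Local Notation tens := (@tens R F).
Local Notation create := (@create R F).
Local Notation Om := (vacuum F).
Implicit Types (x y z : F) (A B : F -> F) (h k : l2 R) (s : seq (l2 R)).

Lemma adjP A : (exists B, adjoint A B) -> adjoint A (adj A).
Proof. by move=> [B hB]; have := @xgetPex _ 0 [set B | adjoint A B] ltac:(by exists B). Qed.

Lemma tens_totalP : total_family dot tens.
Proof.
move=> x hx; apply: (nsq_eq0 dotE); apply/eqP; rewrite eq_le (nsq_ge0 dotE) andbT.
apply: le0_eps => e e0.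
have se0 : 0 < Num.sqrt e by rewrite sqrtr_gt0.
have seC : 0 < (Num.sqrt e)%:C%C :> C by rewrite ltcR.
have [n [c [s hs]]] := tens_total x seC.
move: hs; set y := \sum_(i < n) _; rewrite (norm_lt_nsq dotE)// (sqr_sqrtr (ltW e0)) => lt.
have xy : dot x y = 0.
  by rewrite /y dot_sumr big1// => i _; rewrite dotZr hx mulr0.
apply/ltW; apply: le_lt_trans lt.
by rewrite nsqB xy mulr0 subr0 lerDl (nsq_ge0 dotE).
Qed.

Local Notation cre_adj h := (adj (create h)).

Lemma create_adjoint h : adjoint (create h) (cre_adj h).
Proof. exact/adjP/create_adj. Qed.

Lemma cre_adj_adjoint h : adjoint (cre_adj h) (create h).
Proof. exact/adjoint_sym/create_adjoint. Qed.

Lemma cre_adj_tens h k s : cre_adj h (tens (k :: s)) = l2_dot k h *: tens s.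
Proof.
apply: (total_eq (@tens_totalP)) => s'.
by rewrite cre_adj_adjoint create_tens dotZl !fdot_tens.
Qed.

Lemma cre_adj_vacuum h : cre_adj h Om = 0.
Proof.
apply: (total_eq (@tens_totalP)) => s.
by rewrite cre_adj_adjoint create_tens fdot_tens dot0l.
Qed.

Lemma cre_adj_create h k x : cre_adj h (create k x) = l2_dot k h *: x.
Proof.
move: x; apply: (adjointable_eq dotE (@tens_totalP)).
- exact: adjoint_comp (cre_adj_adjoint h) (create_adjoint k).
- move=> x y; rewrite dotZl; apply/esym; rewrite -[l2_dot k h]conjCK -dotZr; reflexivity.
- by move=> s; rewrite /= create_tens cre_adj_tens.
Qed.

Definition create_word s x := foldr create x s.

Lemma create_word_tens s s' : create_word s (tens s') = tens (s ++ s').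
Proof. by elim: s => //= h s ->; rewrite create_tens. Qed.

Lemma tens_dot1 h k : tens_dot [:: h] [:: k] = l2_dot h k.
Proof. exact: mulr1. Qed.

(* The closed real span of the real-valued one-particle vectors, as a double
   complement for the symplectic form [Im dot]. *)
Definition real_particle (xi : F) := forall eta,
  (forall k, l2_real k -> Im (dot (tens [:: k]) eta) = 0) -> Im (dot xi eta) = 0.

Lemma real_particle_tens k : l2_real k -> real_particle (tens [:: k]).
Proof. by move=> kr eta; apply. Qed.

Lemma real_particle_dot_tens xi k : real_particle xi -> l2_real k ->
  Im (dot xi (tens [:: k])) = 0.
Proof.
move=> rxi kr; apply: rxi => k' kr'; rewrite fdot_tens tens_dot1.
exact: l2_dot_Im0.
Qed.

Lemma real_particle_dot xi xi' : real_particle xi -> real_particle xi' ->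
  Im (dot xi xi') = 0.
Proof.
move=> rxi rxi'; apply: rxi => k kr.
by rewrite dotC FockModel.ImJ (real_particle_dot_tens rxi' kr) oppr0.
Qed.

(** Every complex multiple of such a [tens s] is orthogonal to the one-particle vectors, so it may
    serve as [eta] in [real_particle]; the multiple by ['i] gives the real part. *)
Lemma real_particle_perp xi s : real_particle xi -> size s != 1 -> dot xi (tens s) = 0.
Proof.
move=> rxi s1; have h c : Im (dot xi (c *: tens s)) = 0.
  apply: rxi => k kr; rewrite dotZr fdot_tens.
  by case: s s1 => [|h [|h' s]] //= _; rewrite !mulr0.
apply: FockModel.ReIm_eq; last by have := h 1; rewrite scale1r.
have := h 'i%C; rewrite dotZr FockModel.ImM /=; lra.
Qed.

Lemma real_particle0 : real_particle 0.
Proof. by move=> eta _; rewrite dot0l. Qed.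

Lemma real_particleD xi xi' : real_particle xi -> real_particle xi' ->
  real_particle (xi + xi').
Proof. by move=> h h' eta he; rewrite dotDl FockModel.ImD h ?h' ?addr0. Qed.

Lemma real_particleZ (a : R) xi : real_particle xi -> real_particle (a%:C%C *: xi).
Proof.
by move=> h eta he; rewrite dotZl FockModel.ImM h//= mulr0 mul0r addr0.
Qed.

Lemma real_particle_lim u xi : (forall n, real_particle (u n)) -> hcvg dot u xi ->
  real_particle xi.
Proof.
by move=> hu uxi eta he; apply: (hcvg_Im0 dotE uxi) => n; exact: hu.
Qed.

Lemma cre_adj_particle xi h : real_particle xi ->
  cre_adj h xi = dot xi (tens [:: h]) *: Om.
Proof.
move=> rxi; apply: (total_eq (@tens_totalP)) => s.
rewrite cre_adj_adjoint create_tens dotZl fdot_tens.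
by case: s => [|h' s] /=; rewrite ?mulr1// mulr0 real_particle_perp.
Qed.

(** For [xi = xi'] a unit vector this is the Gram matrix of the elementary tensors, so appending
    [xi] on the right extends to an isometry. *)
Lemma dot_create_word xi xi' s s' : real_particle xi -> real_particle xi' ->
  dot (create_word s xi) (create_word s' xi') = tens_dot s s' * dot xi xi'.
Proof.
move=> rxi rxi'.
have perp z h t : real_particle z -> dot z (create h (create_word t xi)) = 0 /\
    dot z (create h (create_word t xi')) = 0.
  move=> rz; rewrite -!cre_adj_adjoint !cre_adj_particle// !dotZl.
  have vac y : real_particle y -> dot Om (create_word t y) = 0.
    move=> ry; case: t => [|h' t] /=.
      by rewrite dotC real_particle_perp ?rmorph0.
    by rewrite -cre_adj_adjoint cre_adj_vacuum dot0l.
  by rewrite !vac// mulr0.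
elim: s s' => [|h s IH] [|h' s'] /=; rewrite ?mul1r ?mul0r//.
- by have [] := perp _ h' s' rxi.
- by rewrite dotC (perp _ h s rxi').1 rmorph0.
- by rewrite -cre_adj_adjoint cre_adj_create dotZl IH mulrA.
Qed.

(* Meaningful only for a unit vector [xi] with [real_particle xi]; the default
   value [idfun] is reached otherwise. *)
Definition right_create (xi : F) : F -> F := xget (idfun : F -> F)
  [set T | isometric dot T /\ forall s, T (tens s) = create_word s xi].

Section right_creation.
Variable xi : F.
Hypothesis rxi : real_particle xi.
Hypothesis xi1 : nsq xi = 1.
Local Notation r := (right_create xi).
Local Notation r_adj := (adj r).

Let right_createP : isometric dot r /\ forall s, r (tens s) = create_word s xi.
Proof.
suff [T iT hT] : exists2 T, isometric dot T & forall s, T (tens s) = create_word s xi.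
  by have := @xgetPex _ (idfun : F -> F) [set T | isometric dot T /\
       forall s, T (tens s) = create_word s xi] ltac:(by exists T).
apply: (isometry_extension dotE (@tens_totalP)) => s s'.
by rewrite dot_create_word// dot_nsq xi1 mulr1 fdot_tens.
Qed.

Lemma right_create_isometric : isometric dot r. Proof. exact: right_createP.1. Qed.

Lemma right_create_tens s : r (tens s) = create_word s xi.
Proof. exact: right_createP.2. Qed.

Lemma right_create_vacuum : r Om = xi.
Proof. exact: right_create_tens. Qed.

Lemma right_create_adjoint : adjoint r r_adj.
Proof. exact/adjP/(isometric_adjoint dotE)/right_create_isometric. Qed.

Lemma right_adj_adjoint : adjoint r_adj r.
Proof. exact/adjoint_sym/right_create_adjoint. Qed.

Lemma right_create_create h x : r (create h x) = create h (r x).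
Proof.
move: x; apply: (adjointable_eq dotE (@tens_totalP)).
- exact: adjoint_comp right_create_adjoint (create_adjoint h).
- exact: adjoint_comp (create_adjoint h) right_create_adjoint.
- by move=> s; rewrite /= create_tens !right_create_tens.
Qed.

Lemma right_adj_cre_adj h x : r_adj (cre_adj h x) = cre_adj h (r_adj x).
Proof.
apply: (dot_inj dotE) => y.
by rewrite right_adj_adjoint !cre_adj_adjoint -right_create_create -right_adj_adjoint.
Qed.

Lemma right_adj_vacuum : r_adj Om = 0.
Proof.
apply: (total_eq (@tens_totalP)) => s.
rewrite right_adj_adjoint right_create_tens dot0l; case: s => [|h s] /=.
  by rewrite dotC real_particle_perp ?rmorph0.
by rewrite -cre_adj_adjoint cre_adj_vacuum dot0l.
Qed.

Definition vacuum_rank1 (c : C) x : F := (c * dot x Om) *: Om.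

Lemma vacuum_rank1_adjoint c : adjoint (vacuum_rank1 c) (vacuum_rank1 (Num.conj c)).
Proof.
move=> x y; rewrite /vacuum_rank1 dotZl dotZr rmorphM /= conjCK.
by rewrite -(dotC dot Om y); ring.
Qed.

(** Removing a letter on the left commutes with adding one on the right, except on the vacuum, where
    the letter removed is the one just added. *)
Lemma cre_adj_right_create h x :
  cre_adj h (r x) = r (cre_adj h x) + vacuum_rank1 (dot xi (tens [:: h])) x.
Proof.
move: x; apply: (adjointable_eq dotE (@tens_totalP)).
- exact: adjoint_comp (cre_adj_adjoint h) right_create_adjoint.
- apply: adjointD (adjoint_comp right_create_adjoint (cre_adj_adjoint h))
    (vacuum_rank1_adjoint _).
- move=> [|k s]; rewrite /= right_create_tens /vacuum_rank1.
    rewrite [cre_adj h _ in RHS]cre_adj_vacuum (adjoint_morph0 dotE right_create_adjoint).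
    rewrite add0r cre_adj_particle//.
    by rewrite fdot_tens mulr1.
  rewrite cre_adj_tens (adjoint_morphZ dotE _ _ right_create_adjoint).
  rewrite right_create_tens fdot_tens /= mulr0 scale0r addr0.
  exact: cre_adj_create.
Qed.

Lemma right_adj_create h x :
  r_adj (create h x) = create h (r_adj x) + vacuum_rank1 (dot (tens [:: h]) xi) x.
Proof.
apply: (dot_inj dotE) => y; rewrite right_adj_adjoint create_adjoint.
rewrite cre_adj_right_create dotDr dotDl create_adjoint right_adj_adjoint.
congr (_ + _); rewrite vacuum_rank1_adjoint; congr (dot _ (vacuum_rank1 _ _)).
by rewrite -dotC.
Qed.

Lemma right_adj_semicircular h x : r_adj (semicircular h x) =
  semicircular h (r_adj x) + vacuum_rank1 (dot (tens [:: h]) xi) x.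
Proof.
rewrite -[semicircular h x]/(create h x + cre_adj h x).
rewrite (adjoint_morphD dotE _ _ right_adj_adjoint) right_adj_create.
by rewrite right_adj_cre_adj addrAC.
Qed.

Lemma right_create_semicircular h x : r (semicircular h x) =
  semicircular h (r x) - vacuum_rank1 (dot xi (tens [:: h])) x.
Proof.
rewrite -[semicircular h x]/(create h x + cre_adj h x).
rewrite (adjoint_morphD dotE _ _ right_create_adjoint) right_create_create.
rewrite -[semicircular h (r x)]/(create h (r x) + cre_adj h (r x)).
by rewrite cre_adj_right_create addrA addrK.
Qed.

Definition right_semicircular x : F := r x + r_adj x.

(** The vacuum terms produced by [r] and by [r_adj] have opposite signs and conjugate coefficients;
    these coefficients are real, so the terms cancel. *)
Lemma right_semicircular_comm h x : l2_real h ->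
  right_semicircular (semicircular h x) = semicircular h (right_semicircular x).
Proof.
move=> hr.
have SD y z : semicircular h (y + z) = semicircular h y + semicircular h z.
  exact: (adjoint_morphD dotE _ _ (adjointD (create_adjoint h) (cre_adj_adjoint h))).
rewrite /right_semicircular right_create_semicircular right_adj_semicircular SD.
have -> : dot (tens [:: h]) xi = dot xi (tens [:: h]).
  rewrite [LHS]dotC; have := real_particle_dot_tens rxi hr.
  by case: (dot xi _) => a b /= ->; rewrite conj_real.
by rewrite addrACA addNr addr0.
Qed.

Lemma nsq_right_adj x : nsq (r_adj x) <= nsq x.
Proof.
rewrite -(isometric_nsq _ right_create_isometric).
have rr y : r_adj (r y) = y.
  by apply: (dot_inj dotE) => z; rewrite right_adj_adjoint right_create_isometric.
apply: (@nsq_proj_le _ _ _ dotE (fun y => r (r_adj y))); last by move=> y; rewrite rr.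
by move=> y z; rewrite right_create_adjoint right_adj_adjoint.
Qed.

Lemma nsq_right_semicircular x : nsq (right_semicircular x) <= 4 * nsq x.
Proof.
apply: le_trans (nsqD_le dotE _ _) _.
rewrite (isometric_nsq _ right_create_isometric); have := nsq_right_adj x; lra.
Qed.

Lemma right_semicircular_adjoint : adjoint right_semicircular right_semicircular.
Proof.
move=> x y; rewrite dotDl dotDr right_create_adjoint right_adj_adjoint; exact: addrC.
Qed.

(** The right semicircular operator is bounded and commutes with every [S_t], so it belongs to the
    commutant that defines [SC]. *)
Lemma right_semicircular_SC p x : SC p -> right_semicircular (p x) = p (right_semicircular x).
Proof.
move=> [_ /(_ right_semicircular)]; rewrite funeqE => /(_ _ x) /= <-//.
split.
  apply: (@bounded_opP _ _ _ dotE _ 4); last exact: nsq_right_semicircular.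
  exact: (adjoint_linear dotE right_semicircular_adjoint).
move=> _ [t _ ->]; apply/funext => y /=.
by rewrite right_semicircular_comm.
Qed.

End right_creation.
End Fock.

(** * A real orthonormal basis of the one-particle space *)

Section RealBasis.
Variables (R : realType) (F : full_fock R).
Local Notation C := R[i].
Local Notation dot := (@fdot R F).
Local Notation dotE := (@fdotE R F).
Local Notation nsq := (sqnorm dot).
Local Notation tens := (@tens R F).

Let orthonormal_set (E : set F) := (forall xi, E xi -> real_particle xi) /\
  forall xi xi', E xi -> E xi' -> dot xi xi' = (xi == xi')%:R.

Lemma maximal_orthonormal_set : exists2 E, orthonormal_set E &
  forall z, real_particle z -> (forall xi, E xi -> dot z xi = 0) -> z = 0.
Proof.
have [|E [oE maxE]] := @Zorn_bigcup F orthonormal_set.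
  move=> S So Stot; split=> [xi [E SE Exi]|xi xi' [E SE Exi] [E' SE' Exi']].
    exact: (So _ SE).1.
  by have [/(_ xi)|/(_ xi')] := Stot _ _ SE SE'; [move=> /(_ Exi) h; apply: (So _ SE').2|
    move=> /(_ Exi') h; apply: (So _ SE).2].
exists E => // z rz zE; apply: contrapT => zn0.
have zp : 0 < nsq z.
  by rewrite lt_def (nsq_ge0 dotE) andbT; apply/eqP => /(nsq_eq0 dotE).
pose s := (Num.sqrt (nsq z))^-1; pose w := s%:C%C *: z.
have w1 : dot w w = 1.
  rewrite dot_nsq nsqZr exprVn sqr_sqrtr ?(nsq_ge0 dotE)// mulVf// gt_eqF//.
have wE xi : E xi -> dot w xi = 0 by move=> Exi; rewrite dotZl zE// mulr0.
have wNE : ~ E w.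
  by move=> /wE; rewrite w1 => /eqP; rewrite oner_eq0.
apply: (maxE (E `|` [set w])).
  by split=> [xi Exi|h]; [left|apply: wNE; apply: h; right].
split=> [xi [/oE.1//|->]|xi xi' [Exi|->] [Exi'|->]].
- exact: real_particleZ.
- exact: oE.2.
- by rewrite dotC wE// rmorph0; case: eqP => // E'; rewrite E' in Exi.
- by rewrite wE//; case: eqP => // E'; rewrite -E' in Exi'.
- by rewrite w1 eqxx.
Qed.

(** For real [h], the residue of [tens [:: h]] after projection is real, hence orthogonal to [E] in
    its imaginary part as well as its real part, and maximality makes it 0. A general [k] is reduced
    to real ones by [l2_split]. *)
Lemma real_orthonormal_basis : exists (I : choiceType) (xi : I -> F),
  [/\ forall i, real_particle (xi i),
      forall i j, dot (xi i) (xi j) = (i == j)%:R &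
      forall k y, (forall i, dot (xi i) y = 0) -> dot (tens [:: k]) y = 0].
Proof.
have [E [Er Eo] Emax] := maximal_orthonormal_set.
exists (E : Type), val.
have EP (i : E) : E (val i) by exact/set_mem/valP.
split=> [i|i j|k y hy]; [exact: Er|exact: Eo|].
have {}hy xi : E xi -> dot xi y = 0 by move=> /mem_set Exi; exact: (hy (exist _ xi Exi)).
suff real_case h : l2_real h -> dot (tens [:: h]) y = 0.
  have [k1 [k2 [k1r k2r kE]]] := l2_split k.
  have -> : tens [:: k] = tens [:: k1] + 'i%C *: tens [:: k2].
    apply: (total_eq (@tens_totalP _ _)) => s; rewrite dotDl dotZl !fdot_tens.
    by case: s => [|g [|g' s]] /=; rewrite ?mulr0 ?addr0 ?mulr1.
  by rewrite dotDl dotZl !real_case// mulr0 addr0.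
(* The real vectors in the closed span of [E], described by annihilators so that closedness is
   immediate. *)
move=> hr; pose V x := real_particle x /\
  forall y, (forall xi, E xi -> dot xi y = 0) -> dot x y = 0.
have V0 : V 0 by split; [exact: real_particle0|move=> z _; rewrite dot0l].
have VD x z : V x -> V z -> V (x + z).
  move=> [rx hx] [rz hz]; split; first exact: real_particleD.
  by move=> t ht; rewrite dotDl hx// hz// addr0.
have VZ (a : R) x : V x -> V (a%:C%C *: x).
  move=> [rx hx]; split; first exact: real_particleZ.
  by move=> t ht; rewrite dotZl hx// mulr0.
have Vcl u x : (forall n, V (u n)) -> hcvg dot u x -> V x.
  move=> Vu ux; split.
    by apply: real_particle_lim ux => n; exact: (Vu n).1.
  by move=> t ht; apply: (hcvg_dot0 dotE ux) => n; exact: (Vu n).2.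
have [x [rx hx] xh] := hilbert_proj dotE V0 VD VZ Vcl (tens [:: h]).
have rhx : real_particle (tens [:: h] - x).
  apply: real_particleD; first exact: real_particle_tens.
  have := real_particleZ (-1) rx.
  by rewrite (_ : (-1)%:C%C = -1 :> C) ?scaleN1r// rmorphN1.
suff /subr0_eq -> : tens [:: h] - x = 0 by exact: hx.
apply: Emax => // xi Exi; apply: FockModel.ReIm_eq.
  by apply: xh; split; [exact: Er|move=> t; apply].
by apply: real_particle_dot => //; exact: Er.
Qed.

End RealBasis.

(** * The projection and its shift *)

Section Words.
Variables (R : realType) (F : full_fock R).
Local Notation C := R[i].
Local Notation Re := (@complex.Re R).
Local Notation dot := (@fdot R F).
Local Notation dotE := (@fdotE R F).
Local Notation nsq := (sqnorm dot).
Local Notation adjoint := (is_adjoint dot).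
Local Notation tens := (@tens R F).
Local Notation Om := (vacuum F).
Variables (I : choiceType) (xi : I -> F).
Hypothesis xi_real : forall i, real_particle (xi i).
Hypothesis xi_on : forall i j, dot (xi i) (xi j) = (i == j)%:R.
Hypothesis xi_total :
  forall k y, (forall i, dot (xi i) y = 0) -> dot (tens [:: k]) y = 0.

Let xi1 i : nsq (xi i) = 1. Proof. by rewrite /sqnorm xi_on eqxx. Qed.

Local Notation r i := (right_create (xi i)).
Local Notation r_adj i := (adj (r i)).

Let r_adjoint i : adjoint (r i) (r_adj i).
Proof. exact: right_create_adjoint. Qed.
Let r_adj_adjoint i : adjoint (r_adj i) (r i).
Proof. exact: right_adj_adjoint. Qed.
Let R_adjoint i : adjoint (right_semicircular (xi i)) (right_semicircular (xi i)).
Proof. exact: right_semicircular_adjoint. Qed.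

(* The elementary tensor of the one-particle vectors [xi i], [i] in [w]. *)
Definition word_vec (w : seq I) : F := foldl (fun x i => r i x) Om w.
Local Notation e := word_vec.
Local Notation hs := (hs_normsq dot e).

Lemma word_vec_rcons w i : word_vec (rcons w i) = r i (word_vec w).
Proof. by rewrite /word_vec foldl_rcons. Qed.

Lemma right_adj_right_create i j x : r_adj i (r j x) = (i == j)%:R *: x.
Proof.
move: x; apply: (adjointable_eq dotE (@tens_totalP _ _)).
- exact: adjoint_comp (r_adj_adjoint i) (r_adjoint j).
- move=> x y; rewrite dotZl; apply/esym; rewrite -[(i == j)%:R]conjCK -dotZr; reflexivity.
- move=> s; apply: (total_eq (@tens_totalP _ _)) => s'.
  rewrite /= right_adj_adjoint// !right_create_tens// dot_create_word// xi_on.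
  by rewrite dotZl fdot_tens mulrC eq_sym.
Qed.

Lemma dot_right_create i j x y : dot (r i x) (r j y) = (i == j)%:R * dot x y.
Proof. by rewrite -right_adj_adjoint// right_adj_right_create dotZl eq_sym. Qed.

Lemma dot_vacuum_right_create i x : dot Om (r i x) = 0.
Proof. by rewrite -right_adj_adjoint// right_adj_vacuum// dot0l. Qed.

Lemma dot_vacuum : dot Om Om = 1. Proof. exact: fdot_tens. Qed.

Lemma word_vec_on v w : dot (word_vec v) (word_vec w) = (v == w)%:R.
Proof.
elim/last_ind: v w => [|v i IH] w; elim/last_ind: w => [|w j _].
- by rewrite dot_vacuum.
- by rewrite word_vec_rcons dot_vacuum_right_create; case: w.
- by rewrite word_vec_rcons dotC dot_vacuum_right_create rmorph0; case: v {IH}.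
- rewrite !word_vec_rcons dot_right_create IH eqseq_rcons andbC.
  by case: (i == j); rewrite ?mul1r ?mul0r.
Qed.

Lemma right_adj_word_vec i w : r_adj i (word_vec w) = 0 \/
  exists2 v, r_adj i (word_vec w) = word_vec v & (size v < size w)%N.
Proof.
case/lastP: w => [|w j]; first by left; rewrite right_adj_vacuum.
rewrite word_vec_rcons right_adj_right_create; case: (i == j).
  by right; exists w; rewrite ?scale1r ?size_rcons.
by left; rewrite scale0r.
Qed.

Lemma create_word_word_vec h w : create h (word_vec w) =
  foldl (fun x i => r i x) (tens [:: h]) w.
Proof.
elim/last_ind: w => [|w i IH]; first by rewrite /= create_tens.
by rewrite word_vec_rcons foldl_rcons -IH right_create_create.
Qed.

Lemma word_adjoint w : exists A', adjoint (fun y => foldl (fun x i => r i x) y w) A'.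
Proof.
elim/last_ind: w => [|w i [A' hA]]; first by exists id.
exists (A' \o r_adj i) => x y.
by rewrite foldl_rcons right_create_adjoint// hA.
Qed.

(* By induction on [s], the tensors [create_word s (e w)] are in the closed span
   of the words: the last letter [k] of [s] can be expanded in the [xi i]. *)
Lemma word_vec_total : total_family dot word_vec.
Proof.
move=> x xw; apply: (@tens_totalP _ _) => s; rewrite dotC.
suff h : forall w, dot (create_word s (word_vec w)) x = 0.
  by have := h [::]; rewrite create_word_tens cats0 => ->; rewrite rmorph0.
elim/last_ind: s => [|s k IH] w; first by rewrite dotC xw rmorph0.
have [L' hL] : exists L', adjoint (@create_word _ F s) L'.
  elim: {IH} s => [|h s [L' hL]]; first by exists id.
  by exists (L' \o adj (create h)) => y z; rewrite /= create_adjoint hL.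
have [A' hA] := word_adjoint w.
rewrite /create_word foldr_rcons create_word_word_vec -/(create_word s _) hL hA.
apply: xi_total => i; rewrite -hA -hL.
have := IH (i :: w); rewrite /word_vec /= right_create_vacuum//.
Qed.

(** A word is empty or ends with a letter. This is the decomposition of the basis on which the
    shifted projection is defined. *)
Lemma hs_words A : hs A =
  ((nsq (A Om))%:E + \tsum_i \tsum_w (nsq (A (r i (e w))))%:E)%E.
Proof.
rewrite /hs_normsq (esumID [set [::]]); last by move=> w _; rewrite lee_fin (nsq_ge0 dotE).
rewrite !setTI esum_set1 ?lee_fin ?(nsq_ge0 dotE)//; congr (_ + _)%E.
rewrite esum_esum; last by move=> *; rewrite lee_fin (nsq_ge0 dotE).
rewrite (@reindex_esum _ _ _ (setT `*`` (fun=> setT)) _ (fun k : I * seq I => rcons k.2 k.1)).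
  by apply: eq_esum => -[i w] _ /=; rewrite word_vec_rcons.
split=> [[i w] _ /=|[i w] [i' w'] _ _ /=|w].
- by move/(congr1 size); rewrite size_rcons.
- by move/rcons_inj => [-> ->].
- by case/lastP: w => [/(_ erefl)//|w i _]; exists (i, w).
Qed.

Section commuting_projection.
Variable p : F -> F.
Hypothesis p_sa : adjoint p p.
Hypothesis p_idem : forall x, p (p x) = p x.
Hypothesis p_comm : forall i x,
  right_semicircular (xi i) (p x) = p (right_semicircular (xi i) x).

Let pD x y : p (x + y) = p x + p y.
Proof. exact: (adjoint_morphD dotE _ _ p_sa). Qed.
Let pN x : p (- x) = - p x.
Proof. exact: (adjoint_morphN dotE _ p_sa). Qed.

Let rD i x y : r i (x + y) = r i x + r i y.
Proof. exact: (adjoint_morphD dotE _ _ (r_adjoint i)). Qed.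
Let rN i x : r i (- x) = - r i x.
Proof. exact: (adjoint_morphN dotE _ (r_adjoint i)). Qed.

(* The reflection [2 q - 1] is the isometry that maps the orthonormal basis
   [Om, r i (e w)] to the orthonormal family [- Om, r i ((2 p - 1) (e w))]. *)
Lemma shifted_projection : exists q : F -> F, [/\ adjoint q q, forall x, q (q x) = q x,
  forall i x, q (r i x) = r i (p x) & q Om = 0].
Proof.
pose u x := p x + p x - x.
have u_sa : adjoint u u by move=> x y; rewrite /u !(dotBl, dotBr, dotDl, dotDr) p_sa.
have uu x : u (u x) = x.
  rewrite /u !(pD, pN, p_idem); apply: (dot_inj dotE) => z.
  rewrite !(dotDl, dotNl); ring.
pose f w := if rev w is i :: w' then r i (u (e (rev w'))) else - Om.
have f_nil : f [::] = - Om by [].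
have f_rcons w i : f (rcons w i) = r i (u (e w)) by rewrite /f rev_rcons revK.
have f_on v w : dot (f v) (f w) = dot (e v) (e w).
  rewrite word_vec_on; elim/last_ind: v w => [|v i _] w; elim/last_ind: w => [|w j _].
  - by rewrite f_nil dotNl dotNr opprK dot_vacuum.
  - by rewrite f_nil f_rcons dotNl dot_vacuum_right_create// oppr0; case: w.
  - by rewrite f_nil f_rcons dotNr dotC dot_vacuum_right_create// rmorph0 oppr0; case: v.
  - rewrite !f_rcons dot_right_create// u_sa uu word_vec_on eqseq_rcons andbC.
    by case: (i == j); rewrite ?mul1r ?mul0r.
have [U iU Ue] := isometry_extension dotE word_vec_total f_on.
have [U' hU] := isometric_adjoint dotE iU.
have Ur i x : U (r i x) = r i (u x).
  move: x; apply: (adjointable_eq dotE word_vec_total).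
  - exact: adjoint_comp hU (r_adjoint i).
  - exact: adjoint_comp (r_adjoint i) u_sa.
  - by move=> w; rewrite /= -word_vec_rcons Ue f_rcons.
have UOm : U Om = - Om by exact: (Ue [::]).
have UU x : U (U x) = x.
  move: x; apply: (adjointable_eq dotE word_vec_total (adjoint_comp hU hU)).
    by move=> x y; reflexivity.
  elim/last_ind => [|w i _] /=; first by rewrite UOm (adjoint_morphN dotE _ hU) UOm opprK.
  by rewrite word_vec_rcons !Ur uu.
have U_sa : adjoint U U by move=> x y; rewrite -iU UU.
have halfJ : Num.conj (2^-1 : C) = 2^-1 by rewrite fmorphV rmorph_nat.
exists (fun x => 2^-1 *: (x + U x)); split.
- by move=> x y; rewrite dotZl dotZr halfJ dotDl dotDr U_sa.
- move=> x; rewrite (adjoint_morphZ dotE _ _ hU) (adjoint_morphD dotE _ _ hU) UU.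
  apply: (dot_inj dotE) => z.
  by rewrite !(dotZl, dotDl); field.
- move=> i x; rewrite Ur /u -rD; apply: (dot_inj dotE) => z.
  have -> : x + (p x + p x - x) = p x + p x by rewrite addrC subrK.
  by rewrite rD !(dotZl, dotDl); field.
- by rewrite UOm subrr scaler0.
Qed.

Hypothesis comm_hs : (\tsum_i \tsum_w (nsq (p (r i (e w)) - r i (p (e w))))%:E < +oo)%E.

Lemma projection_trace_integral : exists n m : nat, nsq (p Om) + m%:R = n%:R.
Proof.
have [q [q_sa q_idem qr qOm]] := shifted_projection.
pose D := projdiff p q.
have Dr i x : D (r i x) = p (r i x) - r i (p x) by rewrite /D /projdiff qr.
have DOm : D Om = p Om by rewrite /D /projdiff qOm subr0.
have D_hs : (hs D < +oo)%E.
  rewrite hs_words DOm; apply: lte_add_pinfty; first exact: ltry.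
  by under eq_esum do under eq_esum do rewrite Dr.
have [n [m nm]] := index_integral dotE word_vec_on word_vec_total p_sa q_sa p_idem q_idem D_hs.
have D_sa : adjoint D D by move=> x y; rewrite /D /projdiff dotBl dotBr p_sa q_sa.
have DqE : (hs (fun x => D (q x)) =
    \tsum_i \tsum_w (nsq (r i (p (e w)) - p (r i (p (e w)))))%:E)%E.
  rewrite hs_words qOm (adjoint_morph0 dotE D_sa) nsq0 add0e.
  apply: eq_esum => i _; apply: eq_tsum => w.
  by rewrite qr Dr p_idem nsq_subC.
have DpE : hs (fun x => D (p x)) = ((nsq (p Om))%:E + hs (fun x => D (q x)))%E.
  rewrite (@hs_adjoint _ _ _ dotE _ _ word_vec_on word_vec_total _ (fun x => p (D x))); last first.
    by move=> x y; rewrite D_sa p_sa.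
  rewrite DqE hs_words DOm p_idem; congr (_ + _)%E; apply: eq_esum => i _.
  pose A x := p (r i (x - p x)); pose A' x := r_adj i (p x) - p (r_adj i (p x)).
  have AA' : adjoint A A'.
    move=> x y; rewrite /A /A' p_sa (r_adjoint i).
    by rewrite dotBl dotBr p_sa.
  transitivity (hs A); last rewrite (hs_adjoint dotE word_vec_on word_vec_total AA').
    by apply: eq_tsum => w; rewrite /A Dr pD pN p_idem rD rN pD pN.
  apply: eq_tsum => w; rewrite /A' -nsqN; congr nsq.
  have := p_comm i (p (e w)); rewrite p_idem /right_semicircular pD => h.
  apply/eqP; rewrite -subr_eq0; apply/eqP.
  have := congr1 (fun x => x - p (r i (p (e w))) - p (r_adj i (p (e w)))) h.
  rewrite (addrC (p (r i _))) addrK subrr => {}h; rewrite -[RHS]oppr0 -h.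
  by rewrite !opprD !opprK; apply: (dot_inj dotE) => z; rewrite !(dotDl, dotNl); ring.
have Dq_fin : hs (fun x => D (q x)) \is a fin_num.
  rewrite ge0_fin_numE ?(hs_ge0 dotE)//; apply: le_lt_trans D_hs.
  rewrite (@hs_adjoint _ _ _ dotE _ _ word_vec_on word_vec_total _ (fun x => q (D x))).
    by apply: le_hs => x; exact: (nsq_proj_le dotE).
  by move=> x y; rewrite D_sa q_sa.
exists n, m; move: nm; rewrite DpE addeAC addeC => /(fin_num_addeI Dq_fin).
by rewrite -EFinD => -[].
Qed.

(** [e (rcons w i)] is [right_semicircular (xi i) (e w)] minus 0 or a shorter word. As [p] commutes
    with these operators, its vanishing on the vacuum spreads to all words. *)
Lemma vacuum_separating : (forall x, p x = 0) \/ p Om <> 0.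
Proof.
have [pOm|] := pselect (p Om = 0); [left|by right].
have pe n w : (size w <= n)%N -> p (e w) = 0.
  elim: n w => [|n IH] w; first by case: w.
  case/lastP: w => [//|w i]; rewrite size_rcons ltnS => wn.
  have pw := IH _ wn.
  have /= := p_comm i (e w); rewrite pw /right_semicircular (adjoint_morph0 dotE (r_adjoint i)).
  rewrite (adjoint_morph0 dotE (r_adj_adjoint i)) addr0 pD word_vec_rcons.
  have -> : p (r_adj i (e w)) = 0.
    case: (right_adj_word_vec i w) => [->|[v -> vw]].
      exact: (adjoint_morph0 dotE p_sa).
    by apply: IH; exact: leq_trans (ltnW vw) wn.
  by rewrite addr0.
by move=> x; apply: word_vec_total => w; rewrite p_sa (pe (size w))// dot0r.
Qed.

End commuting_projection.

(** * The derivative as a commutator with right annihilation *)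

Record deriv_term := DerivTerm { dfun : l2 R; dleft : F -> F; dright : F -> F;
  dleft_adj : F -> F; dright_adj : F -> F;
  dleftP : adjoint dleft dleft_adj; drightP : adjoint dright dright_adj }.
Implicit Types (q : deriv_term) (a : seq deriv_term).

Definition deriv_tensor a (t : R) : tensor F := [seq (dfun q t *: dleft q, dright q) | q <- a].

(* The Hilbert-Schmidt operator obtained from [x (x) y |-> x P y], P the vacuum
   projection, by integrating the derivative against [eta]. *)
Definition deriv_op a (eta : F) x : F :=
  \sum_(q <- a) (dot (tens [:: dfun q]) eta * dot (dright q x) Om) *: dleft q Om.

(** Commutation with [r_adj i] is a derivation, and the left and right actions in the Leibniz rule
    become composition on either side of [x P y]. On [semicircular h] the commutator is the vacuum
    projection times [dot (tens [:: h]) (xi i)]. The adjoint is carried along so that [adj] never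
    falls back on its default value. *)
Lemma malliavin_terms A (u : R -> tensor F) : malliavin A u -> exists A' a,
  [/\ adjoint A A', u = deriv_tensor a,
      forall i x, r_adj i (A x) = A (r_adj i x) + deriv_op a (xi i) x &
      forall i x, right_semicircular (xi i) (A x) = A (right_semicircular (xi i) x)].
Proof.
have id_adj : adjoint id id by [].
elim=> {A u} [|h hr|A B u v _ [A' [a [AA' -> aA cA]]] _ [B' [b [BB' -> bB cB]]]
  |c A u _ [A' [a [AA' -> aA cA]]]
  |A B u v _ [A' [a [AA' -> aA cA]]] _ [B' [b [BB' -> bB cB]]]].
- exists id, [::]; split=> // i x; by rewrite /deriv_op big_nil addr0.
- exists (adj (@create R F h) + create h), [:: DerivTerm h id_adj id_adj]; split=> //.
  + exact: adjointD (create_adjoint h) (cre_adj_adjoint h).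
  + by move=> i x; rewrite right_adj_semicircular// /deriv_op big_seq1.
  + by move=> i x; rewrite right_semicircular_comm.
- exists (A' + B'), (a ++ b); split.
  + exact: adjointD.
  + by apply/funext => t; rewrite /deriv_tensor map_cat.
  + move=> i x; rewrite -![(A + B) _]/(A _ + B _).
    by rewrite (adjoint_morphD dotE _ _ (r_adj_adjoint i)) aA bB /deriv_op big_cat addrACA.
  + move=> i x; rewrite -![(A + B) _]/(A _ + B _) -cA -cB.
    exact: (adjoint_morphD dotE _ _ (R_adjoint i)).
- pose term q := DerivTerm (dfun q) (adjointZ c (dleftP q)) (drightP q).
  exists (Num.conj c *: A'), (map term a); split.
  + exact: adjointZ.
  + apply/funext => t; rewrite /deriv_tensor /tensor_scale -!map_comp.
    by apply: eq_map => q /=; rewrite !scalerA mulrC.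
  + move=> i x; rewrite -![(c *: A) _]/(c *: A _).
    rewrite (adjoint_morphZ dotE _ _ (r_adj_adjoint i)) aA scalerDr; congr (_ + _).
    rewrite /deriv_op big_map scaler_sumr; apply: eq_bigr => q _ /=.
    rewrite -[(c *: dleft q) Om]/(c *: dleft q Om) !scalerA; congr (_ *: _); ring.
  + move=> i x; rewrite -![(c *: A) _]/(c *: A _) -cA.
    exact: (adjoint_morphZ dotE _ _ (R_adjoint i)).
- pose terml q := DerivTerm (dfun q) (adjoint_comp AA' (dleftP q)) (drightP q).
  pose termr q := DerivTerm (dfun q) (dleftP q) (adjoint_comp (drightP q) BB').
  have AD x y : A (x + y) = A x + A y by exact: (adjoint_morphD dotE _ _ AA').
  have A0 := adjoint_morph0 dotE AA'.
  have AZ c x : A (c *: x) = c *: A x by exact: (adjoint_morphZ dotE _ _ AA').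
  exists (B' \o A'), (map terml b ++ map termr a); split.
  + exact: adjoint_comp.
  + apply/funext => t; rewrite /deriv_tensor /tensor_lact /tensor_ract map_cat -!map_comp.
    congr (_ ++ _); apply: eq_map => q /=; congr (_, _).
    by apply/funext => x; exact: AZ.
  + move=> i x; rewrite /= aA bB AD -addrA; congr (_ + _).
    rewrite /deriv_op big_cat !big_map /= (big_morph A AD A0); congr (_ + _).
    by apply: eq_bigr => q _; rewrite AZ.
  + by move=> i x; rewrite /= cA cB.
Qed.

(** The inner product of two tensors [x (x) y] for [tau (x) tau^op], which is also the
    Hilbert-Schmidt inner product of the operators [x P y]. The opposite product is the source of
    the adjoints and of the exchanged order in the second factor. *)
Definition deriv_gram q q' : C :=
  dot (dleft q Om) (dleft q' Om) * dot (dright_adj q' Om) (dright_adj q Om).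

Lemma tau_dotE (X Y : F -> F) : (exists Y', adjoint Y Y') ->
  tau_dot X Y = dot (X Om) (Y Om).
Proof. by move=> /adjP/adjoint_sym hY; rewrite /tau_dot /tau /= hY. Qed.

Lemma tau_op_dotE (X X' Y Y' : F -> F) : adjoint X X' -> adjoint Y Y' ->
  tau_op_dot X Y = dot (Y' Om) (X' Om).
Proof.
move=> hX hY; rewrite /tau_op_dot /tau /= hX.
have /adjP/adjoint_sym -> : exists Y', adjoint Y Y' by exists Y'.
by rewrite -(adjoint_sym hY).
Qed.

Lemma tensor_dot_deriv a t : tensor_dot (deriv_tensor a t) (deriv_tensor a t) =
  \sum_(q <- a) \sum_(q' <- a) deriv_gram q q' * (dfun q t * Num.conj (dfun q' t)).
Proof.
rewrite /tensor_dot /deriv_tensor big_map; apply: eq_bigr => q _; rewrite big_map.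
apply: eq_bigr => q' _ /=; rewrite tau_dotE; last first.
  by exists (Num.conj (dfun q' t) *: dleft_adj q'); apply: adjointZ; exact: dleftP.
rewrite (tau_op_dotE (drightP q) (drightP q')) /deriv_gram.
rewrite -[(dfun q t *: dleft q) Om]/(dfun q t *: dleft q Om).
rewrite -[(dfun q' t *: dleft q') Om]/(dfun q' t *: dleft q' Om).
rewrite dotZl dotZr; ring.
Qed.

Definition deriv_normsq a : R :=
  Re (\sum_(q <- a) \sum_(q' <- a) l2_dot (dfun q) (dfun q') * deriv_gram q q').

Lemma B2_normsq_deriv a : B2_normsq (deriv_tensor a) = (deriv_normsq a)%:E.
Proof.
pose f t := tensor_dot (deriv_tensor a t) (deriv_tensor a t).
pose g q q' t := deriv_gram q q' * (dfun q t * Num.conj (dfun q' t)).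
have gi q q' : FockModel.cintegrable (g q q').
  exact/FockModel.cintegrableZ/FockModel.l2_cintegrable.
have fE : f = fun t => \sum_(q <- a) \sum_(q' <- a) g q q' t.
  by apply/funext => t; exact: tensor_dot_deriv.
have fi : FockModel.cintegrable f.
  by rewrite fE; apply: FockModel.cintegrable_sum => q; exact: FockModel.cintegrable_sum.
rewrite /B2_normsq -(fineK (integrable_fin_num (@FockModel.mD R) fi.1)).
congr EFin; rewrite -[LHS]/(Re (FockModel.cint f)) fE FockModel.cint_sum; last first.
  by move=> q; exact: FockModel.cintegrable_sum.
congr Re; apply: eq_bigr => q _; rewrite FockModel.cint_sum//; apply: eq_bigr => q' _.
by rewrite FockModel.cintZ ?FockModel.l2_dotE 1?mulrC//; exact: FockModel.l2_cintegrable.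
Qed.

(** The map [x (x) y |-> x P y] preserves norms, and the [xi i] are orthonormal among the
    one-particle vectors. Two applications of [schur_bessel], over the letters and over the words,
    give the inequality for finite sums. *)
Lemma deriv_op_bound a (rI : seq I) (rW : seq (seq I)) : uniq rI -> uniq rW ->
  \sum_(i <- rI) \sum_(w <- rW) nsq (deriv_op a (xi i) (e w)) <= deriv_normsq a.
Proof.
move=> uI uW; pose q_ := tnth (in_tuple a).
pose X j := dleft (q_ j) Om; pose f j := tens [:: dfun (q_ j)].
pose Y j := dright_adj (q_ j) Om.
pose b w j := dot (dright (q_ j) (e w)) Om.
pose G0 j l := dot (X j) (X l).
pose G2 j l := dot (f j) (f l) * G0 j l.
have psd0 : psd G0 by exact: (psd_gram dotE).
(* Positivity of an entrywise product is [schur_bessel] for the empty family, whose left-hand side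
   is 0. *)
have psd2 : psd G2.
  move=> z; have := schur_bessel dotE word_vec_on word_vec_total f (psd_scale z psd0)
    (isT : uniq [::]).
  rewrite big_nil; congr (0 <= Re _); apply: eq_bigr => j _; apply: eq_bigr => l _.
  rewrite /G2; ring.
have bE w j : b w j = Num.conj (dot (Y j) (e w)).
  by rewrite /b (drightP (q_ j)) dotC.
have nsqE i w : nsq (deriv_op a (xi i) (e w)) =
    Re (\sum_j \sum_l dot (f j) (e [:: i]) * Num.conj (dot (f l) (e [:: i])) *
       (b w j * Num.conj (b w l) * G0 j l)).
  have e1 : e [:: i] = xi i by rewrite /word_vec /= right_create_vacuum.
  rewrite /sqnorm /deriv_op (big_tnth _ _ a) dot_suml; congr Re; apply: eq_bigr => j _.
  rewrite dot_sumr; apply: eq_bigr => l _; rewrite e1 dotZl dotZr !rmorphM /=.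
  rewrite /b /G0 /f /X; ring.
rewrite exchange_big /=.
(* For fixed [w] the letters [i] are summed as words of length one. The remaining coefficients
   [b w j] are conjugates of [dot (Y j) (e w)], which is why the kernel [G2] appears transposed. *)
apply: (@le_trans _ _ (\sum_(w <- rW) Re (\sum_j \sum_l
    dot (Y j) (e w) * Num.conj (dot (Y l) (e w)) * G2 l j))).
  apply: ler_sum => w _.
  have u1 : uniq [seq [:: i] | i <- rI] by rewrite map_inj_uniq// => i j [].
  have := schur_bessel dotE word_vec_on word_vec_total f (psd_scale (b w) psd0) u1.
  rewrite big_map; under eq_bigr do rewrite -nsqE; move=> /le_trans; apply.
  rewrite le_eqVlt; apply/orP; left; apply/eqP; congr Re.
  rewrite exchange_big; apply: eq_bigr => l _; apply: eq_bigr => j _.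
  rewrite !bE conjCK /G2; ring.
have := schur_bessel dotE word_vec_on word_vec_total Y (psd_trans psd2) uW; move=> /le_trans; apply.
rewrite /deriv_normsq le_eqVlt; apply/orP; left; apply/eqP; congr Re.
rewrite exchange_big !(big_tnth _ _ a); apply: eq_bigr => j _.
rewrite (big_tnth _ _ a); apply: eq_bigr => l _.
rewrite /G2 /f fdot_tens tens_dot1 /deriv_gram /Y /G0 /X -/q_; ring.
Qed.

Definition right_commutator A i x := r_adj i (A x) - A (r_adj i x).

Lemma malliavinB (A B : F -> F) (u v : R -> tensor F) : malliavin A u -> malliavin B v ->
  malliavin (A - B) (fun t => tensor_sub (u t) (v t)).
Proof. by move=> mA mB; rewrite -scaleN1r; apply: malliavinD => //; exact: malliavinZ. Qed.

(** The bounded right semicircular operators build every word from the vacuum, and both [p] and the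
    [A n] commute with them. *)
Lemma word_vec_cvg p (A : nat -> F -> F) : SC p -> adjoint p p ->
  (forall n, exists u, malliavin (A n) u) ->
  hcvg dot (fun n => A n Om) (p Om) ->
  forall w, hcvg dot (fun n => A n (e w)) (p (e w)).
Proof.
move=> SCp p_sa mA cOm.
have AR n i x : right_semicircular (xi i) (A n x) = A n (right_semicircular (xi i) x).
  by have [u /(malliavin_terms)[? [? [_ _ _ ->]]]] := mA n.
have AB n x y : A n (x - y) = A n x - A n y.
  have [u /(malliavin_terms)[A' [? [hA _ _ _]]]] := mA n.
  exact: (adjoint_morphB dotE _ _ hA).
have A0 n : A n 0 = 0 by have := AB n 0 0; rewrite !subrr.
have pB x y : p (x - y) = p x - p y by exact: (adjoint_morphB dotE _ _ p_sa).
have p0 : p 0 = 0 by have := pB 0 0; rewrite !subrr.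
suff main n w : (size w <= n)%N -> hcvg dot (fun n => A n (e w)) (p (e w)).
  by move=> w; exact: (main (size w)).
elim: n w => [|n IH] w; first by case: w.
case/lastP: w => [//|w i]; rewrite size_rcons ltnS => wn.
have -> : e (rcons w i) = right_semicircular (xi i) (e w) - r_adj i (e w).
  by rewrite word_vec_rcons addrK.
rewrite pB -right_semicircular_SC//.
have -> : (fun n => A n (right_semicircular (xi i) (e w) - r_adj i (e w))) =
    (fun n => right_semicircular (xi i) (A n (e w)) + (-1) *: A n (r_adj i (e w))).
  by apply/funext => k; rewrite AB -AR scaleN1r.
rewrite -[- p _]scaleN1r; apply: (hcvgD dotE); last first.
  apply: (@hcvgZ _ _ _ dotE (-1) (fun n => A n (r_adj i (e w)))).
  case: (right_adj_word_vec i w) => [->|[v -> vw]].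
    by rewrite p0 (funext A0); exact: hcvg_cst.
  by apply: IH; exact: leq_trans (ltnW vw) wn.
apply: (@hcvg_bounded _ _ _ dotE (right_semicircular (xi i)) 4 (fun n => A n (e w))).
- move=> x y.
  exact: (adjoint_morphB dotE _ _ (R_adjoint i)).
- by move=> x; exact: nsq_right_semicircular.
- exact: IH.
Qed.

(** A Fatou argument: the commutators of the [A n] have uniformly bounded finite sums, and each of
    their entries converges to the corresponding entry for [p]. *)
Lemma D12_commutator p : SC p -> adjoint p p -> D12 p ->
  (\tsum_i \tsum_w (nsq (p (r i (e w)) - r i (p (e w))))%:E < +oo)%E.
Proof.
move=> SCp p_sa [A [u [mA cA pA]]].
have pB x y : p (x - y) = p x - p y by exact: (adjoint_morphB dotE _ _ p_sa).
(* Commutation with [r + r^*] turns [[p, r]] into [[r^*, p]], the form that the derivative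
   describes. *)
have cE i x : p (r i x) - r i (p x) = right_commutator p i x.
  have := right_semicircular_SC (xi_real i) (xi1 i) x SCp.
  rewrite /right_commutator /right_semicircular => /esym h.
  apply/subr0_eq.
  have -> : p (r i x) = p (r i x + r_adj i x) - p (r_adj i x) by rewrite -pB addrK.
  rewrite h; apply: (dot_inj dotE) => z; rewrite !(dotDl, dotNl, dot0l); ring.
have AOm : hcvg dot (fun n => A n Om) (p Om).
  move=> d d0; have /cvgrPdist_lt/(_ _ d0)[N _ h] := pA; exists N => n /h /=.
  have [A' [? [hA _ _ _]]] := malliavin_terms (mA n).
  rewrite tau_dotE; last first.
    exists (A' + Num.conj (-1) *: p); rewrite -scaleN1r.
    by apply: adjointD => //; exact: adjointZ.
  rewrite sub0r normrN ger0_norm//; exact: (nsq_ge0 dotE).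
(* Only finiteness is wanted, so the Cauchy condition at the single value 1 is enough: [A N] is
   fixed and [A n - A N] has derivative of squared norm at most 1. *)
have [N hN] := cA 1 ltr01.
have [AN' [aN [hAN uN cN _]]] := malliavin_terms (mA N).
have comm_bound n (rI : seq I) rW : (N <= n)%N -> uniq rI -> uniq rW ->
    \sum_(i <- rI) \sum_(w <- rW) nsq (right_commutator (A n) i (e w)) <=
    2 + 2 * deriv_normsq aN.
  move=> Nn uI uW.
  have [B' [a [hB ua ca _]]] := malliavin_terms (malliavinB (mA n) (mA N)).
  have aN1 : deriv_normsq a <= 1.
    have := hN n N Nn (leqnn N); rewrite /norm12sq ua B2_normsq_deriv -EFinD lte_fin.
    rewrite tau_dotE; last by exists B'.
    by move/ltW; apply: le_trans; rewrite lerDr; exact: (nsq_ge0 dotE).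
  have bB := deriv_op_bound a uI uW.
  have bN := deriv_op_bound aN uI uW.
  apply: (@le_trans _ _ (2 * (\sum_(i <- rI) \sum_(w <- rW) nsq (deriv_op a (xi i) (e w))) +
      2 * (\sum_(i <- rI) \sum_(w <- rW) nsq (deriv_op aN (xi i) (e w))))); last by lra.
  rewrite !mulr_sumr -big_split; apply: ler_sum => i _ /=.
  rewrite !mulr_sumr -big_split; apply: ler_sum => w _ /=.
  have -> : right_commutator (A n) i (e w) = deriv_op a (xi i) (e w) + deriv_op aN (xi i) (e w).
    have := ca i (e w); rewrite -![(A n - A N) _]/(A n _ - A N _).
    rewrite (adjoint_morphB dotE _ _ (r_adj_adjoint i)) cN => h.
    set t := A n (r_adj i (e w)) - _ in h.
    have -> : deriv_op a (xi i) (e w) = (t + deriv_op a (xi i) (e w)) - t.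
      by rewrite addrC addKr.
    rewrite -h /right_commutator; apply: (dot_inj dotE) => z; rewrite !(dotDl, dotNl); ring.
  exact: (nsqD_le dotE).
have Acvg := word_vec_cvg SCp p_sa (fun n => ex_intro _ _ (mA n)) AOm.
have ccvg i w : hcvg dot (fun n => right_commutator (A n) i (e w)) (right_commutator p i (e w)).
  have -> : (fun n => right_commutator (A n) i (e w)) =
      (fun n => r_adj i (A n (e w)) + (-1) *: A n (r_adj i (e w))).
    by apply/funext => k; rewrite scaleN1r.
  rewrite /right_commutator -[- p _]scaleN1r; apply: (hcvgD dotE); last first.
    apply: (@hcvgZ _ _ _ dotE (-1) (fun n => A n (r_adj i (e w)))).
    case: (right_adj_word_vec i w) => [->|[v -> _]]; last exact: Acvg.
    rewrite (adjoint_morph0 dotE p_sa) (_ : (fun n => A n 0) = fun=> 0); first exact: hcvg_cst.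
    apply/funext => n; have [A' [? [hA _ _ _]]] := malliavin_terms (mA n).
    exact: (adjoint_morph0 dotE hA).
  apply: (@hcvg_bounded _ _ _ dotE (r_adj i) 1 (fun n => A n (e w))).
  - by move=> x y; exact: (adjoint_morphB dotE _ _ (r_adj_adjoint i)).
  - by move=> x; rewrite mul1r; exact: nsq_right_adj.
  - exact: Acvg.
(* The inner bracket bounds the sums for [A n]; the outer factor 2 comes from [nsqD_le], and the
   first term absorbs twice an error below 1. *)
pose M := 2 + 2 * (2 + 2 * deriv_normsq aN).
apply: (@le_lt_trans _ _ M%:E); last exact: ltry.
rewrite esum_esum; last by move=> *; rewrite lee_fin (nsq_ge0 dotE).
rewrite (_ : setT `*`` _ = setT); last by apply/seteqP; split.
apply: esum_le_seq => s us; rewrite lee_fin.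
under eq_bigr do rewrite cE.
have [n Nn hn] : exists2 n, (N <= n)%N & \sum_(k <- s)
    nsq (right_commutator (A n) k.1 (e k.2) - right_commutator p k.1 (e k.2)) < 1.
  suff h d : 0 < d -> exists K, forall n, (K <= n)%N -> \sum_(k <- s)
      nsq (right_commutator (A n) k.1 (e k.2) - right_commutator p k.1 (e k.2)) < d.
    have [K hK] := h 1 ltr01.
    by exists (maxn N K); [exact: leq_maxl|apply: hK; exact: leq_maxr].
  elim: s {us} d => [|k s IH] d d0.
    by exists 0%N => n _; rewrite big_nil.
  have d2 : 0 < d / 2 by rewrite divr_gt0.
  have [K1 h1] := IH _ d2; have [K2 h2] := ccvg k.1 k.2 _ d2.
  exists (maxn K1 K2) => n; rewrite geq_max big_cons => /andP[/h1 lt1 /h2 lt2].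
  by rewrite [ltRHS]splitr; exact: ltrD.
(* The finite set [s] of pairs is enclosed in a rectangle, the shape for which [comm_bound] is
   stated. *)
pose rI := undup [seq k.1 | k <- s]; pose rW := undup [seq k.2 | k <- s].
have le1 : \sum_(k <- s) nsq (right_commutator (A n) k.1 (e k.2)) <= 2 + 2 * deriv_normsq aN.
  apply: le_trans (comm_bound n rI rW Nn (undup_uniq _) (undup_uniq _)).
  rewrite [leRHS](_ : _ = \sum_(k <- [seq (i, w) | i <- rI, w <- rW])
      nsq (right_commutator (A n) k.1 (e k.2))); last by rewrite big_allpairs_dep.
  apply: le_sum_subset => //.
  - by move=> k; exact: (nsq_ge0 dotE).
  - by apply: allpairs_uniq; [exact: undup_uniq..|move=> [? ?] [? ?] _ _ /= [-> ->]].
  - move=> [i w] kin; apply/allpairsP; exists (i, w); split=> //=.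
      by rewrite mem_undup; apply/mapP; exists (i, w).
    by rewrite mem_undup; apply/mapP; exists (i, w).
apply: (@le_trans _ _ (2 * (\sum_(k <- s)
    nsq (right_commutator (A n) k.1 (e k.2) - right_commutator p k.1 (e k.2))) +
    2 * (\sum_(k <- s) nsq (right_commutator (A n) k.1 (e k.2))))); last by rewrite /M; lra.
rewrite !mulr_sumr -big_split; apply: ler_sum => k _ /=.
rewrite -{1}[right_commutator p _ _](subrK (right_commutator (A n) k.1 (e k.2))).
by apply: le_trans (nsqD_le dotE _ _) _; rewrite nsq_subC.
Qed.

End Words.

(** * Triviality of projections in the domain of the derivative *)

Section MainTheorem.
Variables (R : realType) (F : full_fock R).
Local Notation dot := (@fdot R F).
Local Notation dotE := (@fdotE R F).
Local Notation nsq := (sqnorm dot).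
Local Notation adjoint := (is_adjoint dot).
Local Notation Om := (vacuum F).

Lemma D12_const (A : F -> F) : malliavin A (fun=> [::]) -> D12 A.
Proof.
have adj0 : exists B : F -> F, adjoint (A - A) B.
  by exists 0 => x y; rewrite subrr dot0l dot0r.
have tau0 : complex.Re (tau_dot (A - A) (A - A)) = 0.
  by rewrite tau_dotE// -/(sqnorm _ _) subrr; exact: nsq0.
move=> mA; exists (fun=> A), (fun _ _ => [::]); split=> //.
  move=> d d0; exists 0%N => m n _ _.
  rewrite /norm12sq tau0 add0e /B2_normsq integral0_eq// => t _.
  by rewrite /tensor_dot big_nil.
by rewrite tau0; exact: cvg_cst.
Qed.

Lemma SC_projection_trivial (p : F -> F) : SC p -> is_projection p -> D12 p ->
  p = 0 \/ p = idfun.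
Proof.
move=> SCp [p_sa pp] Dp; have p_idem x : p (p x) = p x by rewrite -[in RHS]pp.
have [I [xi [xi_real xi_on xi_total]]] := real_orthonormal_basis F.
have xi1 i : nsq (xi i) = 1 by rewrite /sqnorm xi_on eqxx.
have p_comm i x := right_semicircular_SC (xi_real i) (xi1 i) x SCp.
have hs_fin := D12_commutator xi_real xi_on xi_total SCp p_sa Dp.
have [n [m nm]] := projection_trace_integral xi_real xi_on xi_total p_sa p_idem p_comm hs_fin.
pose p' x := x - p x.
have p'_sa : adjoint p' p' by move=> x y; rewrite /p' dotBl dotBr p_sa.
have p'_comm i x : right_semicircular (xi i) (p' x) = p' (right_semicircular (xi i) x).
  rewrite /p' -p_comm.
  exact: (adjoint_morphB dotE _ _ (right_semicircular_adjoint (xi_real i) (xi1 i))).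
have pyth : nsq (p Om) + nsq (p' Om) = 1.
  have -> : 1 = nsq Om by rewrite /sqnorm dot_vacuum.
  have := nsqD dot (Om - p Om) (p Om); rewrite subrK => ->.
  have -> : dot (Om - p Om) (p Om) = 0 by rewrite dotBl p_sa p_idem subrr.
  by rewrite mulr0 addr0 addrC.
have p0 := nsq_ge0 dotE (p Om); have p'0 := nsq_ge0 dotE (p' Om).
(* By [pyth], [nsq (p Om)] lies between 0 and 1; being an integer it is 0 or 1, so [p] or [1 - p]
   kills the vacuum. *)
have [nm'|nm'] : n = m \/ n = m.+1.
  have : (m%:R <= n%:R :> R) /\ (n%:R <= m.+1%:R :> R).
    by rewrite -natr1; split; lra.
  rewrite !ler_nat => -[]; rewrite leq_eqVlt => /orP[/eqP->|]; first by left.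
  by move=> mn nm'; right; apply/eqP; rewrite eqn_leq nm' mn.
- left; apply/funext => x.
  have [//|[]] := vacuum_separating xi_real xi_on xi_total p_sa p_comm.
  by apply: (nsq_eq0 dotE); move: nm; rewrite nm'; lra.
- right; apply/funext => x.
  have [h|[]] := vacuum_separating xi_real xi_on xi_total p'_sa p'_comm.
    exact/esym/subr0_eq/h.
  by apply: (nsq_eq0 dotE); move: nm; rewrite nm' -natr1; lra.
Qed.

End MainTheorem.

Theorem proposition14 (R : realType) (F : full_fock R) (p : F -> F) :
  SC p -> is_projection p -> (D12 p <-> p = 0 \/ p = idfun).
Proof.
move=> SCp pp; split; first exact: SC_projection_trivial.
case=> ->; last by apply: D12_const; exact: malliavin1.
(* Zero enters the algebra as 0 times the identity, and scaling the empty tensor leaves it empty. *)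
apply: D12_const; rewrite -(scale0r (idfun : F -> F)).
exact: (malliavinZ 0 (malliavin1 F)).
Qed.
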